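(* Let $\Xi'\subseteq\Xi\subseteq\Pi$. Then $A_\Xi(\mathbf D_F^\star)=(\mathbf D_F^\star)^{W_\Xi}$. Moreover, for any set of coset representatives $W_{\Xi/\Xi'}$ of $W_\Xi/W_{\Xi'}$, the operator $A_{\Xi/\Xi'}$ induces a surjection $(\mathbf D_F^\star)^{W_{\Xi'}}\to(\mathbf D_F^\star)^{W_\Xi}$ (independent of the choice of $W_{\Xi/\Xi'}$).
   Context: Setting. $R$ is a commutative ring with unit and $F\in R[[x,y]]$ is a one-dimensional commutative formal group law. $(\Lambda,\Sigma)$ is a reduced semisimple root datum: $\Lambda$ is a free abelian group of finite rank, $\Sigma\subset\Lambda$ is the finite set of roots with coroots $\alpha^\vee\in\Lambda^\vee$, and $\Sigma$ spans $\Lambda\otimes\mathbb Q$. $\Pi=\{\alpha_1,\dots,\alpha_n\}$ is a set of simple roots, $\Sigma^{\pm}$ are the positive/negative roots, $W$ is the Weyl group generated by $s_\alpha(\lambda)=\lambda-\alpha^\vee(\lambda)\alpha$, $s_i=s_{\alpha_i}$. The formal group algebra $S=R[[\Lambda]]_F$ is the quotient of $R[[x_\lambda,\lambda\in\Lambda]]$ (completion of the polynomial ring at the augmentation ideal) by the closure of the ideal generated by $x_0$ and all $x_{\lambda+\mu}-F(x_\lambda,x_\mu)$; $W$ acts by $w(x_\lambda)=x_{w(\lambda)}$. Standing assumption: $x_\alpha$ is not a zero divisor in $S$ for all $\alpha\in\Sigma$. $Q=S[x_\alpha^{-1}\mid\alpha\in\Sigma]$. $Q_W$ is the free left $Q$-module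 with basis $(\delta_w)_{w\in W}$ and product $(q\delta_w)(q'\delta_{w'})=q\,w(q')\,\delta_{ww'}$. Put $X_i=\frac1{x_{\alpha_i}}(1-\delta_{s_i})$. $\mathbf D_F\subseteq Q_W$ is the $R$-subalgebra generated by $S$ and $X_1,\dots,X_n$. $Q_W^*=\mathrm{Hom}_Q(Q_W,Q)$ (left $Q$-linear maps). $Q_W$ acts on the left on $Q_W^*$ by $(z\bullet f)(z')=f(z'z)$; $W$ acts by $w(f)=\delta_w\bullet f$, and invariants are with respect to this action. $\mathbf D_F^\star=\mathrm{Hom}_S(\mathbf D_F,S)$ is identified with $\{f\in Q_W^*\mid f(\mathbf D_F)\subseteq S\}$. For $\Xi\subseteq\Pi$: $W_\Xi$ is the subgroup generated by $s_\alpha$, $\alpha\in\Xi$; $\Sigma_\Xi^-=\{\alpha\in\Sigma^-\mid s_\alpha\in W_\Xi\}$; for $\Xi'\subseteq\Xi$, $x_{\Xi/\Xi'}=\prod_{\alpha\in\Sigma_\Xi^-\setminus\Sigma_{\Xi'}^-}x_\alpha$. For a set $W_{\Xi/\Xi'}$ of representatives of the left cosets $W_\Xi/W_{\Xi'}$, $Y_{\Xi/\Xi'}=\big(\sum_{w\in W_{\Xi/\Xi'}}\delta_w\big)\frac1{x_{\Xi/\Xi'}}\in Q_W$ and $A_{\Xi/\Xi'}(f)=Y_{\Xi/\Xi'}\bullet f$ for $f\in Q_W^*$; $A_\Xi=A_{\Xi/\emptyset}$. *)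

(* Defs.v *)
Set Warnings "-notation-overridden,-ambiguous-paths,-notation-incompatible-prefix,-redundant-canonical-projection".
From HB Require Import structures.
From mathcomp Require Import all_boot all_order all_algebra all_fingroup.
From mathcomp Require Import finmap multiset ring.
From mathcomp Require Import boolp classical_sets functions cardinality.

Set Implicit Arguments.
Unset Strict Implicit.
Unset Printing Implicit Defensive.

Import GRing.Theory.
Local Open Scope mset_scope.
Local Open Scope classical_set_scope.
Local Open Scope ring_scope.

Section Submultisets.
Variable I : choiceType.
Implicit Types m a b : {mset I}.

(* The divisors of the monomial m, without repetition. *)
Definition msub m : seq {mset I} :=
  undup [seq seq_mset (mask (tval t) (enum_mset m)) | t : (size m).-tuple bool].

Lemma size_msetD a b : size (a `+` b)%mset = (size a + size b)%N.
Proof.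
suff /perm_size -> : perm_eq (a `+` b)%mset (enum_mset a ++ enum_mset b).
  by rewrite size_cat.
apply/allP => x _ /=; rewrite count_cat !count_mem_mset.
by rewrite msetE2.
Qed.

Lemma size_seq_mset (s : seq I) : size (seq_mset s) = size s.
Proof. exact/perm_size/perm_eq_seq_mset. Qed.

Lemma mem_msub m a : (a \in msub m) = (a `<=` m)%mset.
Proof.
rewrite mem_undup; apply/mapP/msubsetP => [[t _ ->] x|am].
  rewrite mset_seqE -(count_mem_mset x m).
  by rewrite -[X in (_ <= count _ X)%N]/(enum_mset m); apply/leq_count_subseq/mask_subseq.
have /count_subseqP [s /subseqP[b sb ->]] :
    forall x, (count_mem x (enum_mset a) <= count_mem x (enum_mset m))%N.
  by move=> x; rewrite !count_mem_mset.
move=> /eq_seq_msetP; rewrite seq_mset_id => ->.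
by exists (Tuple (introT eqP sb)); rewrite ?mem_enum.
Qed.

Lemma msub_uniq m : uniq (msub m). Proof. exact: undup_uniq. Qed.

End Submultisets.

Section Series.
Variables (R : comPzRingType) (I : choiceType).

(* The completion of R[x_i, i in I] at the ideal (x_i, i in I): formal power
   series having only finitely many monomials in each degree (a condition that
   matters since I may be infinite). Monomials are multisets of variables, and
   the size of a multiset is the degree of the monomial. *)
Record series := Series {
  scoef :> {mset I} -> R;
  _ : forall d, finite_set [set m : {mset I} | (size m <= d)%N /\ scoef m != 0] }.

HB.instance Definition _ := gen_eqMixin series.
HB.instance Definition _ := gen_choiceMixin series.

Lemma seriesP (f g : series) : (forall m, f m = g m) <-> f = g.
Proof.
split=> [|-> //]; case: f g => [f Pf] [g Pg] /= /funext fg.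
by subst g; congr Series; apply: Prop_irrelevance.
Qed.

Lemma series_fin (f : series) d :
  finite_set [set m : {mset I} | (size m <= d)%N /\ f m != 0].
Proof. by case: f. Qed.

Lemma szero_fin d :
  finite_set [set m : {mset I} | (size m <= d)%N /\ (0 : R) != 0].
Proof.
by apply: (@sub_finite_set _ _ set0) => // m [_]; rewrite eqxx.
Qed.
Definition szero := Series szero_fin.

Lemma sopp_fin (f : series) d :
  finite_set [set m : {mset I} | (size m <= d)%N /\ - f m != 0].
Proof.
by apply: sub_finite_set (series_fin f d) => m /= [md]; rewrite oppr_eq0.
Qed.
Definition sopp f := Series (sopp_fin f).

Lemma sadd_fin (f g : series) d :
  finite_set [set m : {mset I} | (size m <= d)%N /\ f m + g m != 0].
Proof.
have := conj (series_fin f d) (series_fin g d).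
rewrite -finite_setU; apply: sub_finite_set => m /= [md fg].
have [f0|f0] := eqVneq (f m) 0; last by left.
by right; split=> //; rewrite f0 add0r in fg.
Qed.
Definition sadd f g := Series (sadd_fin f g).

Fact saddA : associative sadd.
Proof. by move=> f g h; apply/seriesP => m /=; rewrite addrA. Qed.
Fact saddC : commutative sadd.
Proof. by move=> f g; apply/seriesP => m /=; rewrite addrC. Qed.
Fact sadd0 : left_id szero sadd.
Proof. by move=> f; apply/seriesP => m /=; rewrite add0r. Qed.
Fact saddN : left_inverse szero sopp sadd.
Proof. by move=> f; apply/seriesP => m /=; rewrite addNr. Qed.

HB.instance Definition _ := GRing.isZmodule.Build series saddA saddC sadd0 saddN.

Lemma smul_fin (f g : series) d :
  finite_set [set m : {mset I} | (size m <= d)%N /\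
    \sum_(a <- msub m) f a * g (m `\` a)%mset != 0].
Proof.
have fin := finite_setX (series_fin f d) (series_fin g d).
apply: sub_finite_set (finite_image (fun p => (p.1 `+` p.2)%mset) fin).
move=> m /= [md].
apply: contra_neqP => nex; rewrite big_seq big1 // => a.
rewrite mem_msub => am; apply: contra_notP nex => /eqP fg.
have am' : m = (a `+` (m `\` a))%mset by rewrite msetBDKC.
have sm : (size (a : {mset I}) + size (m `\` a)%mset <= d)%N.
  by rewrite -size_msetD -am'.
exists (a, (m `\` a)%mset) => //=; split; split.
- by apply: leq_trans sm; rewrite leq_addr.
- by apply: contraNneq fg => ->; rewrite mul0r.
- by apply: leq_trans sm; rewrite leq_addl.
- by apply: contraNneq fg => ->; rewrite mulr0.
Qed.
Definition smul f g := Series (smul_fin f g).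

Lemma sconst_fin c d :
  finite_set [set m : {mset I} |
    (size m <= d)%N /\ (if m == mset0 then c : R else 0) != 0].
Proof.
apply: (@sub_finite_set _ _ [set mset0]) => // m [_].
by case: (m =P _) => // _; rewrite eqxx.
Qed.
Definition sconst c := Series (sconst_fin c).

Lemma msubBB (m : {mset I}) : perm_eq [seq (m `\` a)%mset | a <- msub m] (msub m).
Proof.
apply: uniq_perm; rewrite ?msub_uniq //.
  rewrite map_inj_in_uniq ?msub_uniq // => a b; rewrite !mem_msub => am bm e.
  by rewrite -(msetBBK am) e msetBBK.
move=> a; apply/mapP/idP => [[b bm ->]|am].
  by rewrite mem_msub msubsetDl.
exists (m `\` a)%mset; rewrite ?mem_msub ?msubsetDl //.
by rewrite msetBBK -?mem_msub.
Qed.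

Fact smulC : commutative smul.
Proof.
move=> f g; apply/seriesP => m /=.
rewrite -(perm_big _ (msubBB m)) big_map; rewrite big_seq [RHS]big_seq.
apply: eq_bigr => a; rewrite mem_msub => am.
by rewrite msetBBK // mulrC.
Qed.

Fact smul1 : left_id (sconst 1) smul.
Proof.
move=> f; apply/seriesP => m /=.
rewrite (bigD1_seq mset0) ?msub_uniq ?mem_msub ?msub0set //=.
rewrite eqxx mul1r msetB0 big1 ?addr0 // => a a0.
by rewrite (negPf a0) mul0r.
Qed.

Fact smulDl : left_distributive smul sadd.
Proof.
move=> f g h; apply/seriesP => m /=.
by rewrite -big_split; apply: eq_bigr => a _ /=; rewrite mulrDl.
Qed.

Lemma msub_shift (m a : {mset I}) : (a `<=` m)%mset ->
  perm_eq [seq (a `+` b)%mset | b <- msub (m `\` a)%mset]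
          [seq c <- msub m | (a `<=` c)%mset].
Proof.
move=> am; apply: uniq_perm; rewrite ?filter_uniq ?msub_uniq //.
  rewrite map_inj_uniq ?msub_uniq // => b c /(congr1 (fun d => (d `\` a)%mset)).
  by rewrite !(msetDKB a).
move=> c; rewrite mem_filter mem_msub; apply/mapP/andP => [[b]|[ac cm]].
  rewrite mem_msub => bm ->; split.
    by apply/msubsetP => x; rewrite msetE2 leq_addr.
  by rewrite -(msetBDKC am) msetDS.
exists (c `\` a)%mset; last by rewrite msetBDKC.
by rewrite mem_msub msetSB.
Qed.

Fact smulA : associative smul.
Proof.
move=> f g h; apply/seriesP => m /=.
under eq_bigr do rewrite mulr_sumr.
under [RHS]eq_bigr do rewrite mulr_suml.
have -> : \sum_(c <- msub m) \sum_(a <- msub c) f a * g (c `\` a)%mset * h (m `\` c)%mset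
  = \sum_(c <- msub m) \sum_(a <- msub m | (a `<=` c)%mset)
      f a * g (c `\` a)%mset * h (m `\` c)%mset.
  rewrite big_seq [RHS]big_seq; apply: eq_bigr => c; rewrite mem_msub => cm.
  rewrite -[RHS]big_filter; apply: perm_big; apply: uniq_perm.
  - exact: msub_uniq.
  - by rewrite filter_uniq ?msub_uniq.
  move=> a; rewrite mem_filter !mem_msub; case ac: (a `<=` c)%mset => //=.
  by rewrite (msubset_trans ac cm).
rewrite (exchange_big_dep predT) //= big_seq [RHS]big_seq.
apply: eq_bigr => a; rewrite mem_msub => am.
rewrite -[RHS]big_filter -(perm_big _ (msub_shift am)) big_map.
apply: eq_bigr => b _; rewrite mulrA msetDKB msetBDA.
by [].
Qed.

HB.instance Definition _ :=
  GRing.Zmodule_isComPzRing.Build series smulA smulC smul1 smulDl.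

Lemma svar_fin i d :
  finite_set [set m : {mset I} |
    (size m <= d)%N /\ (if m == [mset i]%mset then 1 : R else 0) != 0].
Proof.
apply: (@sub_finite_set _ _ [set [mset i]%mset]) => // m [_].
by case: (m =P _) => // _; rewrite eqxx.
Qed.
Definition svar i : series := Series (svar_fin i).

(* For F = sum_(i, j) F i j x^i y^j, the series F(u, v), where u and v are meant
   to have zero constant term: its part of degree d then only involves the terms
   with i, j <= d, whence the truncation below. *)
Variable F : nat -> nat -> R.

Definition subst_trunc d (u v : series) : series :=
  \sum_(i < d.+1) \sum_(j < d.+1) sconst (F i j) * u ^+ i * v ^+ j.

Lemma ssubst_fin (u v : series) d :
  finite_set [set m : {mset I} |
    (size m <= d)%N /\ subst_trunc (size m) u v m != 0].
Proof.
pose A e := [set m : {mset I} | (size m <= e)%N /\ subst_trunc e u v m != 0].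
have : finite_set (\bigcup_(e in `I_d.+1) A e).
  by apply: bigcup_finite => // e _; apply: series_fin.
apply: sub_finite_set => m [md h]; exists (size m) => //.
Qed.
Definition ssubst u v : series := Series (ssubst_fin u v).

End Series.

Import VectorInternalTheory.

Section RootDatum.

(* Reduced semisimple root data (SGA 3, XXI). The lattice is a free Z-module of
   finite rank; refl_root and refl_coroot say that the reflections s_a and their
   duals f |-> f - f(a) a^vee stabilize the roots and the coroots, and
   root_semisimple that the roots span the lattice rationally. *)
Record root_datum := RootDatum {
  lattice : vectType int;
  rootset : {fset lattice};
  coroot : rootset -> {scalar lattice};
  coroot_inj : forall a b : rootset, coroot a =1 coroot b -> a = b;
  coroot_root : forall a : rootset, coroot a (fsval a) = 2;
  refl_root : forall a b : rootset,
    fsval b - coroot a (fsval b) *: fsval a \in rootset;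
  refl_coroot : forall a b : rootset, exists c : rootset, forall l,
    coroot c l = coroot b l - coroot b (fsval a) * coroot a l;
  root_reduced : forall a : rootset, fsval a *+ 2 \notin rootset;
  root_semisimple : forall l : lattice, exists2 m : int, m != 0 &
    exists c : rootset -> int, m *: l = \sum_(a : rootset) c a *: fsval a }.

Variable D : root_datum.
Local Notation L := (lattice D).

Definition refl (a : rootset D) (l : L) : L := l - coroot a l *: fsval a.

(* Products of reflections; these form a group since reflections are involutions. *)
Definition in_weyl (w : L -> L) : Prop :=
  exists s : seq (rootset D), forall l, w l = foldr refl l s.

Record weyl := Weyl { weyl_fun :> L -> L; weylP : in_weyl weyl_fun }.

HB.instance Definition _ := gen_eqMixin weyl.
HB.instance Definition _ := gen_choiceMixin weyl.

Lemma weyl_eqP (v w : weyl) : v =1 w <-> v = w.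
Proof.
split=> [|-> //]; case: v w => [v Pv] [w Pw] /= /funext e.
by subst w; congr Weyl; apply: Prop_irrelevance.
Qed.

Lemma refl_linear a : linear (refl a).
Proof.
move=> k u v; rewrite /refl linearP /= scalerDl -scalerA scalerBr.
by rewrite opprD addrACA.
Qed.

Lemma reflK a : involutive (refl a).
Proof.
move=> l; rewrite /refl linearB [coroot a (_ *: _)]linearZ /= coroot_root.
rewrite -addrA -!scaleNr -scalerDl mulr_natr mulr2n opprB addrA addKr.
by rewrite addrN scale0r addr0.
Qed.

Lemma weyl_linear (w : weyl) : linear w.
Proof.
case: w => w [s ws] /= k u v; rewrite !ws; elim: s {ws} => //= a s ->.
by rewrite refl_linear.
Qed.

Lemma weyl_root (w : weyl) (a : rootset D) : w (fsval a) \in rootset D.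
Proof.
case: w => w [s ws] /=; rewrite ws; elim: s {ws} => [|b s IH] /=; first exact: fsvalP.
exact: (refl_root b [` IH]%fset).
Qed.

Definition weyl_on_roots (w : weyl) (a : rootset D) : rootset D :=
  [` weyl_root w a]%fset.

Lemma weyl_sum (w : weyl) (c : rootset D -> int) :
  w (\sum_(a : rootset D) c a *: fsval a) =
  \sum_(a : rootset D) c a *: fsval (weyl_on_roots w a).
Proof.
have w0 : w 0 = 0.
  have := weyl_linear w 1 0 0; rewrite !scale1r addr0 => /esym/eqP.
  by rewrite -subr_eq0 addrK => /eqP.
elim/big_rec2: _ => // a y x _ <-.
by rewrite weyl_linear.
Qed.

Lemma lattice_torsion_free (m : int) (l : L) : m != 0 -> m *: l = 0 -> l = 0.
Proof.
move=> m0 ml; apply: v2r_inj.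
have h : v2r (m *: l) = m *: v2r l.
  exact: linearZZ.
have h0 : v2r (0 : L) = 0 by exact: raddf0.
rewrite h0; apply/rowP => i; apply/eqP; rewrite mxE.
have := congr1 (fun u : 'rV_ _ => u ord0 i) h; rewrite ml h0 !mxE.
by move/esym/eqP; rewrite mulf_eq0 (negPf m0).
Qed.

Lemma weyl_on_roots_inj : injective (fun w => [ffun a => weyl_on_roots w a]).
Proof.
move=> v w /ffunP e; apply/weyl_eqP => l.
have [m m0 [c cl]] := root_semisimple l.
apply/eqP; rewrite -subr_eq0; apply/eqP/(lattice_torsion_free m0).
have scal (u : weyl) : m *: u l = u (m *: l).
  rewrite -[m *: l]addr0 weyl_linear.
  have := weyl_linear u 1 0 0; rewrite !scale1r addr0 => /esym/eqP.
  by rewrite -subr_eq0 addrK => /eqP ->; rewrite addr0.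
rewrite scalerBr !scal cl !weyl_sum -sumrB big1 // => a _.
by have := e a; rewrite !ffunE => ->; rewrite subrr.
Qed.

End RootDatum.

Section WeylGroup.
Variable D : root_datum.
Local Notation W := (weyl D).

Definition weyl_decode (f : {ffun rootset D -> rootset D}) : option W :=
  match pselect (exists w : W, [ffun a => weyl_on_roots w a] = f) with
  | left ex => Some (projT1 (cid ex))
  | right _ => None
  end.

Fact weyl_decodeK : pcancel (fun w : W => [ffun a => weyl_on_roots w a]) weyl_decode.
Proof.
move=> w; rewrite /weyl_decode; case: pselect => [ex|[]]; last by exists w.
by congr Some; apply/weyl_on_roots_inj/(projT2 (cid ex)).
Qed.

HB.instance Definition _ := PCanIsCountable weyl_decodeK.
HB.instance Definition _ : isFinite W := PCanIsFinite weyl_decodeK.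

Fact weyl1P : in_weyl (id : lattice D -> lattice D).
Proof. by exists [::]. Qed.
Definition weyl1 : W := Weyl weyl1P.

Fact weyl_mulP (v w : W) : in_weyl (v \o w).
Proof.
case: v w => [v [s vs]] [w [t wt]]; exists (s ++ t) => l /=.
by rewrite vs wt foldr_cat.
Qed.
Definition weyl_mul (v w : W) : W := Weyl (weyl_mulP v w).

Fact weyl_inv_ex (w : W) : exists v : W, cancel w v.
Proof.
case: w => w [s ws]; have vP : in_weyl (fun l => foldr (@refl D) l (rev s)).
  by exists (rev s).
exists (Weyl vP) => l /=; rewrite ws; elim: s {ws vP} => //= a s IH.
by rewrite rev_cons -cats1 foldr_cat /= reflK.
Qed.
Definition weyl_inv (w : W) : W := projT1 (cid (weyl_inv_ex w)).

Fact weyl_mulA : associative weyl_mul.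
Proof. by move=> u v w; apply/weyl_eqP. Qed.
Fact weyl_mul1 : left_id weyl1 weyl_mul.
Proof. by move=> w; apply/weyl_eqP. Qed.
Fact weyl_mulV : left_inverse weyl1 weyl_inv weyl_mul.
Proof.
by move=> w; apply/weyl_eqP => l /=; rewrite /weyl_inv; case: cid => v /= ->.
Qed.

HB.instance Definition _ := Finite_isGroup.Build W weyl_mulA weyl_mul1 weyl_mulV.

Fact weyl_reflP (a : rootset D) : in_weyl (refl a).
Proof. by exists [:: a]. Qed.
Definition weyl_refl a : W := Weyl (weyl_reflP a).

Lemma weyl_on_roots_refl (a : rootset D) (w: W) : fsval (weyl_on_roots w a) = w (fsval a).
Proof. by []. Qed.

Lemma weylM (v w : W) l : (v * w)%g l = v (w l).
Proof. by []. Qed.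
Lemma weylK (w : W) : cancel w (w^-1)%g.
Proof. by move=> l; rewrite -weylM mulVg. Qed.
Lemma weylKV (w : W) : cancel (w^-1)%g w.
Proof. by move=> l; rewrite -weylM mulgV. Qed.

End WeylGroup.

Section Localization.
Variables (A : comPzRingType) (T : choiceType) (x : T -> A).

Definition den (u : seq T) : A := \prod_(t <- u) x t.

Lemma den_cat u v : den (u ++ v) = den u * den v.
Proof. exact: big_cat. Qed.

Definition loc_equiv (p q : A * seq T) : bool :=
  `[< exists v, den v * (p.1 * den q.2) = den v * (q.1 * den p.2) >].

Fact loc_equivP : equiv_class_of loc_equiv.
Proof.
split=> [p|p q|q p r].
- by apply/asboolP; exists [::].
- by apply/asboolP/asboolP => -[v e]; exists v.
move=> /asboolP[v e] /asboolP[w f]; apply/asboolP; exists (v ++ w ++ q.2).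
rewrite !den_cat.
transitivity (den w * den r.2 * (den v * (p.1 * den q.2))); first by ring.
rewrite e; transitivity (den v * den p.2 * (den w * (q.1 * den r.2))); first by ring.
by rewrite f; ring.
Qed.
Canonical loc_equiv_rel := EquivRelPack loc_equivP.

(* The localization A[1 / x t, t in T]; frac s [:: t1; ...; tk] stands for
   s / (x t1 * ... * x tk). *)
Definition loc : Type := {eq_quot loc_equiv_rel}%qT.
HB.instance Definition _ := Choice.on loc.
HB.instance Definition _ := EqQuotient.on loc.

Definition frac (s : A) (u : seq T) : loc := (\pi_loc (s, u))%qT.

Lemma frac_eq s u s' u' : frac s u = frac s' u' <->
  exists v, den v * (s * den u') = den v * (s' * den u).
Proof. by split=> [/eqmodP/asboolP|h]; last exact/eqmodP/asboolP. Qed.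

Definition numer (p : loc) : A := (generic_quotient.repr p).1.
Definition denom (p : loc) : seq T := (generic_quotient.repr p).2.

Lemma fracK p : frac (numer p) (denom p) = p.
Proof. by rewrite /frac -surjective_pairing reprK. Qed.

Lemma loc_ind (P : loc -> Prop) : (forall s u, P (frac s u)) -> forall p, P p.
Proof. by move=> h p; rewrite -(fracK p). Qed.

Lemma frac_repr s u : exists v,
  den v * (numer (frac s u) * den u) = den v * (s * den (denom (frac s u))).
Proof. exact/frac_eq/fracK. Qed.

Definition loc_zero := frac 0 [::].
Definition loc_one := frac 1 [::].
Definition loc_opp p := frac (- numer p) (denom p).
Definition loc_add p q :=
  frac (numer p * den (denom q) + numer q * den (denom p)) (denom p ++ denom q).
Definition loc_mul p q := frac (numer p * numer q) (denom p ++ denom q).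

Lemma opp_frac s u : loc_opp (frac s u) = frac (- s) u.
Proof.
have [v e] := frac_repr s u; apply/frac_eq; exists v.
by rewrite !mulNr !mulrN e.
Qed.

Lemma add_frac s u s' u' :
  loc_add (frac s u) (frac s' u') = frac (s * den u' + s' * den u) (u ++ u').
Proof.
have [v e] := frac_repr s u; have [v' e'] := frac_repr s' u'.
apply/frac_eq; exists (v ++ v'); rewrite !den_cat; move: e e'.
move: (numer (frac s u)) (den (denom (frac s u))) => n d.
move: (numer (frac s' u')) (den (denom (frac s' u'))) => n' d' e e'.
transitivity (den v' * d' * den u' * (den v * (n * den u))
            + den v * d * den u * (den v' * (n' * den u'))); first by ring.
by rewrite e e'; ring.
Qed.

Lemma mul_frac s u s' u' :
  loc_mul (frac s u) (frac s' u') = frac (s * s') (u ++ u').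
Proof.
have [v e] := frac_repr s u; have [v' e'] := frac_repr s' u'.
apply/frac_eq; exists (v ++ v'); rewrite !den_cat; move: e e'.
move: (numer (frac s u)) (den (denom (frac s u))) => n d.
move: (numer (frac s' u')) (den (denom (frac s' u'))) => n' d' e e'.
transitivity ((den v * (n * den u)) * (den v' * (n' * den u'))); first by ring.
by rewrite e e'; ring.
Qed.

Fact loc_addA : associative loc_add.
Proof.
elim/loc_ind=> s u; elim/loc_ind=> s' u'; elim/loc_ind=> s'' u''.
rewrite !add_frac; apply/frac_eq; exists [::]; rewrite !den_cat; ring.
Qed.
Fact loc_addC : commutative loc_add.
Proof.
elim/loc_ind=> s u; elim/loc_ind=> s' u'.
rewrite !add_frac; apply/frac_eq; exists [::]; rewrite !den_cat; ring.
Qed.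
Fact loc_add0 : left_id loc_zero loc_add.
Proof.
elim/loc_ind=> s u.
rewrite !add_frac; apply/frac_eq; exists [::]; rewrite !den_cat /den big_nil; ring.
Qed.
Fact loc_addN : left_inverse loc_zero loc_opp loc_add.
Proof.
elim/loc_ind=> s u.
rewrite opp_frac add_frac; apply/frac_eq; exists [::]; rewrite /den big_nil; ring.
Qed.
Fact loc_mulA : associative loc_mul.
Proof.
elim/loc_ind=> s u; elim/loc_ind=> s' u'; elim/loc_ind=> s'' u''.
by rewrite !mul_frac mulrA catA.
Qed.
Fact loc_mulC : commutative loc_mul.
Proof.
elim/loc_ind=> s u; elim/loc_ind=> s' u'.
rewrite !mul_frac; apply/frac_eq; exists [::]; rewrite !den_cat; ring.
Qed.
Fact loc_mul1 : left_id loc_one loc_mul.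
Proof. by elim/loc_ind=> s u; rewrite mul_frac mul1r. Qed.
Fact loc_mulD : left_distributive loc_mul loc_add.
Proof.
elim/loc_ind=> s u; elim/loc_ind=> s' u'; elim/loc_ind=> s'' u''.
rewrite !(add_frac, mul_frac); apply/frac_eq; exists [::]; rewrite !den_cat; ring.
Qed.

HB.instance Definition _ :=
  GRing.isZmodule.Build loc loc_addA loc_addC loc_add0 loc_addN.
HB.instance Definition _ :=
  GRing.Zmodule_isComPzRing.Build loc loc_mulA loc_mulC loc_mul1 loc_mulD.

End Localization.

Section Ideals.
Variables (R : comPzRingType) (I : choiceType).
Implicit Types (f g : series R I) (G J : set (series R I)).

Definition ideal_gen (A : comPzRingType) (G : set A) : set A :=
  [set f | exists2 s : seq (A * A),
     forall p, p \in s -> G p.2 & f = \sum_(p <- s) p.1 * p.2].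

(* Closure for the topology of the completion, in which the series of order at
   least d, d in nat, form a basis of neighbourhoods of 0. *)
Definition series_closure J : set (series R I) :=
  [set f | forall d, exists2 g, J g &
     forall m : {mset I}, (size m < d)%N -> f m = g m].

Lemma scoefD f g m : (f + g) m = f m + g m. Proof. by []. Qed.
Lemma scoefN f m : (- f) m = - f m. Proof. by []. Qed.
Lemma scoefB f g m : (f - g) m = f m - g m. Proof. by []. Qed.
Lemma scoef0 m : (0 : series R I) m = 0. Proof. by []. Qed.
Lemma scoefM f g (m : {mset I}) :
  (f * g) m = \sum_(a <- msub m) f a * g (m `\` a)%mset.
Proof. by []. Qed.

Lemma closure_gen0 G : series_closure (ideal_gen G) 0.
Proof. by move=> d; exists 0 => //; exists [::]; rewrite ?big_nil. Qed.

Lemma closure_genB G f g : series_closure (ideal_gen G) f ->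
  series_closure (ideal_gen G) g -> series_closure (ideal_gen G) (f - g).
Proof.
move=> hf hg d; have [f' [s sG ->] ff'] := hf d; have [g' [t tG ->] gg'] := hg d.
exists (\sum_(p <- s) p.1 * p.2 - \sum_(p <- t) p.1 * p.2); last first.
  by move=> m md; rewrite !scoefB ff' ?gg'.
exists (s ++ [seq (- p.1, p.2) | p <- t]).
  by move=> p; rewrite mem_cat => /orP[/sG|/mapP[q /tG ? ->]].
rewrite big_cat big_map -sumrN; congr (_ + _).
by apply: eq_bigr => p _; rewrite mulNr.
Qed.

Lemma closure_genM G f g :
  series_closure (ideal_gen G) g -> series_closure (ideal_gen G) (f * g).
Proof.
move=> hg d; have [g' [t tG ->] gg'] := hg d.
exists (f * \sum_(p <- t) p.1 * p.2); last first.
  move=> m md; rewrite !scoefM; apply: eq_big_seq => a.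
  rewrite mem_msub => am; rewrite gg' //; apply: leq_ltn_trans md.
  have <- : size (a `+` (m `\` a))%mset = size m by rewrite msetBDKC.
  by rewrite size_msetD leq_addl.
exists [seq (f * p.1, p.2) | p <- t].
  by move=> p /mapP[q /tG ? ->].
by rewrite big_map mulr_sumr; apply: eq_bigr => p _; rewrite mulrA.
Qed.

End Ideals.

(* One-dimensional commutative formal group laws, given by the coefficients of
   F in R[[x, y]]; the axioms are identities in R[[x, y, z]]. *)
Record fgl (R : comPzRingType) := FGL {
  fgl_coef :> nat -> nat -> R;
  fgl_unit : let x := svar R (inord 0 : 'I_3) in
    ssubst fgl_coef x 0 = x;
  fgl_comm : let x := svar R (inord 0 : 'I_3) in let y := svar R (inord 1 : 'I_3) in
    ssubst fgl_coef x y = ssubst fgl_coef y x;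
  fgl_assoc : let x := svar R (inord 0 : 'I_3) in let y := svar R (inord 1 : 'I_3) in
    let z := svar R (inord 2 : 'I_3) in
    ssubst fgl_coef (ssubst fgl_coef x y) z = ssubst fgl_coef x (ssubst fgl_coef y z) }.

Section FGA.
Variables (R : comPzRingType) (F : fgl R) (D : root_datum).
Local Notation L := (lattice D).
Local Notation W := (weyl D).
Local Notation PS := (series R L).

Definition fga_relation : set PS :=
  [set f | f = svar R (0 : L) \/
     exists l m : L, f = svar R (l + m) - ssubst F (svar R l) (svar R m)].

Definition fga_ideal : {pred PS} :=
  fun f => `[< series_closure (ideal_gen fga_relation) f >].

Fact fga_ideal_closed : zmod_closed fga_ideal.
Proof.
split; first exact/asboolP/closure_gen0.
by move=> f g /asboolP hf /asboolP hg; apply/asboolP/closure_genB.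
Qed.
HB.instance Definition _ := GRing.isZmodClosed.Build PS fga_ideal fga_ideal_closed.

Lemma fga_idealM f g : g \in fga_ideal -> f * g \in fga_ideal.
Proof. by move=> /asboolP hg; apply/asboolP/closure_genM. Qed.

(* The formal group algebra R[[lattice]]_F. *)
Definition fga : Type := {ideal_quot fga_ideal}.
HB.instance Definition _ := GRing.Zmodule.on fga.
HB.instance Definition _ := EqQuotient.on fga.

Definition fga_pi (f : PS) : fga := (\pi_fga f)%qT.

Lemma fga_piK (s : fga) : fga_pi (generic_quotient.repr s) = s.
Proof. exact: reprK. Qed.

Lemma fga_pi_eq f g : fga_pi f = fga_pi g <-> f - g \in fga_ideal.
Proof. by rewrite Quotient.idealrBE; split=> /eqP. Qed.

Lemma fga_pi_is_zmod_morphism : zmod_morphism fga_pi.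
Proof. exact: raddfB. Qed.

Definition fga_one : fga := fga_pi 1.
Definition fga_mul (s t : fga) : fga :=
  fga_pi (generic_quotient.repr s * generic_quotient.repr t).

Lemma fga_pi_mul f g : fga_mul (fga_pi f) (fga_pi g) = fga_pi (f * g).
Proof.
apply/fga_pi_eq; set f' := generic_quotient.repr _; set g' := generic_quotient.repr _.
have hf : f' - f \in fga_ideal by apply/fga_pi_eq/fga_piK.
have hg : g' - g \in fga_ideal by apply/fga_pi_eq/fga_piK.
have -> : f' * g' - f * g = f' * (g' - g) + g * (f' - f) by ring.
by rewrite rpredD ?fga_idealM.
Qed.

Fact fga_mulA : associative fga_mul.
Proof.
move=> s t u; rewrite -(fga_piK s) -(fga_piK t) -(fga_piK u).
by rewrite !fga_pi_mul mulrA.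
Qed.
Fact fga_mulC : commutative fga_mul.
Proof. by move=> s t; rewrite /fga_mul mulrC. Qed.
Fact fga_mul1 : left_id fga_one fga_mul.
Proof. by move=> s; rewrite -(fga_piK s) fga_pi_mul mul1r. Qed.
Fact fga_mulD : left_distributive fga_mul +%R.
Proof.
move=> s t u; rewrite -(fga_piK s) -(fga_piK t) -(fga_piK u).
have piD f g : fga_pi f + fga_pi g = fga_pi (f + g) by rewrite [RHS]raddfD.
by rewrite !(piD, fga_pi_mul) mulrDl.
Qed.
HB.instance Definition _ :=
  GRing.Zmodule_isComPzRing.Build fga fga_mulA fga_mulC fga_mul1 fga_mulD.

HB.instance Definition _ := GRing.isZmodMorphism.Build PS fga fga_pi
  fga_pi_is_zmod_morphism.
Fact fga_pi_is_monoid_morphism : monoid_morphism fga_pi.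
Proof. by split=> // f g; rewrite -fga_pi_mul. Qed.
HB.instance Definition _ := GRing.isMonoidMorphism.Build PS fga fga_pi
  fga_pi_is_monoid_morphism.

Definition fga_x (l : L) : fga := fga_pi (svar R l).
Definition fga_const (c : R) : fga := fga_pi (sconst L c).

End FGA.

Arguments fga_ideal {R} F D.
Arguments fga_pi {R} F {D} f.
Arguments fga_x {R} F {D} l.
Arguments fga_const {R} F D c.

Section WeylAction.
Variables (R : comPzRingType) (D : root_datum).
Local Notation L := (lattice D).
Local Notation W := (weyl D).
Local Notation PS := (series R L).
Implicit Types (w : W) (m a : {mset L}) (f g : PS).

Definition weyl_mset w m : {mset L} := seq_mset (map w m).

Lemma weyl_msetE w m l : weyl_mset w m l = m ((w^-1)%g l).
Proof.
rewrite mset_seqE count_map -(count_mem_mset ((w^-1)%g l) m).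
by apply: eq_count => k /=; rewrite -(can2_eq (weylK w) (weylKV w)).
Qed.

Lemma size_weyl_mset w m : size (weyl_mset w m) = size m.
Proof. by rewrite size_seq_mset size_map. Qed.

Lemma weyl_msetM v w m : weyl_mset (v * w)%g m = weyl_mset v (weyl_mset w m).
Proof. by apply/msetP => l; rewrite !weyl_msetE invMg weylM. Qed.

Lemma weyl_mset1 m : weyl_mset 1%g m = m.
Proof. by apply/msetP => l; rewrite !weyl_msetE invg1. Qed.

Lemma weyl_msetK w : cancel (weyl_mset w) (weyl_mset (w^-1)%g).
Proof. by move=> m; rewrite -weyl_msetM mulVg weyl_mset1. Qed.

Lemma weyl_msetB w m a :
  weyl_mset w (m `\` a)%mset = (weyl_mset w m `\` weyl_mset w a)%mset.
Proof. by apply/msetP => l; rewrite !msetE2 !weyl_msetE msetE2. Qed.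

Lemma weyl_msub w m :
  perm_eq [seq weyl_mset w a | a <- msub m] (msub (weyl_mset w m)).
Proof.
have sub v b c : (b `<=` c)%mset -> (weyl_mset v b `<=` weyl_mset v c)%mset.
  by move=> /msubsetP bc; apply/msubsetP => l; rewrite !weyl_msetE.
apply: uniq_perm; rewrite ?msub_uniq //.
  by rewrite map_inj_uniq ?msub_uniq //; apply/can_inj/weyl_msetK.
move=> a; apply/mapP/idP => [[b]|]; rewrite !mem_msub.
  by move=> bm ->; apply: sub.
move=> am; exists (weyl_mset (w^-1)%g a); rewrite ?mem_msub.
  by rewrite -(weyl_msetK w m); apply: sub.
by rewrite -{1}[w]invgK weyl_msetK.
Qed.

Lemma weyl_series_fin w f d :
  finite_set [set m : {mset L} |
    (size m <= d)%N /\ f (weyl_mset (w^-1)%g m) != 0].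
Proof.
apply: sub_finite_set (finite_image (weyl_mset w) (series_fin f d)).
move=> m /= [md fm]; exists (weyl_mset (w^-1)%g m).
  by rewrite size_weyl_mset.
by rewrite -{1}[w]invgK weyl_msetK.
Qed.
(* The action w(x_l) = x_(w l); see weyl_series_var. *)
Definition weyl_series w f : PS := Series (weyl_series_fin w f).

Lemma weyl_series_is_zmod_morphism w : zmod_morphism (weyl_series w).
Proof. by move=> f g; apply/seriesP. Qed.
HB.instance Definition _ w := GRing.isZmodMorphism.Build PS PS (weyl_series w)
  (weyl_series_is_zmod_morphism w).

Lemma weyl_series_const w c : weyl_series w (sconst L c) = sconst L c.
Proof.
apply/seriesP => m /=; congr (if _ then _ else _).
by rewrite -!size_mset_eq0 size_weyl_mset.
Qed.

Fact weyl_series_is_monoid_morphism w : monoid_morphism (weyl_series w).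
Proof.
split=> [|f g]; first exact: weyl_series_const.
apply/seriesP => m /=; rewrite -(perm_big _ (weyl_msub _ m)) big_map.
by apply: eq_bigr => a _; rewrite weyl_msetB.
Qed.
HB.instance Definition _ w := GRing.isMonoidMorphism.Build PS PS (weyl_series w)
  (weyl_series_is_monoid_morphism w).

Lemma weyl_series_var w l : weyl_series w (svar R l) = svar R (w l).
Proof.
apply/seriesP => m /=; congr (if _ then _ else _).
have -> : [mset w l]%mset = weyl_mset w [mset l]%mset.
  by rewrite /weyl_mset enum_msetn /= mset_cons; apply/msetP => k;
     rewrite msetE2 mset_seqE addn0.
by rewrite -(can_eq (weyl_msetK w)) -{1}[w]invgK weyl_msetK.
Qed.

Lemma weyl_series_subst (F : nat -> nat -> R) w f g :
  weyl_series w (ssubst F f g) = ssubst F (weyl_series w f) (weyl_series w g).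
Proof.
apply/seriesP => m /=; rewrite size_weyl_mset.
have -> : subst_trunc F (size m) (weyl_series w f) (weyl_series w g)
  = weyl_series w (subst_trunc F (size m) f g) by
  rewrite /subst_trunc rmorph_sum; apply: eq_bigr => i _;
  rewrite rmorph_sum; apply: eq_bigr => j _;
  rewrite !rmorphM !rmorphXn /= weyl_series_const.
by [].
Qed.

Lemma weyl_series1 f : weyl_series 1%g f = f.
Proof. by apply/seriesP => m /=; rewrite invg1 weyl_mset1. Qed.

Lemma weyl_seriesM v w f : weyl_series (v * w)%g f = weyl_series v (weyl_series w f).
Proof. by apply/seriesP => m /=; rewrite invMg weyl_msetM. Qed.

Variable F : fgl R.
Local Notation S := (fga F D).

Lemma weyl_series_ideal w f : f \in fga_ideal F D -> weyl_series w f \in fga_ideal F D.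
Proof.
move=> /asboolP h; apply/asboolP => d; have [_ [s sG ->] fg] := h d.
exists (weyl_series w (\sum_(p <- s) p.1 * p.2)); last first.
  by move=> m md /=; rewrite fg // size_weyl_mset.
exists [seq (weyl_series w p.1, weyl_series w p.2) | p <- s].
  move=> p /mapP[q /sG Gq ->] /=; case: Gq => [->|[l [k ->]]]; [left|right].
    rewrite weyl_series_var; congr svar.
    by have := weyl_sum w (fun=> 0); rewrite !big1 // => a _; rewrite scale0r.
  exists (w l), (w k); rewrite raddfB /= weyl_series_subst !weyl_series_var.
  by have := weyl_linear w 1 l k; rewrite !scale1r => ->.
rewrite rmorph_sum big_map; apply: eq_bigr => p _; exact: rmorphM.
Qed.

(* Independent of the representative by weyl_fga_pi. *)
Definition weyl_fga w (s : S) : S :=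
  fga_pi F (weyl_series w (generic_quotient.repr s)).

Lemma weyl_fga_pi w f : weyl_fga w (fga_pi F f) = fga_pi F (weyl_series w f).
Proof.
apply/fga_pi_eq; rewrite -raddfB; apply: weyl_series_ideal.
exact/fga_pi_eq/fga_piK.
Qed.

Fact weyl_fga_is_zmod_morphism w : zmod_morphism (weyl_fga w).
Proof.
move=> s t; rewrite -(fga_piK s) -(fga_piK t).
by rewrite -raddfB !weyl_fga_pi /= !raddfB.
Qed.
HB.instance Definition _ w := GRing.isZmodMorphism.Build S S (weyl_fga w)
  (weyl_fga_is_zmod_morphism w).
Fact weyl_fga_is_monoid_morphism w : monoid_morphism (weyl_fga w).
Proof.
split=> [|s t].
  by rewrite -(rmorph1 (fga_pi F)) weyl_fga_pi /= rmorph1.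
rewrite -(fga_piK s) -(fga_piK t).
by rewrite -rmorphM !weyl_fga_pi /= !rmorphM.
Qed.
HB.instance Definition _ w := GRing.isMonoidMorphism.Build S S (weyl_fga w)
  (weyl_fga_is_monoid_morphism w).

Lemma weyl_fga1 s : weyl_fga 1%g s = s.
Proof. by rewrite -(fga_piK s) weyl_fga_pi weyl_series1. Qed.
Lemma weyl_fgaM v w s : weyl_fga (v * w)%g s = weyl_fga v (weyl_fga w s).
Proof. by rewrite -(fga_piK s) !weyl_fga_pi weyl_seriesM. Qed.
Lemma weyl_fga_x w l : weyl_fga w (fga_x F l) = fga_x F (w l).
Proof. by rewrite /fga_x weyl_fga_pi weyl_series_var. Qed.

End WeylAction.

Lemma scalar_ext (A : pzRingType) (V : lmodType A) (f g : {scalar V}) :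
  f =1 g -> f = g.
Proof.
case: f => f [[[f0 fD]] [fZ]]; case: g => g [[[g0 gD]] [gZ]] /= /funext e.
subst g.
by rewrite (Prop_irrelevance f0 g0) (Prop_irrelevance fD gD) (Prop_irrelevance fZ gZ).
Qed.

Section TwistedAlgebra.
Variables (R : comPzRingType) (F : fgl R) (D : root_datum).
Local Notation W := (weyl D).
Local Notation S := (fga F D).

Definition fga_root (a : rootset D) : S := fga_x F (fsval a).

Definition fgaQ : Type := loc fga_root.
HB.instance Definition _ := GRing.ComPzRing.on fgaQ.
Local Notation Q := fgaQ.

Definition toQ (s : S) : Q := frac fga_root s [::].

Definition weylQ (w : W) (q : Q) : Q :=
  frac fga_root (weyl_fga w (numer q)) [seq weyl_on_roots w a | a <- denom q].

Lemma weyl_den (w : W) (u : seq (rootset D)) :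
  weyl_fga w (den fga_root u) = den fga_root [seq weyl_on_roots w a | a <- u].
Proof.
rewrite rmorph_prod /den big_map; apply: eq_bigr => a _.
exact: weyl_fga_x.
Qed.

Lemma weylQ_frac (w : W) s u : weylQ w (frac fga_root s u) =
  frac fga_root (weyl_fga w s) [seq weyl_on_roots w a | a <- u].
Proof.
have [v e] := frac_repr fga_root s u.
apply/frac_eq; exists [seq weyl_on_roots w a | a <- v].
by rewrite -!weyl_den -!rmorphM /= e.
Qed.

Fact weylQ_is_zmod_morphism w : zmod_morphism (weylQ w).
Proof.
elim/loc_ind=> s u; elim/loc_ind=> t v.
have fracB s' u' t' v' : (frac fga_root s' u' - frac fga_root t' v' : Q) =
    frac fga_root (s' * den fga_root v' - t' * den fga_root u') (u' ++ v').
  rewrite -[LHS]/(loc_add _ (loc_opp _)) opp_frac add_frac mulNr.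
  by [].
by rewrite fracB !weylQ_frac fracB rmorphB !rmorphM /= !weyl_den map_cat.
Qed.
HB.instance Definition _ w := GRing.isZmodMorphism.Build Q Q (weylQ w)
  (weylQ_is_zmod_morphism w).
Fact weylQ_is_monoid_morphism w : monoid_morphism (weylQ w).
Proof.
split=> [|]; first by rewrite -[1]/(frac fga_root 1 [::]) weylQ_frac rmorph1.
elim/loc_ind=> s u; elim/loc_ind=> t v.
have fracM s' u' t' v' : (frac fga_root s' u' * frac fga_root t' v' : Q) =
    frac fga_root (s' * t') (u' ++ v') by exact: mul_frac.
by rewrite fracM !weylQ_frac fracM rmorphM /= map_cat.
Qed.
HB.instance Definition _ w := GRing.isMonoidMorphism.Build Q Q (weylQ w)
  (weylQ_is_monoid_morphism w).

Fact toQ_is_zmod_morphism : zmod_morphism toQ.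
Proof.
move=> s t; rewrite -[RHS]/(loc_add _ (loc_opp _)) opp_frac add_frac.
by rewrite /den big_nil !mulr1.
Qed.
HB.instance Definition _ := GRing.isZmodMorphism.Build S Q toQ toQ_is_zmod_morphism.
Fact toQ_is_monoid_morphism : monoid_morphism toQ.
Proof. by split=> // s t; rewrite -[RHS]/(loc_mul _ _) mul_frac. Qed.
HB.instance Definition _ := GRing.isMonoidMorphism.Build S Q toQ
  toQ_is_monoid_morphism.

Lemma toQ_rootV (a : rootset D) : toQ (fga_root a) * frac fga_root 1 [:: a] = 1.
Proof.
rewrite -[LHS]/(loc_mul _ _) mul_frac; apply/frac_eq; exists [::].
by rewrite /den /= big_seq1 !big_nil !(mulr1, mul1r).
Qed.

Lemma weylQ1 q : weylQ 1%g q = q.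
Proof.
elim/loc_ind: q => s u; rewrite weylQ_frac weyl_fga1; congr frac.
by rewrite -[RHS]map_id; apply: eq_map => a; apply: val_inj.
Qed.
Lemma weylQM v w q : weylQ (v * w)%g q = weylQ v (weylQ w q).
Proof.
elim/loc_ind: q => s u; rewrite !weylQ_frac weyl_fgaM -map_comp; congr frac.
by apply: eq_map => a; apply: val_inj.
Qed.

(* Functions on the (finite) Weyl group, i.e. coordinates in the basis (delta w). *)
Definition QW : Type := {ffun W -> Q^o}.
HB.instance Definition _ := GRing.Lmodule.copy QW {ffun W -> Q^o}.

Definition delta (w : W) : QW := [ffun v => (v == w)%:R].

Definition qw_mul (y z : QW) : QW :=
  \sum_(v : W) \sum_(w : W) (y v * weylQ v (z w)) *: delta (v * w)%g.

Lemma qw_mulE y z u :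
  qw_mul y z u = \sum_(v : W) y v * weylQ v (z (v^-1 * u)%g).
Proof.
rewrite /qw_mul sum_ffunE; apply: eq_bigr => v _.
rewrite sum_ffunE (bigD1 (v^-1 * u)%g) //= big1 ?addr0.
  by rewrite !ffunE mulKVg eqxx [LHS]mulr1.
move=> w wu; rewrite !ffunE (_ : _ == _ = false) ?[LHS]mulr0 //.
by apply: contra_neqF wu => /eqP ->; rewrite mulKg.
Qed.

Fact qw_mulA : associative qw_mul.
Proof.
move=> x y z; apply/ffunP => u; rewrite !qw_mulE.
under eq_bigr do rewrite qw_mulE rmorph_sum mulr_sumr.
under [RHS]eq_bigr do rewrite qw_mulE mulr_suml.
rewrite [RHS]exchange_big; apply: eq_bigr => v _.
rewrite [RHS](reindex (fun w => v * w)%g) /=; last first.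
  by exists (fun w => v^-1 * w)%g => w _; rewrite (mulKg, mulKVg).
apply: eq_bigr => w _; rewrite rmorphM /= mulrA mulKg weylQM invMg.
by rewrite mulgA.
Qed.

Fact qw_mul1l : left_id (delta 1%g) qw_mul.
Proof.
move=> z; apply/ffunP => u; rewrite qw_mulE (bigD1 1%g) //= big1 ?addr0.
  by rewrite ffunE eqxx mul1r weylQ1 invg1 mul1g.
by move=> v v1; rewrite ffunE (negPf v1) mul0r.
Qed.

Fact qw_mul1r : right_id (delta 1%g) qw_mul.
Proof.
move=> z; apply/ffunP => u; rewrite qw_mulE (bigD1 u) //= big1 ?addr0.
  by rewrite ffunE mulVg eqxx rmorph1 mulr1.
move=> v vu; rewrite ffunE (_ : _ == _ = false) ?rmorph0 ?mulr0 //.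
by apply: contra_neqF vu => /eqP/(congr1 (fun w => v * w)%g); rewrite mulKVg mulg1.
Qed.

Fact qw_mulDl : left_distributive qw_mul +%R.
Proof.
move=> x y z; apply/ffunP => u; rewrite ffunE !qw_mulE -big_split /=.
by apply: eq_bigr => v _; rewrite ffunE mulrDl.
Qed.

Fact qw_mulDr : right_distributive qw_mul +%R.
Proof.
move=> x y z; apply/ffunP => u; rewrite ffunE !qw_mulE -big_split /=.
by apply: eq_bigr => v _; rewrite ffunE rmorphD mulrDr.
Qed.

HB.instance Definition _ := GRing.Zmodule_isPzRing.Build QW
  qw_mulA qw_mul1l qw_mul1r qw_mulDl qw_mulDr.

Lemma qw_deltaE (q : Q) (w u : W) : (q *: delta w) u = if u == w then q else 0.
Proof. by rewrite !ffunE; case: eqP => _; [apply: mulr1|apply: mulr0]. Qed.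

Lemma qw_mul_delta (q q' : Q) (v w : W) :
  (q *: delta v) * (q' *: delta w) = (q * weylQ v q') *: delta (v * w)%g.
Proof.
apply/ffunP => u; rewrite [LHS]qw_mulE (bigD1 v) //= big1 ?addr0.
  rewrite !qw_deltaE eqxx -(can2_eq (mulKVg v) (mulKg v)).
  by case: eqP => _ //; rewrite rmorph0 mulr0.
by move=> x xv; rewrite qw_deltaE (negPf xv) mul0r.
Qed.

Lemma qw_scaleAl (q : Q) (y z : QW) : q *: (y * z) = (q *: y) * z.
Proof.
apply/ffunP => u; rewrite ffunE !qw_mulE [LHS]mulr_sumr.
by apply: eq_bigr => v _; rewrite ffunE [LHS]mulrA.
Qed.

(* (z . f)(y) = f(y z) *)
Definition qw_act_fun (z : QW) (f : {scalar QW}) (y : QW) : Q := f (y * z).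
Fact qw_act_is_linear z f : scalar (qw_act_fun z f).
Proof. by move=> q x y; rewrite /qw_act_fun mulrDl -qw_scaleAl linearP. Qed.
HB.instance Definition _ z f := GRing.isLinear.Build Q QW Q *%R (qw_act_fun z f)
  (qw_act_is_linear z f).
Definition qw_act z f : {scalar QW} := qw_act_fun z f.

Variables (n : nat) (Pi : 'I_n -> rootset D).

Definition nat_comb (l : lattice D) : Prop :=
  exists c : 'I_n -> nat, l = \sum_i fsval (Pi i) *+ c i.

Definition simple_roots : Prop :=
  (forall c : 'I_n -> int, \sum_i c i *: fsval (Pi i) = 0 -> forall i, c i = 0) /\
  (forall a : rootset D, nat_comb (fsval a) \/ nat_comb (- fsval a)).

Definition neg_roots : {set rootset D} :=
  [set a : rootset D | `[< nat_comb (- fsval a) >]]%SET.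

(* X_i = (1 / x_(alpha_i)) (1 - delta_(s_i)) *)
Definition demazure (i : 'I_n) : QW :=
  frac fga_root 1 [:: Pi i] *: (1 - delta (weyl_refl (Pi i))).

(* The R-subalgebra of Q_W generated by S and the X_i. *)
Inductive DF : QW -> Prop :=
| DF_S s : DF (toQ s *: delta 1%g)
| DF_X i : DF (demazure i)
| DF_add y z : DF y -> DF z -> DF (y + z)
| DF_mul y z : DF y -> DF z -> DF (y * z)
| DF_scale c z : DF z -> DF (toQ (fga_const F D c) *: z).

(* Hom_S(D_F, S), as the linear forms on Q_W that map D_F into S. *)
Definition DF_dual : set {scalar QW} :=
  [set f : {scalar QW} | forall z, DF z -> range toQ (f z)].

Definition parabolic (Xi : {set 'I_n}) : {set W} :=
  <<(fun i => weyl_refl (Pi i)) @: Xi>>%g.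

Definition DF_dual_inv (Xi : {set 'I_n}) : set {scalar QW} :=
  [set f | DF_dual f /\ forall w, w \in parabolic Xi -> qw_act (delta w) f = f].

Definition neg_roots_of (Xi : {set 'I_n}) : {set rootset D} :=
  [set a in neg_roots | weyl_refl a \in parabolic Xi]%SET.

Definition left_coset_reps (Xi' Xi : {set 'I_n}) (T : {set W}) : bool :=
  is_transversal T (lcosets (parabolic Xi') (parabolic Xi)) (parabolic Xi).

(* (sum_(w in T) delta_w) (1 / x_(Xi / Xi')) *)
Definition push_pull_elt (Xi' Xi : {set 'I_n}) (T : {set W}) : QW :=
  (\sum_(w in T) delta w) *
  (frac fga_root 1 (enum (neg_roots_of Xi :\: neg_roots_of Xi')) *: delta 1%g).

Definition push_pull (Xi' Xi : {set 'I_n}) (T : {set W}) (f : {scalar QW}) :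
  {scalar QW} := qw_act (push_pull_elt Xi' Xi T) f.

(* W_Xi is the only set of representatives of W_Xi / 1. *)
Definition push_pull_abs (Xi : {set 'I_n}) : {scalar QW} -> {scalar QW} :=
  push_pull finset.set0 Xi (parabolic Xi).

End TwistedAlgebra.

Arguments demazure {R} F {D n} Pi i.
Arguments DF {R} F {D n} Pi _.
Arguments DF_dual {R} F {D n} Pi _.
Arguments DF_dual_inv {R} F {D n} Pi Xi _.
Arguments push_pull_elt {R} F {D n} Pi Xi' Xi T.
Arguments push_pull {R} F {D n} Pi Xi' Xi T f.
Arguments push_pull_abs {R} F {D n} Pi Xi f.

(* Main.v *)
(* Call a function on words in the simple reflections divisible if its iterated divided
   differences stay in S. A linear form f on Q_W lies in the dual of D_F exactly when
   w |-> f(delta_w), read along words, is divisible; so the dual is stable under pointwise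
   products and under inverses of functions with unit values.

   For w0 the longest element of W_Xi, the functional p = (prod of x_b over the positive
   roots b of Xi) * (coefficient at delta_w0) takes integral values on every product X_K of
   the X_i, i in Xi, and its value is +-1 for K reduced of product w0. Both facts follow
   from two relations modulo shorter words: X_I - X_J for reduced words I, J of the same
   element, and X_K for K non-reduced. By Matsumoto's theorem these reduce to rank two,
   where the function supported at w0 with value x_(negative roots) is written as an
   explicit divisible function: a product of x_psi in types A1xA1, A2 and B2, and such a
   product times the class of a plane in a five-dimensional quadric in type G2. Conversely,
   pairing with p and solving a triangular system shows that an element z of Q_W supported
   on W_Xi lies in the S-span of the X_K as soon as all p(z X_J) are integral. Since
   Y_Xi X_i = 0 for i in Xi and p(Y_Xi) = 1, it follows that Y_Xi lies in D_F, hence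
   A_Xi maps the dual into its W_Xi-invariants.

   For surjectivity, some f in the dual has A_Xi(f)(delta_1) = +-1, so that g = A_Xi(f) has
   unit values and every invariant h equals A_Xi(f g^-1 h). Finally
   A_(Xi/Xi') o A_Xi' = A_Xi for every choice of coset representatives. *)
Require Import Defs.
From HB Require Import structures.
Set Warnings "-notation-overridden,-ambiguous-paths,-notation-incompatible-prefix".
From mathcomp Require Import all_boot all_order all_algebra all_fingroup.
From mathcomp Require Import finmap multiset ring zify boolp classical_sets functions cardinality.

Set Implicit Arguments.
Unset Strict Implicit.
Unset Printing Implicit Defensive.

Import GRing.Theory Num.Theory.
Local Open Scope mset_scope.
Local Open Scope classical_set_scope.
Local Open Scope ring_scope.

(** * Complete filtered rings *)

(** F is an infinite series, so quotients of its values are found degree by degree and then summed.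
    [cfilt] collects what such sums need. It is applied both to S and to the ring of divisible
    functions, so an identity about F proved once holds in either. Divisibility is read along words
    because a quotient chosen on words never has to be shown independent of the word.

    Type G2 differs for a reason. The simply connected groups of types A1xA1, A2 and B2 have torsion
    index 1, and there one product of classes x_psi represents a point. For G2 the torsion index is
    2: in the five-dimensional quadric the cube of the hyperplane class is twice the class of a
    plane. That class is therefore given by its localizations, and its divided differences are
    computed from an identity symmetric under b -> -b.

    There is no circularity in the use of Matsumoto's theorem: the rank-two relation enters it as a
    hypothesis, and integrality of p for two simple roots is proved from divisible functions
    alone. *)

Record cfilt (A : comPzRingType) (fl : nat -> A -> Prop) : Prop := CFilt {
  fl_le : forall m n a, (m <= n)%N -> fl n a -> fl m a;
  fl0 : forall d, fl d 0;
  flD : forall d a b, fl d a -> fl d b -> fl d (a + b);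
  flN : forall d a, fl d a -> fl d (- a);
  fl1 : fl 0 1;
  flM : forall m n a b, fl m a -> fl n b -> fl (m + n)%N (a * b);
  fl_sep : forall a, (forall d, fl d a) -> a = 0;
  fl_lim : forall t : nat -> A, (forall k, fl k (t k)) ->
    exists s, forall d, fl d (s - \sum_(k < d) t k) }.

Section Filtered.
Variables (A : comPzRingType) (fl : nat -> A -> Prop).
Hypothesis H : cfilt fl.
Implicit Types (a b u v : A).

Lemma flB d a b : fl d a -> fl d b -> fl d (a - b).
Proof. by move=> ha hb; apply: (flD H) => //; apply: (flN H). Qed.

Lemma flMl d a b : fl 0 a -> fl d b -> fl d (a * b).
Proof. by move=> ha hb; have := flM H ha hb. Qed.

Lemma flMr d a b : fl d a -> fl 0 b -> fl d (a * b).
Proof. by move=> ha hb; rewrite mulrC; apply: flMl. Qed.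

Lemma fl_ge0 d a : fl d a -> fl 0 a.
Proof. exact: (fl_le H). Qed.

Lemma fl_sum (I : Type) (r : seq I) (P : pred I) d (F : I -> A) :
  (forall i, P i -> fl d (F i)) -> fl d (\sum_(i <- r | P i) F i).
Proof. move=> h; elim/big_ind: _ => //; [exact: (fl0 H)|exact: (flD H)]. Qed.

Lemma flX d a k : fl d a -> fl (k * d) (a ^+ k).
Proof.
move=> ha; elim: k => [|k IH]; first exact: (fl1 H).
by rewrite exprS mulSn; apply: (flM H).
Qed.

Lemma flX1 a k : fl 1 a -> fl k (a ^+ k).
Proof. by move=> /(@flX _ _ k); rewrite muln1. Qed.

Definition islim (t : nat -> A) (s : A) := forall d, fl d (s - \sum_(k < d) t k).

(** The value 0 stands for a missing limit; only convergent series are used, through [flimP]. *)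
Definition flim (t : nat -> A) : A :=
  match pselect (exists s, islim t s) with
  | left e => projT1 (cid e) | right _ => 0 end.

Lemma flimP t : (forall k, fl k (t k)) -> islim t (flim t).
Proof.
move=> /(fl_lim H) e; rewrite /flim; case: pselect => // e'.
exact: (projT2 (cid e')).
Qed.

Lemma islim_unique t s s' : islim t s -> islim t s' -> s = s'.
Proof.
move=> h h'; apply/eqP; rewrite -subr_eq0; apply/eqP/(fl_sep H) => d.
have -> : s - s' = (s - \sum_(k < d) t k) - (s' - \sum_(k < d) t k) by ring.
exact: flB.
Qed.

Lemma islim_fl t s d : islim t s -> (forall k, fl d (t k)) -> fl d s.
Proof.
move=> h ht; rewrite -[s](subrK (\sum_(k < d) t k)).
by apply: (flD H) => //; apply: fl_sum.
Qed.

Lemma flim_fl t d : (forall k, fl k (t k)) -> (forall k, fl d (t k)) -> fl d (flim t).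
Proof. by move=> /flimP h; apply: islim_fl. Qed.

Lemma islimD t1 t2 s1 s2 :
  islim t1 s1 -> islim t2 s2 -> islim (fun k => t1 k + t2 k) (s1 + s2).
Proof. by move=> h1 h2 d; rewrite big_split opprD addrACA; apply: (flD H). Qed.

Lemma islimN t s : islim t s -> islim (fun k => - t k) (- s).
Proof. by move=> h d; rewrite sumrN -opprD; apply: (flN H). Qed.

(** Geometric series. *)
Lemma fl_unit a : fl 1 a -> exists2 b, fl 0 b & (1 - a) * b = 1.
Proof.
move=> ha; have hX k : fl k (a ^+ k) by apply: flX1.
exists (flim (fun k => a ^+ k)).
  by apply: flim_fl => // k; apply: fl_ge0 (hX k).
have h := flimP hX; set s := flim _ in h *.
apply/eqP; rewrite -subr_eq0; apply/eqP/(fl_sep H) => d.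
have -> : (1 - a) * s - 1 = (1 - a) * (s - \sum_(k < d) a ^+ k) - a ^+ d.
  rewrite mulrBr; have := subrX1 a d => e.
  have -> : (1 - a) * (\sum_(k < d) a ^+ k) = 1 - a ^+ d.
    by rewrite -[1 - a]opprB mulNr -e opprB.
  by ring.
apply: flB => //; apply: flMl => //; apply: flB; [exact: (fl1 H)|exact: fl_ge0 ha].
Qed.

(** Division by an element of order m lowers orders by m. The quotients still form a convergent
    series, but m more terms are needed to reach a given precision. *)
Lemma islim_shift m (q : nat -> A) : (forall k, fl (k - m) (q k)) ->
  exists2 s, fl 0 s & forall d, fl d (s - \sum_(k < m + d) q k).
Proof.
move=> hq; have hq' k : fl k (q (m + k)%N) by have := hq (m + k)%N; rewrite addKn.
have [s hs] := fl_lim H hq'.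
exists (\sum_(k < m) q k + s) => [|d].
  apply: (flD H); first by apply: fl_sum => k _; apply: fl_ge0 (hq k).
  by apply: (islim_fl hs) => k; apply: fl_ge0 (hq' k).
rewrite big_split_ord /=.
by rewrite opprD addrACA subrr add0r.
Qed.

(** A termwise decomposition passes to the sum even if the [q k] lose m orders. The [r k] gain one
    order, so [r'] has positive order and 1 - r' will be invertible. *)
Lemma islim_comb m t s x y (q r : nat -> A) : islim t s -> fl 0 x -> fl 0 y ->
  (forall k, fl (k - m) (q k)) -> (forall k, fl k.+1 (r k)) ->
  (forall k, t k = x * q k + y * r k) ->
  exists q' r', [/\ fl 0 q', fl 1 r' & s = x * q' + y * r'].
Proof.
move=> ht hx hy hq hr e; have [q' q0 hq'] := islim_shift hq.
have hr0 k : fl k (r k) by apply: (fl_le H) (hr k).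
have hr' := flimP hr0; exists q', (flim r); split=> //.
  by apply: flim_fl => // k; apply: (fl_le H) (hr k).
apply/eqP; rewrite -subr_eq0; apply/eqP/(fl_sep H) => d.
have -> : s - (x * q' + y * flim r) = (s - \sum_(k < m + d) t k)
    - (x * (q' - \sum_(k < m + d) q k) + y * (flim r - \sum_(k < m + d) r k)).
  have -> : \sum_(k < m + d) t k
      = x * (\sum_(k < m + d) q k) + y * (\sum_(k < m + d) r k).
    by rewrite !mulr_sumr -big_split; apply: eq_bigr => k _; rewrite e.
  by ring.
apply: flB; first by apply: (fl_le H) (ht _); apply: leq_addl.
apply: (flD H); apply: flMl => //.
by apply: (fl_le H) (hr' _); apply: leq_addl.
Qed.

Definition hom (c : nat -> nat -> A) (k : nat) u v := \sum_(i < k.+1) c i (k - i)%N * u ^+ i * v ^+ (k - i).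
Definition ev c u v := flim (fun k => hom c k u v).

Lemma hom_fl c k u v : (forall i j, fl 0 (c i j)) -> fl 1 u -> fl 1 v -> fl k (hom c k u v).
Proof.
move=> hc hu hv; apply: fl_sum => i _; rewrite -mulrA; apply: flMl => //.
have := flM H (flX1 i hu) (flX1 (k - i) hv); rewrite subnKC //.
by rewrite -ltnS.
Qed.

Lemma evP c u v : (forall i j, fl 0 (c i j)) -> fl 1 u -> fl 1 v ->
  islim (fun k => hom c k u v) (ev c u v).
Proof. by move=> hc hu hv; apply: flimP => k; apply: hom_fl. Qed.

Lemma ev_fl c u v : (forall i j, fl 0 (c i j)) -> fl 1 u -> fl 1 v -> fl 0 (ev c u v).
Proof.
by move=> hc hu hv; apply: flim_fl => k; last apply: (@fl_ge0 k); apply: hom_fl.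
Qed.

(** * Symmetric series in a pair of formal inverses *)

Section Symmetric.
Variables (c : nat -> nat -> A) (u u' y y' : A).
Hypotheses (c0 : forall i j, fl 0 (c i j)) (cC : forall i j, c i j = c j i).
Hypotheses (u1 : fl 1 u) (u'1 : fl 1 u') (y1 : fl 1 y) (y'1 : fl 1 y').
Hypotheses (uu' : u + u' + u * u' * ev c u u' = 0) (yy' : y + y' + y * y' * ev c y y' = 0).

(** [ku] and [ky] stand for 1/u + 1/u' and 1/y + 1/y', see [su] and [sy]. The relation between y and
    y' makes y + y' a series in y y'; hence differences of symmetric expressions ought to be
    multiples of [dp], and [dk] is the error term to be absorbed. *)
Let dp := y * y' - u * u'.
Let ku := - ev c u u'.
Let ky := - ev c y y'.
Let dk := ky - ku.

Let ku0 : fl 0 ku. Proof. exact/(flN H)/ev_fl. Qed.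
Let ky0 : fl 0 ky. Proof. exact/(flN H)/ev_fl. Qed.
Let pu2 : fl 2 (u * u'). Proof. exact: (flM H u1 u'1). Qed.
Let py2 : fl 2 (y * y'). Proof. exact: (flM H y1 y'1). Qed.
Let su : u + u' = u * u' * ku.
Proof. by rewrite /ku mulrN; apply/eqP; rewrite -addr_eq0 uu'. Qed.
Let sy : y + y' = y * y' * ky.
Proof. by rewrite /ky mulrN; apply/eqP; rewrite -addr_eq0 yy'. Qed.

(* t and t' are the values at (y, y') and (u, u') of a symmetric form of degree d. *)
Let diff d t t' := [/\ fl d t, fl d t' & exists q r,
  [/\ fl (d - 2) q, fl d.+1 r & t - t' = dp * q + dk * r]].

Let diff_const a : fl 0 a -> diff 0 a a.
Proof.
by move=> ha; split=> //; exists 0, 0; split; rewrite ?subrr; try apply: (fl0 H); ring.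
Qed.

Let diffD d s t s' t' : diff d s s' -> diff d t t' -> diff d (s + t) (s' + t').
Proof.
move=> [hs hs' [q [r [hq hr e]]]] [ht ht' [q' [r' [hq' hr' e']]]].
split; try exact: (flD H); exists (q + q'), (r + r'); split; try exact: (flD H).
by rewrite opprD addrACA e e'; ring.
Qed.

Let diffM d d' s t s' t' : diff d s s' -> diff d' t t' -> diff (d + d') (s * t) (s' * t').
Proof.
move=> [hs hs' [q [r [hq hr e]]]] [ht ht' [q' [r' [hq' hr' e']]]].
split; try exact: (flM H); exists (q * t + s' * q'), (r * t + s' * r'); split.
- apply: (flD H); [apply: (fl_le H) (flM H hq ht)|apply: (fl_le H) (flM H hs' hq')]; lia.
- apply: (flD H); [apply: (fl_le H) (flM H hr ht)|apply: (fl_le H) (flM H hs' hr')]; lia.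
have -> : s * t - s' * t' = (s - s') * t + s' * (t - t') by ring.
by rewrite e e'; ring.
Qed.

Let diffN d s s' : diff d s s' -> diff d (- s) (- s').
Proof.
move=> [hs hs' [q [r [hq hr e]]]]; split; try exact: (flN H).
exists (- q), (- r); split; try exact: (flN H).
by rewrite -opprD e; ring.
Qed.

Let diff_p : diff 2 (y * y') (u * u').
Proof.
split=> //; exists 1, 0; split; [exact: (fl1 H)|exact: (fl0 H)|].
by rewrite /dp; ring.
Qed.

Let diff_s1 : diff 1 (y + y') (u + u').
Proof.
split; try exact: (flD H); exists ky, (u * u'); split=> //.
by rewrite su sy /dk /dp; ring.
Qed.

(** Newton's recursion for power sums, carried for two consecutive exponents. *)
Let diff_pow n : diff n (y ^+ n + y' ^+ n) (u ^+ n + u' ^+ n).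
Proof.
suff : diff n (y ^+ n + y' ^+ n) (u ^+ n + u' ^+ n) /\
  diff n.+1 (y ^+ n.+1 + y' ^+ n.+1) (u ^+ n.+1 + u' ^+ n.+1) by case.
elim: n => [|n [IH1 IH2]]; first by split; [apply: diff_const; apply: (flD H); apply: (fl1 H)|].
split=> //.
have E a b : a ^+ n.+2 + b ^+ n.+2 = (a + b) * (a ^+ n.+1 + b ^+ n.+1) + - (a * b * (a ^+ n + b ^+ n)).
  by rewrite !exprS; ring.
by rewrite !E; apply: diffD; [apply: (diffM diff_s1 IH2)|apply/diffN/(diffM diff_p IH1)].
Qed.

(** Splitting off the two extreme terms of a symmetric form leaves a b times a symmetric form of
    degree two less. *)
Let hom_rec (d : nat -> nat -> A) k a b : (forall i j, d i j = d j i) ->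
  hom d k.+2 a b = d 0%N k.+2 * (a ^+ k.+2 + b ^+ k.+2)
    + a * b * hom (fun i j => d i.+1 j.+1) k a b.
Proof.
move=> dC; rewrite /hom big_ord_recl big_ord_recr /= subn0 expr0 mulr1 subnn mulr1.
rewrite [d k.+2 0%N]dC; set X := \sum_(i < k.+1) _.
suff -> : X = a * b * \sum_(i < k.+1) d i.+1 (k - i).+1 * a ^+ i * b ^+ (k - i) by ring.
rewrite mulr_sumr; apply: eq_bigr => i _; rewrite /bump /= add1n subSS subSn; last by rewrite -ltnS.
by rewrite !exprS; ring.
Qed.

Let diff_hom k (d : nat -> nat -> A) : (forall i j, d i j = d j i) -> (forall i j, fl 0 (d i j)) ->
  diff k (hom d k y y') (hom d k u u').
Proof.
elim/ltn_ind: k d => -[|[|k]] IH d dC d0.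
- by rewrite /hom !big_ord1 !expr0 !mulr1; apply: diff_const.
- have E a b : hom d 1 a b = d 0%N 1%N * (a + b).
    by rewrite /hom !big_ord_recr big_ord0 /= !expr0 !expr1 [d 1%N 0%N]dC; ring.
  by rewrite !E; apply: (diffM (diff_const (d0 _ _)) diff_s1).
rewrite !hom_rec //; apply: diffD; first exact: (diffM (diff_const (d0 _ _)) (diff_pow _)).
exact: (diffM diff_p (IH _ _ _ _ _)).
Qed.

(* Comparing the expansions of the two sides degree by degree gives dk = dp q' + dk r'
   with r' of positive order, and 1 - r' is a unit. *)
Let dk_div : exists2 e, fl 0 e & dk = dp * e.
Proof.
have /choice[q] : forall k, exists q, exists r, [/\ fl (k - 2) q, fl k.+1 r &
    hom c k y y' - hom c k u u' = dp * q + dk * r].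
  by move=> k; have [_ _ h] := diff_hom k cC c0.
move=> /choice[r hqr].
have ht := islimD (evP c0 y1 y'1) (islimN (evP c0 u1 u'1)).
have dp0 : fl 0 dp by apply: flB; [exact: fl_ge0 py2|exact: fl_ge0 pu2].
have dk0 : fl 0 dk by apply: flB.
have [|||q' [r' [q0 r1 e]]] := islim_comb ht dp0 dk0 (q := q) (r := r) (m := 2).
- by move=> k; case: (hqr k).
- by move=> k; case: (hqr k).
- by move=> k; case: (hqr k).
have [b b0 eb] := fl_unit (flN H r1).
exists (- (q' * b)); first exact/(flN H)/flMl.
have e' : dk = - (ev c y y' - ev c u u') by rewrite /dk /ky /ku; ring.
have : dk * (1 - - r') = - (dp * q').
  by rewrite opprK mulrDr mulr1 {1}e' e; ring.
move/(congr1 ( *%R^~ b)); rewrite -mulrA eb mulr1 => ->; ring.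
Qed.

Let pow_div n : exists2 e, fl (n - 2) e &
  (y ^+ n + y' ^+ n) - (u ^+ n + u' ^+ n) = dp * e.
Proof.
have [_ _ [q [r [hq hr ->]]]] := diff_pow n; have [e e0 ->] := dk_div.
exists (q + e * r); last by ring.
by apply: (flD H) => //; apply: flMl => //; apply: (fl_le H) hr; lia.
Qed.

Lemma sym_sum_div : exists2 e, fl 0 e & (y + y') - (u + u') = (y * y' - u * u') * e.
Proof. by have [e e0] := pow_div 1; rewrite !expr1 => E; exists e. Qed.

(** Insert ev c u u'. The difference of ev c u u' and ev c y y' is [dk]; what remains is a sum of
    terms c u^i times differences of power sums, each a multiple of [dp] by [pow_div]. *)
Lemma sym_trace_div : exists2 e, fl 0 e &
  - ev c y y' + ev c u y + ev c u y' - ev c u u = (y * y' - u * u') * e.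
Proof.
have /choice[E hE] : forall n, exists e, fl (n - 2) e /\
    (y ^+ n + y' ^+ n) - (u ^+ n + u' ^+ n) = dp * e.
  by move=> n; have [e] := pow_div n; exists e.
have ht := islimD (islimD (evP c0 u1 y1) (evP c0 u1 y'1))
  (islimN (islimD (evP c0 u1 u1) (evP c0 u1 u'1))).
have dp0 : fl 0 dp by apply: flB; [exact: fl_ge0 py2|exact: fl_ge0 pu2].
pose q k := \sum_(i < k.+1) c i (k - i)%N * u ^+ i * E (k - i)%N.
have [|||q' [r' [q0 r1 e]]] := islim_comb ht dp0 (fl0 H 0) (q := q) (r := fun=> 0) (m := 2).
- move=> k; apply: fl_sum => i _; rewrite -mulrA; apply: flMl => //.
  have [hi _] := hE (k - i)%N.
  apply: (fl_le H) (flM H (flX1 i u1) hi); have := ltn_ord i; lia.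
- by move=> k; apply: (fl0 H).
- move=> k; rewrite mul0r addr0 /hom /q mulr_sumr -!big_split -sumrN -big_split.
  apply: eq_bigr => i _ /=; have [_ e] := hE (k - i)%N.
  rewrite mulrCA -e; ring.
have [f f0 ef] := dk_div.
exists (f + q'); first exact: (flD H).
rewrite -/dp mulrDr -ef; move: e; rewrite mul0r addr0 => <-.
rewrite /dk /ky /ku; ring.
Qed.

End Symmetric.
End Filtered.

(** * Series coefficients and the filtration of S *)

Section SeriesCoefficients.
Variables (R : comPzRingType) (I : choiceType).
Implicit Types (f g : series R I) (m n : {mset I}).

Lemma scoef_sum (T : Type) (r : seq T) (P : pred T) (f : T -> series R I) m :
  (\sum_(i <- r | P i) f i) m = \sum_(i <- r | P i) f i m.
Proof. by apply: (big_morph (fun f : series R I => f m)). Qed.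

Lemma sconstMcoef c f m : (sconst I c * f) m = c * f m.
Proof.
rewrite scoefM (bigD1_seq mset0) ?msub_uniq ?mem_msub ?msub0set //=.
rewrite eqxx msetB0 big1 ?addr0 // => a a0.
by rewrite (negPf a0) mul0r.
Qed.

Lemma monomial_coef (s : seq I) m :
  (\prod_(i <- s) svar R i : series R I) m = (m == seq_mset s)%:R.
Proof.
elim: s m => [|i s IH] m; rewrite ?big_nil ?big_cons.
  rewrite -[LHS]/(if m == mset0 then 1 else 0).
  rewrite (_ : seq_mset [::] = mset0 :> {mset I}); first by case: (_ == _).
  by apply/msetP => j; rewrite mset_seqE mset0E.
rewrite scoefM; case im : ([mset i] `<=` m)%mset.
  rewrite (bigD1_seq [mset i]%mset) ?msub_uniq ?mem_msub //= eqxx mul1r [X in _ + X]big1 ?addr0.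
    rewrite IH mset_cons; congr (_%:R); congr nat_of_bool.
    apply/eqP/eqP => [<-|->]; first by rewrite msetBDKC.
    by rewrite msetDKB.
  by move=> a ai; rewrite (negPf ai) mul0r.
rewrite big1_seq => [|a /andP[_]]; last first.
  rewrite mem_msub /= => am; case: eqP am => [->|_ _]; last by rewrite mul0r.
  by rewrite im.
case: eqP => // e; move: im; rewrite e mset_cons => /negP[].
by apply/msubsetP => x; rewrite msetE2 leq_addr.
Qed.

Definition has_order d f := forall m, (size m < d)%N -> f m = 0.

Lemma has_orderM d e f g : has_order d f -> has_order e g -> has_order (d + e) (f * g).
Proof.
move=> hf hg m md; rewrite scoefM big1_seq // => a /andP[_]; rewrite mem_msub => am.
have : size m = (size (a : {mset I}) + size (m `\` a)%mset)%N by rewrite -size_msetD msetBDKC.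
move=> sm; have [ad|ad] := ltnP (size (a : {mset I})) d; first by rewrite hf ?mul0r.
rewrite hg ?mulr0 // -(ltn_add2l (size (a : {mset I}))) -sm.
by apply: leq_trans md _; rewrite leq_add2r.
Qed.

Lemma spart_fin k f d : finite_set [set m : {mset I} |
  (size m <= d)%N /\ (if size m == k then f m else 0) != 0].
Proof.
apply: sub_finite_set (series_fin f d) => m /= [md].
by case: ifP => // _; rewrite eqxx.
Qed.
Definition spart k f : series R I := Series (spart_fin k f).

Lemma spart_monomials k f : exists r : seq {mset I}, all (fun m => size m == k) r /\
  spart k f = \sum_(m <- r) sconst I (f m) * \prod_(i <- enum_mset m) svar R i.
Proof.
have /finite_seqP[r er] := series_fin f k.
exists (filter (fun m : {mset I} => size m == k) (undup r)); split; first exact: filter_all.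
have rP m : (m \in r) = ((size m <= k)%N && (f m != 0)).
  have : [set` r] m <-> (size m <= k)%N /\ f m != 0 by rewrite -er.
  by move=> [h1 h2]; apply/idP/andP => [/h1|/h2].
apply/seriesP => m; rewrite scoef_sum big_filter.
have E n : (sconst I (f n) * (\prod_(i <- enum_mset n) svar R i : series R I)) m
    = if n == m then f m else 0.
  rewrite sconstMcoef monomial_coef seq_mset_id eq_sym.
  by case: eqP => [->|_]; rewrite ?mulr1 ?mulr0.
under eq_bigr do rewrite E.
rewrite -[LHS]/(if size m == k then f m else 0).
rewrite -big_mkcondr /=; case: ifPn => mk; last first.
  rewrite big1 // => n /andP[nk /eqP nm].
  by move: mk; rewrite -nm nk.
have [fm0|fm0] := eqVneq (f m) 0; first by rewrite fm0 big1.
rewrite (eq_bigl (pred1 m)) => [|n] /=; last first.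
  by case: (n =P m) => [->|]; rewrite ?mk ?andbF.
by rewrite -big_filter filter_pred1_uniq ?undup_uniq ?mem_undup ?rP ?fm0 ?(eqP mk) ?leqnn ?big_seq1.
Qed.

End SeriesCoefficients.

Lemma ssubstE (R : comPzRingType) (I : choiceType) (F : nat -> nat -> R)
  (u v : series R I) m : ssubst F u v m = subst_trunc F (size m) u v m.
Proof. by []. Qed.

(** * Coefficients of a formal group law *)

Section FormalGroupLaw.
Variables (R : comPzRingType) (F : fgl R).

Let x : 'I_3 := inord 0.
Let y : 'I_3 := inord 1.
Let xy : x != y. Proof. by rewrite -val_eqE /= !inordK. Qed.

Let monoxy i j : svar R x ^+ i * svar R y ^+ j = \prod_(k <- nseq i x ++ nseq j y) svar R k.
Proof. by rewrite big_cat /= !big_nseq !iter_mulr_1. Qed.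

Let eq_monoxy i j a b : (seq_mset (nseq i x ++ nseq j y) == seq_mset (nseq a x ++ nseq b y)) = ((i == a) && (j == b)).
Proof.
apply/eqP/andP => [e|[/eqP-> /eqP->] //].
have cx p q : seq_mset (nseq p x ++ nseq q y) x = p.
  by rewrite mset_seqE count_cat !count_nseq /= eqxx (eq_sym y) (negPf xy) mul1n addn0.
have cy p q : seq_mset (nseq p x ++ nseq q y) y = q.
  by rewrite mset_seqE count_cat !count_nseq /= eqxx (negPf xy) mul1n.
by split; apply/eqP; [rewrite -(cx i j) e cx|rewrite -(cy i j) e cy].
Qed.

(** Monomials in two distinct variables are distinct, so a coefficient of F can be read off F(x, y)
    as soon as the truncation exceeds both exponents. *)
Let coefxy (c : nat -> nat -> R) N a b : (a < N)%N -> (b < N)%N ->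
  (\sum_(i < N) \sum_(j < N) sconst 'I_3 (c i j) * svar R x ^+ i * svar R y ^+ j)
    (seq_mset (nseq a x ++ nseq b y)) = c a b.
Proof.
move=> aN bN; rewrite scoef_sum.
have E (i j : 'I_N) : (sconst 'I_3 (c i j) * svar R x ^+ i * svar R y ^+ j) (seq_mset (nseq a x ++ nseq b y))
   = if (i == Ordinal aN) && (j == Ordinal bN) then c a b else 0.
  rewrite -mulrA monoxy sconstMcoef monomial_coef eq_monoxy (eq_sym a) (eq_sym b).
  rewrite -!val_eqE /=; case: eqP => [->|_]; last by rewrite mulr0.
  by case: eqP => [->|_]; rewrite ?mulr1 ?mulr0.
under eq_bigr do rewrite scoef_sum; under eq_bigr do under eq_bigr do rewrite E.
rewrite (bigD1 (Ordinal aN)) //= [X in _ + X]big1 ?addr0; last first.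
  by move=> i ia; rewrite big1 // => j _; rewrite (negPf ia).
rewrite (bigD1 (Ordinal bN)) //= [X in _ + X]big1 ?addr0 ?eqxx //.
by move=> j jb; rewrite (negPf jb) andbF.
Qed.

Let size_xy a b : size (seq_mset (nseq a x ++ nseq b y)) = (a + b)%N.
Proof. by rewrite size_seq_mset size_cat !size_nseq. Qed.

Lemma fgl_coefC i j : F i j = F j i.
Proof.
have /seriesP/(_ (seq_mset (nseq i x ++ nseq j y))) := fgl_comm F.
rewrite -/x -/y !ssubstE size_xy /subst_trunc coefxy ?ltnS ?leq_addr ?leq_addl // => ->.
rewrite exchange_big /=.
transitivity ((\sum_(k < (i + j).+1) \sum_(l < (i + j).+1)
    sconst 'I_3 (F l k) * svar R x ^+ k * svar R y ^+ l)
    (seq_mset (nseq i x ++ nseq j y))); last first.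
  by rewrite (coefxy (fun k l => F l k)) ?ltnS ?leq_addr ?leq_addl.
by congr (scoef _ _); apply: eq_bigr => k _; apply: eq_bigr => l _; rewrite mulrAC.
Qed.

Lemma fgl_coef0r i : F i 0%N = (i == 1%N)%:R.
Proof.
have /seriesP/(_ (seq_mset (nseq i x ++ nseq 0 y))) := fgl_unit F.
rewrite -/x ssubstE size_xy addn0 /subst_trunc.
have -> : \sum_(k < i.+1) \sum_(l < i.+1) sconst 'I_3 (F k l) * svar R x ^+ k * 0 ^+ l
  = \sum_(k < i.+1) \sum_(l < i.+1) sconst 'I_3 (if l == 0 :> nat then F k l else 0) * svar R x ^+ k * svar R y ^+ l.
  apply: eq_bigr => k _; apply: eq_bigr => l _; rewrite expr0n.
  case: (_ =P _) => [->|_]; first by rewrite expr0.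
  rewrite mulr0 (_ : sconst _ 0 = 0) ?mul0r //.
  by apply/seriesP => m /=; case: (_ == _).
rewrite (coefxy (fun k l => if l == 0 :> nat then F k l else 0)) // eqxx => ->.
rewrite -[LHS]/(if _ == [mset x]%mset then 1 else 0) (_ : [mset x]%mset = seq_mset (nseq 1 x ++ nseq 0
    y)); last first.
  by rewrite mset_cons; apply/msetP => k; rewrite msetE2 mset_seqE addn0.
by rewrite eq_monoxy andbT; case: (_ == _).
Qed.

Lemma fgl_coef0l j : F 0%N j = (j == 1%N)%:R.
Proof. by rewrite fgl_coefC fgl_coef0r. Qed.

End FormalGroupLaw.

(** Passes from the square truncation in [subst_trunc] to the sum by total degree in [ev]. *)
Lemma sum_triangle (V : zmodType) (t : nat -> nat -> V) M N : (N <= M)%N ->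
  \sum_(i < M) \sum_(j < M | (i + j < N)%N) t i j
  = \sum_(k < N) \sum_(i < k.+1) t i (k - i)%N.
Proof.
elim: N => [|N IH] NM.
  by rewrite big_ord0 big1 // => i _; rewrite big_pred0.
rewrite big_ord_recr /= -IH; last exact: ltnW.
have -> : \sum_(i < N.+1) t i (N - i)%N
    = \sum_(i < M) \sum_(j < M | (i + j == N)%N) t i j.
  rewrite (big_ord_widen _ (fun i => t i (N - i)%N) NM) big_mkcond /=.
  apply: eq_bigr => i _; case: ltnP => iN; last first.
    by rewrite big_pred0 // => j; apply/eqP; lia.
  have h : (N - i < M)%N by lia.
  rewrite (big_pred1 (Ordinal h)) // => j.
  by apply/eqP/eqP => [e|->] /=; [apply: val_inj => /=|]; lia.
rewrite -big_split; apply: eq_bigr => i _ /=.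
rewrite (bigID (fun j : 'I_M => (i + j < N)%N)) /=; congr (_ + _); apply: eq_bigl => j; lia.
Qed.

Section FgaFiltration.
Variables (R : comPzRingType) (F : fgl R) (D : root_datum).
Local Notation L := (lattice D).
Local Notation S := (fga F D).
Local Notation PS := (series R L).
Local Notation x := (fga_x F).

Definition Sfil d (s : S) := exists2 f : PS, s = fga_pi F f & has_order d f.

Lemma fga_pi_relation (f : PS) : @fga_relation R F D f -> fga_pi F f = 0.
Proof.
move=> hf; rewrite -(rmorph0 (@fga_pi R F D)); apply/fga_pi_eq; rewrite subr0.
apply/asboolP => d; exists f => //; exists [:: (1, f)]; last by rewrite big_seq1 mul1r.
by move=> p; rewrite inE => /eqP ->.
Qed.

(** Separatedness holds because S is the quotient by a closed ideal. *)
Lemma Sfil_sep (s : S) : (forall d, Sfil d s) -> s = 0.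
Proof.
rewrite -(fga_piK s); set f := generic_quotient.repr s => h.
rewrite -(rmorph0 (@fga_pi R F D)); apply/fga_pi_eq; rewrite subr0; apply/asboolP => d.
have [g /fga_pi_eq/asboolP/(_ d)[g' Ig' e] og] := h d.
exists g' => // m md; rewrite -e // scoefB og // subr0; reflexivity.
Qed.

(** A term of order above the size of m does not meet m, so the coefficient of the infinite sum at m
    is that of a finite partial sum. *)
Lemma Slim_fin (f : nat -> PS) d : finite_set [set m : {mset L} |
  (size m <= d)%N /\ (\sum_(k < (size m).+1) f k) m != 0].
Proof.
have : finite_set (\bigcup_(e in `I_d.+1) [set m : {mset L} | (size m <= d)%N /\ (\sum_(k < e.+1) f k) m != 0]).
  by apply: bigcup_finite => // e _; apply: series_fin.
by apply: sub_finite_set => m /= [md h]; exists (size m).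
Qed.

Lemma Sfil_lim (t : nat -> S) : (forall k, Sfil k (t k)) ->
  exists s, forall d, Sfil d (s - \sum_(k < d) t k).
Proof.
move=> ht; have /choice[f hf] : forall k, exists f : PS, t k = fga_pi F f /\ has_order k f.
  by move=> k; have [f] := ht k; exists f.
exists (fga_pi F (Series (Slim_fin f))) => d.
exists (Series (Slim_fin f) - \sum_(k < d) f k).
  by rewrite rmorphB rmorph_sum; congr (_ - _); apply: eq_bigr => k _; case: (hf k).
move=> m md; rewrite scoefB -[Series _ m]/((\sum_(k < (size m).+1) f k) m).
rewrite (big_ord_widen _ f md) !scoef_sum [X in _ - X](bigID (fun k : 'I_d => (k < (size m).+1)%N)) /=.
rewrite opprD addrA subrr sub0r big1 ?oppr0 // => k.
by rewrite -leqNgt => mk; case: (hf k) => _ ->.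
Qed.

Lemma Sfil_cfilt : cfilt Sfil.
Proof.
split.
- by move=> m n a mn [f -> hf]; exists f => // p pm; apply: hf; apply: leq_trans mn.
- by move=> d; exists 0; rewrite ?rmorph0.
- move=> d a b [f -> hf] [g -> hg]; exists (f + g); rewrite ?rmorphD // => m md.
  by rewrite scoefD hf // hg // addr0.
- move=> d a [f -> hf]; exists (- f); rewrite ?rmorphN // => m md.
  by rewrite scoefN hf // oppr0.
- by exists 1; rewrite ?rmorph1.
- move=> m n a b [f -> hf] [g -> hg]; exists (f * g); rewrite ?rmorphM //.
  exact: has_orderM.
- exact: Sfil_sep.
exact: Sfil_lim.
Qed.

Lemma svar_order (l : L) : has_order 1 (svar R l).
Proof.
move=> m; rewrite ltnS leqn0 size_mset_eq0 => /eqP ->.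
rewrite -[LHS]/(if mset0 == [mset l]%mset then 1 else 0).
by case: eqP => // /(congr1 (fun m : {mset L} => m l)); rewrite mset0E msetnxx.
Qed.

Lemma fga_x_fil (l : L) : Sfil 1 (x l).
Proof. by exists (svar R l) => //; apply: svar_order. Qed.

Lemma Sfil0 (s : S) : Sfil 0 s.
Proof. by exists (generic_quotient.repr s); rewrite ?fga_piK. Qed.

Lemma fga_x0 : x (0 : L) = 0.
Proof. by apply: fga_pi_relation; left. Qed.

(** The coefficients of G in F(u, v) = u + v + u v G(u, v). *)
Definition fga_coef i j : S := fga_const F D (F i.+1 j.+1).

Lemma fga_coefC i j : fga_coef i j = fga_coef j i.
Proof. by rewrite /fga_coef fgl_coefC. Qed.

Lemma ssubst_trunc_order (u v : PS) d : has_order 1 u -> has_order 1 v ->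
  has_order d.+1 (ssubst F u v - subst_trunc F d u v).
Proof.
move=> hu hv m md; rewrite scoefB; apply/eqP; rewrite subr_eq0; apply/eqP.
have hX (w : PS) k : has_order 1 w -> has_order k (w ^+ k).
  move=> hw; elim: k => [|k IH] //; rewrite exprS; exact: has_orderM hw IH.
have h0 (i j : nat) : (size m < i + j)%N -> (sconst L (F i j) * u ^+ i * v ^+ j) m = 0.
  move=> mij; rewrite -mulrA sconstMcoef (has_orderM (hX _ i hu) (hX _ j hv)) ?mulr0 //.
have E N : (size m < N)%N -> (\sum_(i < N) \sum_(j < N) sconst L (F i j) * u ^+ i * v ^+ j) m =
   \sum_(i < (size m).+1) \sum_(j < (size m).+1) (sconst L (F i j) * u ^+ i * v ^+ j) m.
  move=> mN; rewrite scoef_sum; under eq_bigr do rewrite scoef_sum.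
  rewrite (big_ord_widen _ (fun i => \sum_(j < (size m).+1) (sconst L (F i j) * u ^+ i * v ^+ j) m) mN).
  rewrite [RHS]big_mkcond; apply: eq_bigr => i _; case: ltnP => im.
    rewrite (big_ord_widen _ (fun j => (sconst L (F i j) * u ^+ i * v ^+ j) m) mN).
    rewrite [RHS]big_mkcond; apply: eq_bigr => j _; case: ltnP => jm //.
    by rewrite h0 //; apply: (leq_trans jm); apply: leq_addl.
  by rewrite big1 // => j _; rewrite h0 //; apply: (leq_trans im); apply: leq_addr.
by rewrite ssubstE /subst_trunc !E.
Qed.

Lemma fga_pi_subst_trunc (u v : L) d : fga_pi F (subst_trunc F d.+1 (svar R u) (svar R v)) =
  x u + x v + x u * x v * \sum_(i < d.+1) \sum_(j < d.+1) fga_coef i j * x u ^+ i * x v ^+ j.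
Proof.
rewrite /subst_trunc rmorph_sum.
have E i j : fga_pi F (sconst L (F i j) * svar R u ^+ i * svar R v ^+ j)
    = fga_const F D (F i j) * x u ^+ i * x v ^+ j.
  by rewrite !rmorphM !rmorphXn.
have c0 : fga_const F D 0 = 0.
  rewrite /fga_const (_ : sconst L 0 = 0) ?rmorph0 //.
  by apply/seriesP => m /=; case: ifP.
have c1 : fga_const F D 1 = 1 by exact: (rmorph1 (@fga_pi R F D)).
rewrite (eq_bigr (fun i : 'I_d.+2 => \sum_(j < d.+2) fga_const F D (F i j) * x u ^+ i * x v ^+ j)); last first.
  by move=> i _; rewrite rmorph_sum; apply: eq_bigr => j _; apply: E.
rewrite big_ord_recl /= big_ord_recl /= fgl_coef0l c0 !mul0r add0r.
rewrite big_ord_recl /= fgl_coef0l c1 mul1r expr0 mul1r expr1 big1 ?addr0; last first.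
  by move=> j _; rewrite fgl_coef0l c0 !mul0r.
rewrite [x u + x v]addrC -addrA; congr (_ + _).
under eq_bigr do rewrite big_ord_recl /=.
rewrite big_split /=; congr (_ + _).
  rewrite big_ord_recl /= fgl_coef0r c1 mul1r expr1 expr0 mulr1 big1 ?addr0 //.
  by move=> i _; rewrite fgl_coef0r c0 !mul0r.
rewrite mulr_sumr; apply: eq_bigr => i _; rewrite mulr_sumr; apply: eq_bigr => j _.
by rewrite /bump /= !add1n !exprS /fga_coef; ring.
Qed.

(** Modulo order d both sides are finite sums in x u and x v. The terms by which the square
    truncation exceeds the sum over total degrees below d have order at least d. *)
Lemma fga_xD (u v : L) : x (u + v) = x u + x v + x u * x v * ev Sfil fga_coef (x u) (x v).
Proof.
have H := Sfil_cfilt; have [u1 v1] := (fga_x_fil u, fga_x_fil v).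
apply/eqP; rewrite -subr_eq0; apply/eqP/Sfil_sep => d.
have -> : x (u + v) = fga_pi F (ssubst F (svar R u) (svar R v)).
  have : fga_pi F (svar R (u + v) - ssubst F (svar R u) (svar R v)) = 0.
    by apply: fga_pi_relation; right; exists u, v.
  by rewrite rmorphB => /eqP; rewrite subr_eq0 => /eqP.
set f := ssubst _ _ _; set g := subst_trunc F d.+1 (svar R u) (svar R v).
have -> : fga_pi F f = fga_pi F g + fga_pi F (f - g).
  by rewrite [fga_pi F (f - g)]rmorphB addrC subrK.
rewrite fga_pi_subst_trunc.
set X := \sum_(i < _) _; set e := ev _ _ _ _.
set P := fga_pi F _.
have -> : x u + x v + x u * x v * X + P - (x u + x v + x u * x v * e)
    = x u * x v * (X - e) + P by ring.
apply: (flD H); last first.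
  exists (f - g) => // m md.
  by apply: ssubst_trunc_order; [exact: svar_order|exact: svar_order|]; apply: ltn_trans md _; rewrite ltnS.
apply: (flMl H); first exact: Sfil0.
have he := evP H (fun i j => Sfil0 (fga_coef i j)) u1 v1.
have -> : X - e = \sum_(i < d.+1) \sum_(j < d.+1 | ~~ (i + j < d)%N) fga_coef i j * x u ^+ i * x v ^+ j
   - (e - \sum_(k < d) hom fga_coef k (x u) (x v)).
  rewrite -(sum_triangle (fun i j => fga_coef i j * x u ^+ i * x v ^+ j) (leqnSn d)).
  rewrite opprB addrA; congr (_ - _); rewrite -big_split.
  by apply: eq_bigr => i _ /=; rewrite [LHS](bigID (fun j : 'I_d.+1 => (i + j < d)%N)) /= addrC.
apply: (flB H) => //; apply: (fl_sum H) => i _; apply: (fl_sum H) => j.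
rewrite -leqNgt => dij; rewrite -mulrA; apply: (flMl H); first exact: Sfil0.
exact: (fl_le H dij (flM H (flX1 H i u1) (flX1 H j v1))).
Qed.

End FgaFiltration.

Arguments Sfil {R F D} d s.

Section FgaDifferences.
Variables (R : comPzRingType) (F : fgl R) (D : root_datum).
Local Notation L := (lattice D).
Local Notation W := (weyl D).
Local Notation S := (fga F D).
Local Notation x := (fga_x F).
Let H := @Sfil_cfilt R F D.

Definition fgF (u v : L) : S := ev Sfil (@fga_coef R F D) (x u) (x v).
(** The element 1/x_u + 1/x_(-u), see [kapE]. *)
Definition kap (u : L) : S := - fgF u (- u).

Lemma fga_xDF (u v : L) : x (u + v) = x u + x v + x u * x v * fgF u v.
Proof. exact: fga_xD. Qed.

Lemma fga_xNF (u : L) : x u + x (- u) + x u * x (- u) * fgF u (- u) = 0.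
Proof. by rewrite -fga_xDF subrr fga_x0. Qed.

Lemma kapE (u : L) : x u + x (- u) = x u * x (- u) * kap u.
Proof. by rewrite /kap mulrN; apply/eqP; rewrite -addr_eq0 fga_xNF. Qed.

(** By [kap_opp] the two factors are - x_u / x_(-u) and its inverse: passing from a root to its
    negative changes x by a unit. *)
Lemma kap_unit (u : L) : (1 - kap u * x u) * (1 - kap u * x (- u)) = 1.
Proof.
have -> : (1 - kap u * x u) * (1 - kap u * x (- u)) = 1 - kap u * (x u + x (- u))
   + kap u * (x u * x (- u) * kap u) by ring.
by rewrite -kapE; ring.
Qed.

Lemma kap_opp (u : L) : x (- u) * (1 - kap u * x u) = - x u.
Proof.
have -> : x (- u) * (1 - kap u * x u) = x (- u) - x u * x (- u) * kap u by ring.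
by rewrite -kapE; ring.
Qed.

Lemma fga_x_nat_diff (l a : L) n : exists t, x (l + a *+ n) - x l = x a * t.
Proof.
elim: n => [|n [t IH]]; first by exists 0; rewrite mulr0n addr0 subrr mulr0.
exists (t + 1 + x (l + a *+ n) * fgF (l + a *+ n) a).
rewrite mulrSr addrA [x (_ + a)]fga_xDF.
set y := x (l + a *+ n) in IH *; set g := fgF _ _.
transitivity (y - x l + x a * (1 + y * g)); first by ring.
by rewrite IH; ring.
Qed.

Lemma fga_x_diff (l a : L) (k : int) : exists t, x l - x (l - k *: a) = x a * t.
Proof.
have E m : Posz m *: a = a *+ m by rewrite -scaler_nat natz.
case: k => n.
  have [t e] := fga_x_nat_diff (l - n%:Z *: a) a n; exists t; rewrite -e.
  by rewrite E subrK.
have [t e] := fga_x_nat_diff l a n.+1; exists (- t).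
by rewrite mulrN -e NegzE scaleNr opprK E opprB.
Qed.

Lemma weyl_fga_fil (w : W) d (s : S) : Sfil d s -> Sfil d (weyl_fga w s).
Proof.
move=> [f -> hf]; exists (weyl_series w f); first exact: weyl_fga_pi.
by move=> m md /=; apply: hf; rewrite size_weyl_mset.
Qed.

Lemma fga_islim_parts (f : series R L) :
  islim Sfil (fun k => fga_pi F (spart k f)) (fga_pi F f).
Proof.
move=> d; exists (f - \sum_(k < d) spart k f); first by rewrite rmorphB rmorph_sum.
move=> m md; rewrite scoefB scoef_sum (bigD1 (Ordinal md)) //= eqxx big1 ?addr0 ?subrr // => k.
by rewrite -val_eqE /= eq_sym => /negPf ->.
Qed.

(** For the variables x_l this is [fga_x_diff]; the twisted Leibniz rule extends it to monomials,
    and summation over degrees to all of S. *)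
Lemma divdiff_ex (b : rootset D) (s : S) :
  exists t, s - weyl_fga (weyl_refl b) s = x (fsval b) * t.
Proof.
(* The quotient is kept of order k - 1, so that the quotients of the homogeneous parts of s form a
   convergent series. *)
pose w := weyl_refl b; pose Q k (t : S) := Sfil k t /\ exists u, Sfil k.-1 u /\
  t - weyl_fga w t = x (fsval b) * u.
have QM k l t t' : Q k t -> Q l t' -> Q (k + l)%N (t * t').
  move=> [kt [u [hu e]]] [kt' [u' [hu' e']]]; split; first exact: (flM H).
  exists (u * t' + weyl_fga w t * u'); split.
    apply: (flD H); [apply: (fl_le H) (flM H hu kt')|apply: (fl_le H) (flM H (weyl_fga_fil w kt) hu')]; lia.
  rewrite rmorphM; have -> : forall a a' : S, t * t' - a * a' = (t - a) * t' + a * (t' - a') by move=> *; ring.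
  by rewrite e e'; ring.
have QD k t t' : Q k t -> Q k t' -> Q k (t + t').
  move=> [kt [u [hu e]]] [kt' [u' [hu' e']]]; split; first exact: (flD H).
  by exists (u + u'); split; [exact: (flD H)|rewrite rmorphD opprD addrACA e e' mulrDr].
have Q0 k : Q k 0.
  split; [exact: (fl0 H)|exists 0; split; [exact: (fl0 H)|]].
  by rewrite rmorph0 subrr mulr0.
have Qc c : Q 0%N (fga_const F D c).
  split; [exact: Sfil0|exists 0; split; [exact: Sfil0|]].
  by rewrite /fga_const weyl_fga_pi weyl_series_const subrr mulr0.
have Qx l : Q 1%N (x l).
  split; [exact: fga_x_fil|have [t e] := fga_x_diff l (fsval b) (coroot b l)].
  by exists t; split; [exact: Sfil0|rewrite weyl_fga_x -e].
have Qpart k f : Q k (fga_pi F (spart k f)).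
  have [r [rk ->]] := spart_monomials k f; rewrite rmorph_sum big_seq.
  elim/big_ind: _ => [|t t0|m mr]; [exact: Q0|exact: QD|]; have /eqP <- := allP rk m mr; rewrite rmorphM rmorph_prod.
  apply: (QM 0%N _ _ _ (Qc _)); move: (enum_mset m) => r'.
  elim: r' => [|l r' IH]; last by rewrite big_cons; apply: (QM 1%N _ _ _ (Qx l)).
  by rewrite big_nil -(rmorph1 (@fga_pi R F D)); apply: Qc.
rewrite -(fga_piK s); set f := generic_quotient.repr s.
have /choice[u hu] : forall k, exists u, Sfil k.-1 u /\ fga_pi F (spart k f)
    - weyl_fga w (fga_pi F (spart k f)) = x (fsval b) * u by move=> k; case: (Qpart k f).
have hl := fga_islim_parts f.
have hlw : islim Sfil (fun k => weyl_fga w (fga_pi F (spart k f))) (weyl_fga w (fga_pi F f)).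
  by move=> d; have := weyl_fga_fil w (hl d); rewrite rmorphB rmorph_sum.
have [|||t [r [_ _ e]]] := islim_comb H (islimD H hl (islimN H hlw))
    (Sfil0 (x (fsval b))) (Sfil0 0) (m := 1) (q := u) (r := fun=> 0).
- by move=> k; rewrite subn1; case: (hu k).
- by move=> k; apply: (fl0 H).
- by move=> k; rewrite mul0r addr0; case: (hu k).
by exists t; rewrite e mul0r addr0.
Qed.

End FgaDifferences.

(** * Divisible functions on words *)

Section Pointwise.
Variables (X : Type) (A : comPzRingType).
Implicit Types f g : X -> A.

Lemma pw0 k : (0 : X -> A) k = 0. Proof. by []. Qed.
Lemma pw1 k : (1 : X -> A) k = 1. Proof. by []. Qed.
Lemma pwD f g k : (f + g) k = f k + g k. Proof. by []. Qed.
Lemma pwN f k : (- f) k = - f k. Proof. by []. Qed.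
Lemma pwM f g k : (f * g) k = f k * g k. Proof. by []. Qed.
Lemma pwX f n k : (f ^+ n) k = f k ^+ n.
Proof. by elim: n => [|n IH]; rewrite ?expr0 // !exprS pwM IH. Qed.
Lemma pw_sum (I : Type) (r : seq I) (P : pred I) (f : I -> X -> A) k :
  (\sum_(i <- r | P i) f i) k = \sum_(i <- r | P i) f i k.
Proof. by rewrite fct_sumE. Qed.
Definition pwE := (pw0, pw1, pwD, pwN, pwM, pwX, pw_sum).

End Pointwise.

Section Words.
Variables (R : comPzRingType) (F : fgl R) (D : root_datum).
Local Notation L := (lattice D).
Local Notation W := (weyl D).
Local Notation S := (fga F D).
Local Notation x := (fga_x F).
Variables (T : Type) (rho : T -> rootset D).
Let H := @Sfil_cfilt R F D.
Implicit Types (f g : seq T -> S) (K J : seq T) (c : T) (psi : seq T -> L).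

Definition wprod K : W := (\prod_(c <- K) weyl_refl (rho c))%g.
(** Left multiplication by the reflection in this root takes [wprod K] to [wprod (rcons K c)]; it is
    the root on the edge between them in the GKM graph. *)
Definition wroot K c : L := wprod K (fsval (rho c)).

Lemma wd_nil : wprod [::] = 1%g. Proof. by rewrite /wprod big_nil. Qed.
Lemma wd_cons c K : wprod (c :: K) = (weyl_refl (rho c) * wprod K)%g.
Proof. by rewrite /wprod big_cons. Qed.
Lemma wd_cat K J : wprod (K ++ J) = (wprod K * wprod J)%g.
Proof. by rewrite /wprod big_cat. Qed.
Lemma wd_rcons K c : wprod (rcons K c) = (wprod K * weyl_refl (rho c))%g.
Proof. by rewrite -cats1 wd_cat wd_cons wd_nil mulg1. Qed.

(* Read along words, the elements of the dual of D_F are the f that are divisible for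
   all n (dual_divisible, divisible_dual). The degree d is kept so that the notion is
   stable under infinite sums. *)
Fixpoint divisible n d f : Prop := (forall K, Sfil d (f K)) /\
  if n is m.+1 then forall c, exists g,
    (forall K, f K - f (rcons K c) = x (wroot K c) * g K) /\ divisible m d.-1 g
  else True.

Lemma divisible_fil n d f : divisible n d f -> forall K, Sfil d (f K).
Proof. by case: n => [|n] []. Qed.

Lemma divisible_le m n d e f : (m <= n)%N -> (d <= e)%N -> divisible n e f -> divisible m d f.
Proof.
elim: n m d e f => [|n IH] [|m] d e f //= mn de [h1 h2].
- by split=> // K; apply: (fl_le H de).
- by split=> // K; apply: (fl_le H de).
split=> [K|c]; first exact: (fl_le H de).
by have [g [e1 e2]] := h2 c; exists g; split=> //; apply: IH e2 => //; lia.
Qed.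

Lemma divisible0 n d : divisible n d (0 : seq T -> S).
Proof.
elim: n d => [|n IH] d /=; split=> //; try by move=> K; apply: (fl0 H).
by move=> c; exists 0; split=> // K; rewrite !pwE subrr mulr0.
Qed.

Lemma divisibleD n d f g : divisible n d f -> divisible n d g -> divisible n d (f + g).
Proof.
elim: n d f g => [|n IH] d f g [h1 h2] [h1' h2'].
  by split=> // K; apply: (flD H).
split=> [K|c]; first exact: (flD H).
have [a [e1 e2]] := h2 c; have [b [e1' e2']] := h2' c; exists (a + b); split; last exact: IH.
by move=> K; rewrite !pwE mulrDr -e1 -e1'; ring.
Qed.

Lemma divisibleN n d f : divisible n d f -> divisible n d (- f).
Proof.
elim: n d f => [|n IH] d f [h1 h2].
  by split=> // K; apply: (flN H).
split=> [K|c]; first exact: (flN H).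
have [a [e1 e2]] := h2 c; exists (- a); split; last exact: IH.
by move=> K; rewrite !pwE mulrN -e1; ring.
Qed.

Lemma divisible_cst n d s : Sfil d s -> divisible n d (fun=> s).
Proof.
move=> hs; case: n => [|n] /=; split=> // c; exists 0; split; last exact: divisible0.
by move=> K; rewrite subrr mulr0.
Qed.

Lemma divisible_ext n d f g : f =1 g -> divisible n d f -> divisible n d g.
Proof. by move=> /funext ->. Qed.

(** Taking a quotient lowers the order by one. The quotients of the t k with k > 0 thus converge
    after a shift of the index, and that of t 0 is added separately. *)
Lemma divisible_flim n d (t : nat -> seq T -> S) f :
  (forall k, divisible n (maxn k d) (t k)) ->
  (forall K, islim Sfil (fun k => t k K) (f K)) -> divisible n d f.
Proof.
elim: n d t f => [|n IH] d t f ht hl.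
  split=> // K; apply: (islim_fl H (hl K)) => k.
  by apply: (fl_le H) (divisible_fil (ht k) K); apply: leq_maxr.
split=> [K|c].
  apply: (islim_fl H (hl K)) => k.
  by apply: (fl_le H) (divisible_fil (ht k) K); apply: leq_maxr.
have /choice[g hg] : forall k, exists g, (forall K, t k K - t k (rcons K c) = x (wroot K c) * g K)
    /\ divisible n (maxn k d).-1 g by move=> k; case: (ht k) => _ /(_ c).
have hg1 k : divisible n (maxn k d.-1) (g k.+1).
  by case: (hg k.+1) => _; apply: divisible_le => //; lia.
pose G K := flim Sfil (fun k => g k.+1 K).
have hG K : islim Sfil (fun k => g k.+1 K) (G K).
  apply: (flimP H) => k; apply: (fl_le H) (divisible_fil (hg1 k) K); exact: leq_maxl.
exists (g 0%N + G); split; last first.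
  apply: divisibleD; last exact: IH hg1 hG.
  by case: (hg 0%N) => _; rewrite max0n.
move=> K; apply/eqP; rewrite -subr_eq0; apply/eqP/(fl_sep H) => e.
have -> : f K - f (rcons K c) - x (wroot K c) * (g 0%N + G) K
  = (f K - \sum_(k < e.+1) t k K) - (f (rcons K c) - \sum_(k < e.+1) t k (rcons K c))
    - x (wroot K c) * (G K - \sum_(k < e) g k.+1 K).
  have : \sum_(k < e.+1) t k K - \sum_(k < e.+1) t k (rcons K c)
      = x (wroot K c) * (g 0%N K + \sum_(k < e) g k.+1 K).
    rewrite -sumrB; under eq_bigr => k _ do rewrite (proj1 (hg k)).
    by rewrite -mulr_sumr big_ord_recl.
  move=> /eqP; rewrite subr_eq => /eqP ->; rewrite !pwE; ring.
apply: (flB H); last by apply: (flMl H); [exact: Sfil0|exact: hG].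
by apply: (flB H); apply: (fl_le H (leqnSn e)); apply: hl.
Qed.

Lemma divisible_complete n (t : nat -> seq T -> S) : (forall k, divisible n k (t k)) ->
  exists s, forall d, divisible n d (s - \sum_(k < d) t k).
Proof.
move=> ht; pose s K := flim Sfil (fun k => t k K).
have hs K : islim Sfil (fun k => t k K) (s K).
  by apply: (flimP H) => k; apply: divisible_fil (ht k) K.
(* With the first d terms replaced by 0, every term has the order that [divisible_flim] asks for. *)
exists s => d; apply: (@divisible_flim _ _ (fun k => if (k < d)%N then 0 else t k)).
  move=> k; case: ltnP => kd; first exact: divisible0.
  by apply: divisible_le (ht k) => //; lia.
move=> K e; rewrite !pwE.
have [ed|de] := leqP e d.
  rewrite [X in _ - _ - X]big1 ?subr0 => [|k _]; first exact: (fl_le H ed (hs K d)).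
  by rewrite (leq_trans (ltn_ord k) ed).
suff -> : \sum_(k < e) (if (k < d)%N then 0 else t k : seq T -> S) K
    = \sum_(k < e) t k K - \sum_(k < d) t k K.
  by rewrite opprB addrA subrK; apply: hs.
rewrite (big_ord_widen _ (fun k => t k K) (ltnW de)) (bigID (fun k : 'I_e => (k < d)%N)) /=.
rewrite big1 ?add0r => [|k -> //].
rewrite [X in _ = X - _](bigID (fun k : 'I_e => (k < d)%N)) /= addrAC subrr add0r.
by apply: eq_bigr => k /negPf ->.
Qed.

(* psi K is w mu - nu with w = wprod K, for a (rational) weight mu and a constant nu. *)
Definition weightlike psi := forall J c, exists k : int, forall K,
  psi (K ++ J) - psi (rcons K c ++ J) = k *: wroot K c.

Lemma weightlikeD psi psi' : weightlike psi -> weightlike psi' ->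
  weightlike (fun K => psi K + psi' K).
Proof.
move=> h h' J c; have [k e] := h J c; have [k' e'] := h' J c; exists (k + k') => K.
by rewrite scalerDl -e -e' opprD addrACA.
Qed.

Lemma weightlikeN psi : weightlike psi -> weightlike (fun K => - psi K).
Proof. by move=> h J c; have [k e] := h J c; exists (- k) => K; rewrite scaleNr -e opprD. Qed.

Lemma weightlike_cst l : weightlike (fun=> l).
Proof. by move=> J c; exists 0 => K; rewrite subrr scale0r. Qed.

Lemma weightlike_rcons psi c : weightlike psi -> weightlike (fun K => psi (rcons K c)).
Proof. by move=> h J c'; have [k e] := h (rcons J c) c'; exists k => K; rewrite !rcons_cat. Qed.

Lemma weylB (w : W) (l m : L) : w (l - m) = w l - w m.
Proof. by have := weyl_linear w (-1) m l; rewrite !scaleN1r (addrC (- m)) => ->; rewrite addrC. Qed.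
Lemma weyl0 (w : W) : w 0 = 0. Proof. by rewrite -[X in w X](subrr 0) weylB subrr. Qed.
Lemma weylN (w : W) (l : L) : w (- l) = - w l. Proof. by rewrite -[- l]sub0r weylB weyl0 sub0r. Qed.
Lemma weylD (w : W) (l m : L) : w (l + m) = w l + w m.
Proof. by rewrite -[m in LHS]opprK weylB weylN opprK. Qed.
Lemma weylZ (w : W) k (l : L) : w (k *: l) = k *: w l.
Proof. by have := weyl_linear w k l 0; rewrite !addr0 weyl0 addr0. Qed.

Lemma weightlike_wd l : weightlike (fun K => wprod K l).
Proof.
move=> J c; exists (coroot (rho c) (wprod J l)) => K.
by rewrite cat_rcons !wd_cat wd_cons !weylM -weylB /= /refl opprB addrCA subrr addr0 weylZ.
Qed.

Lemma weightlike_wr c : weightlike (fun K => wroot K c).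
Proof. exact: weightlike_wd. Qed.

(** The hypothesis on l says that l / n is an integral weight, so an edge changes w (l / n) by an
    integral multiple of its root. The lattice is torsion free, which allows the division by n. *)
Lemma weightlike_div psi (n : int) l : n != 0 -> (forall c, exists k : int, coroot (rho c) l = k * n) ->
  (forall K, n *: psi K = wprod K l - l) -> weightlike psi.
Proof.
move=> n0 hl e J c; have [k ek] := hl c.
exists (k + coroot (rho c) (psi J)) => K.
apply/eqP; rewrite -subr_eq0; apply/eqP/(lattice_torsion_free n0).
rewrite scalerBr scalerBr !e opprB addrA subrK.
rewrite cat_rcons !wd_cat wd_cons !weylM -weylB /= /refl opprB addrCA subrr addr0 weylZ.
have -> : wprod J l = l + n *: psi J by rewrite e addrC subrK.
rewrite linearD linearZ /= ek scalerA -scalerBl.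
by rewrite (_ : _ - _ = 0) ?scale0r //; ring.
Qed.

Definition xw psi K : S := x (psi K).

Section Step.
Variable n : nat.
Hypothesis HM : forall d d' f g, divisible n d f -> divisible n d' g -> divisible n (d + d') (f * g).
Hypothesis Hx : forall psi, weightlike psi -> divisible n 1 (xw psi).

Lemma divisible_cfilt_step : cfilt (divisible n).
Proof.
split=> //.
- by move=> k l f kl; apply: divisible_le.
- exact: divisible0.
- exact: divisibleD.
- exact: divisibleN.
- by apply: divisible_cst; apply: Sfil0.
- by move=> f hf; apply/funext => K; apply: (fl_sep H) => d; apply: divisible_fil (hf d) K.
exact: divisible_complete.
Qed.
Let Hn := divisible_cfilt_step.

Lemma ev_divisible_step psi psi' : weightlike psi -> weightlike psi' ->
  ev (divisible n) (fun i j => cst (fga_coef F D i j)) (xw psi) (xw psi')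
  = fun K => fgF F (psi K) (psi' K).
Proof.
move=> h h'; apply/funext => K.
have h1 := @evP _ _ Hn (fun i j => cst (fga_coef F D i j)) _ _ (fun i j => divisible_cst n (Sfil0 _)) (Hx h) (Hx h').
have h2 := evP H (fun i j => Sfil0 (fga_coef F D i j)) (fga_x_fil F (psi K)) (fga_x_fil F (psi' K)).
apply: (islim_unique H _ h2) => d; have := divisible_fil (h1 d) K; rewrite !pwE.
congr (Sfil _ (_ - _)); apply: eq_bigr => k _; rewrite /hom !pwE; apply: eq_bigr => i _.
by rewrite !pwE.
Qed.

Lemma fgF_divisible_step psi psi' : weightlike psi -> weightlike psi' ->
  divisible n 0 (fun K => fgF F (psi K) (psi' K)).
Proof.
move=> h h'; rewrite -ev_divisible_step //.
by apply: (ev_fl Hn); [move=> i j; apply: divisible_cst; apply: Sfil0|exact: Hx|exact: Hx].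
Qed.

Lemma x_diff_step psi beta m : weightlike psi -> weightlike beta ->
  exists g, divisible n 0 g /\ forall K, x (psi K + beta K *+ m) - x (psi K) = x (beta K) * g K.
Proof.
move=> h h'; elim: m => [|m [g [hg e]]].
  by exists 0; split=> [|K]; [exact: divisible0|rewrite mulr0n addr0 subrr mulr0].
pose psi' K := psi K + beta K *+ m.
have hpsi' : weightlike psi'.
  apply: weightlikeD => //; elim: m {g hg e psi'} => [|m IH]; first exact: weightlike_cst.
  by rewrite (_ : (fun K => _) = fun K => beta K + beta K *+ m);
    [exact: weightlikeD|apply/funext => K; rewrite mulrS].
exists (g + 1 + xw psi' * (fun K => fgF F (psi' K) (beta K))); split.
  apply: divisibleD; first by apply: divisibleD => //; apply: divisible_cst; apply: Sfil0.
  apply: (fl_le Hn (leq0n 1)); rewrite -[1%N]addn0.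
  by apply: HM; [exact: Hx|exact: fgF_divisible_step].
move=> K; rewrite mulrSr addrA -/(psi' K) fga_xDF !pwE /xw.
transitivity (x (psi' K) - x (psi K) + x (beta K) * (1 + x (psi' K) * fgF F (psi' K) (beta K))); first by ring.
rewrite e; ring.
Qed.

End Step.

(** The two claims need each other. Together at level n they make the divisible functions a complete
    filtered ring in which F can be evaluated; this provides the quotients of x_psi, and the Leibniz
    rule those of products, at level n + 1. *)
Lemma divisible_step n :
  (forall d d' f g, divisible n d f -> divisible n d' g -> divisible n (d + d') (f * g)) /\
  (forall psi, weightlike psi -> divisible n 1 (xw psi)).
Proof.
elim: n => [|n [HM Hx]].
  split=> [d d' f g [hf _] [hg _]|psi _]; split=> // K; [exact: (flM H)|exact: fga_x_fil].
split=> [d d' f g hf hg|psi hpsi]; split=> [K|c].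
- exact: (flM H (divisible_fil hf K) (divisible_fil hg K)).
- have [[_ /(_ c)[f1 [ef hf1]]] [_ /(_ c)[g1 [eg hg1]]]] := (hf, hg).
  (* Leibniz rule. The translate K |-> f (rcons K c) is rewritten as f minus x times its quotient,
     which is known to be divisible. *)
  exists (f1 * g + (f - xw (wroot^~ c) * f1) * g1); split=> [K|].
    have efc : f (rcons K c) = f K - x (wroot K c) * f1 K by rewrite -ef; ring.
    rewrite !pwE /xw -efc.
    transitivity (x (wroot K c) * f1 K * g K + f (rcons K c) * (x (wroot K c) * g1 K)); last by ring.
    by rewrite -ef -eg; ring.
  have hf' : divisible n d f by apply: divisible_le hf.
  have hg' : divisible n d' g by apply: divisible_le hg.
  have hx : divisible n d (xw (wroot^~ c) * f1).
    apply: divisible_le (HM _ _ _ _ (Hx _ (weightlike_wr c)) hf1) => //; lia.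
  apply: divisibleD; first by apply: divisible_le (HM _ _ _ _ hf1 hg') => //; lia.
  have hB := divisibleD hf' (divisibleN hx).
  by apply: divisible_le (HM _ _ _ _ hB hg1) => //; lia.
- exact: fga_x_fil.
have [k ek] := hpsi [::] c; have hc := weightlike_rcons c hpsi; have hw := weightlike_wr c.
have E K (m : nat) : Posz m *: wroot K c = wroot K c *+ m by rewrite -scaler_nat natz.
have ek' K : psi K = psi (rcons K c) + k *: wroot K c by rewrite -ek !cats0 addrC subrK.
case: k ek' {ek} => m ek'.
  have [g [hg eg]] := x_diff_step HM Hx m hc hw.
  by exists g; split=> // K; rewrite -eg /xw -E -ek'.
have [g [hg eg]] := x_diff_step HM Hx m.+1 hpsi hw.
exists (- g); split; last exact: divisibleN.
move=> K; rewrite !pwE mulrN -eg opprB /xw [X in _ - x X = _](_ : _ = psi K + wroot K c *+ m.+1) //.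
by rewrite (ek' K) NegzE scaleNr E addrNK.
Qed.

Lemma divisible_cfilt n : cfilt (divisible n).
Proof. by have [HM _] := divisible_step n; apply: divisible_cfilt_step. Qed.

Lemma divisible_xw n psi : weightlike psi -> divisible n 1 (xw psi).
Proof. by have [_] := divisible_step n; apply. Qed.

Lemma divisible_fgF n psi psi' : weightlike psi -> weightlike psi' ->
  divisible n 0 (fun K => fgF F (psi K) (psi' K)).
Proof. by have [HM Hx] := divisible_step n; apply: fgF_divisible_step. Qed.

Lemma ev_divisible n psi psi' : weightlike psi -> weightlike psi' ->
  ev (divisible n) (fun i j => cst (fga_coef F D i j)) (xw psi) (xw psi')
  = fun K => fgF F (psi K) (psi' K).
Proof. by have [HM Hx] := divisible_step n; apply: ev_divisible_step. Qed.

Lemma divisibleM n f g : divisible n 0 f -> divisible n 0 g -> divisible n 0 (f * g).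
Proof. by have [HM _] := divisible_step n; apply: (HM 0%N 0%N). Qed.

Lemma divisible_xw0 n psi : weightlike psi -> divisible n 0 (xw psi).
Proof. by move=> /(divisible_xw n); apply: divisible_le. Qed.

(** Quotient rule 1/f - 1/f' = - (f - f') / (f f'), where f' K = f (rcons K c) is divisible because
    it is f minus x times a quotient of f. *)
Lemma divisible_inv n f g : divisible n 0 f -> (forall K, f K * g K = 1) -> divisible n 0 g.
Proof.
elim: n f g => [|n IH] f g hf e; first by split=> // K; apply: Sfil0.
split=> [K|c]; first exact: Sfil0.
have hf' : divisible n 0 f by apply: divisible_le hf.
have [_ /(_ c)[f1 [ef hf1]]] := hf; have hg := IH _ _ hf' e.
have hfc : divisible n 0 (fun K => f (rcons K c)).
  rewrite (_ : (fun K => _) = f - xw (wroot^~ c) * f1).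
    apply: divisibleD => //; apply: divisibleN; apply: divisibleM => //.
    exact/divisible_xw0/weightlike_wr.
  by apply/funext => K; rewrite !pwE /xw -ef opprB addrCA subrr addr0.
have hgc := IH _ (fun K => g (rcons K c)) hfc (fun K => e _).
exists (- f1 * g * (fun K => g (rcons K c))); split=> [K|].
  rewrite !pwE; transitivity (- (f K - f (rcons K c)) * g K * g (rcons K c)); last by rewrite ef; ring.
  have := e K; have := e (rcons K c); move: (f K) (f _) (g K) (g _) => a b a' b' eb ea.
  transitivity (a' * (b * b') - b' * (a * a')); [by rewrite eb ea !mulr1|ring].
by apply: divisibleM => //; apply: divisibleM => //; apply: divisibleN.
Qed.

End Words.

(** * A quotient symmetric in a root and its negative *)

Section TraceQuotient.
Variables (R : comPzRingType) (F : fgl R) (D : root_datum).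
Local Notation L := (lattice D).
Local Notation S := (fga F D).
Local Notation x := (fga_x F).
Variables (T : Type) (rho : T -> rootset D).
Implicit Types (K : seq T).

(* For y = x_b, y' = x_(-b) and u = x_l, the left-hand side times u is
   F(u, y') / y' + F(u, y) / y - F(u, u) / u, which vanishes for b = l and b = - l. *)
Lemma trace_quotient m (l : L) (beta : seq T -> L) : weightlike rho beta ->
  exists U, divisible rho m 0 U /\ forall K,
    x l * (kap F (beta K) + fgF F l (beta K) + fgF F l (- beta K) - fgF F l l)
    = x (l - beta K) * x (l + beta K) * U K.
Proof.
move=> hb; have hl := weightlike_cst rho l; have hN := weightlikeN hb.
have hlN : weightlike rho (fun=> - l) by apply: weightlike_cst.
have H := divisible_cfilt F rho m.
pose c i j := (cst (fga_coef F D i j) : seq T -> S).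
have c0 i j : divisible rho m 0 (c i j) by apply: divisible_cst; apply: Sfil0.
have cC i j : c i j = c j i by rewrite /c fga_coefC.
pose u := xw F (fun _ : seq T => l); pose u' := xw F (fun _ : seq T => - l).
pose y := xw F beta; pose y' := xw F (fun K => - beta K).
have xd psi : weightlike rho psi -> divisible rho m 1 (xw F psi) by apply: divisible_xw.
have [u1 u'1 y1 y'1] := And4 (xd _ hl) (xd _ hlN) (xd _ hb) (xd _ hN).
have uu' : u + u' + u * u' * ev (divisible rho m) c u u' = 0.
  by rewrite ev_divisible //; apply/funext => K; rewrite !pwE; apply: fga_xNF.
have yy' : y + y' + y * y' * ev (divisible rho m) c y y' = 0.
  by rewrite ev_divisible //; apply/funext => K; rewrite !pwE; apply: fga_xNF.
have [e e0 he] := sym_trace_div H c0 cC u1 u'1 y1 y'1 uu' yy'.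
have [f f0 hf] := sym_sum_div H c0 cC u1 u'1 y1 y'1 uu' yy'.
have [v v0 hv] := fl_unit H (flMr H u1 f0).
have fd psi psi' := @divisible_fgF R F D T rho m psi psi'.
pose g1 K := 1 + y K * fgF F (l - beta K) (beta K).
pose g2 K := 1 + y' K * fgF F (l + beta K) (- beta K).
have one : divisible rho m 0 (1 : seq T -> S) by apply: (fl1 H).
have hg1 : divisible rho m 0 g1.
  apply: divisibleD one _; apply: divisibleM; first exact: (fl_ge0 H y1).
  by apply: fd => //; apply: weightlikeD.
have hg2 : divisible rho m 0 g2.
  apply: divisibleD one _; apply: divisibleM; first exact: (fl_ge0 H y'1).
  by apply: fd => //; apply: weightlikeD.
exists (u * e * (g1 * (g2 * v))); split.
  apply: divisibleM; first by apply: divisibleM => //; exact: (fl_ge0 H u1).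
  by apply: divisibleM => //; apply: divisibleM.
move=> K; have := congr1 (fun h => h K) he; have := congr1 (fun h => h K) hf.
have := congr1 (fun h => h K) hv; rewrite !ev_divisible // !pwE => hvK hfK heK.
have eu1 : u K - y K = x (l - beta K) * g1 K.
  have := fga_xDF F (l - beta K) (beta K); rewrite subrK /g1 /u /y /xw => ->; ring.
have eu2 : u K - y' K = x (l + beta K) * g2 K.
  have := fga_xDF F (l + beta K) (- beta K); rewrite addrK /g2 /u /y' /xw => ->; ring.
(* As u is a root of t^2 - (u + u') t + u u', the product on the left is the value at u of the
   difference of two quadratics. Up to the unit 1 - u f it is the divisor y y' - u u', which is
   thereby traded for x (l - b) x (l + b). *)
have prod : (u K - y K) * (u K - y' K) = (y K * y' K - u K * u' K) * (1 - u K * f K).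
  transitivity ((y K * y' K - u K * u' K) - u K * ((y K + y' K) - (u K + u' K))); first by ring.
  by rewrite hfK; ring.
transitivity (u K * ((y K * y' K - u K * u' K) * e K)); first by rewrite -heK /kap.
transitivity (u K * ((y K * y' K - u K * u' K) * ((1 - u K * f K) * v K) * e K)).
  by rewrite hvK mulr1.
transitivity (u K * e K * v K * ((u K - y K) * (u K - y' K))); first by rewrite prod; ring.
by rewrite eu1 eu2; ring.
Qed.

End TraceQuotient.

(** * Weyl groups and parabolic subgroups *)

Section RootSystem.
Variable D : root_datum.
Local Notation L := (lattice D).
Local Notation W := (weyl D).
Implicit Types (a b : rootset D) (w u v : W).

Lemma corootD b l m : coroot b (l + m) = coroot b l + coroot b m.
Proof. exact: linearD. Qed.
Lemma corootB b l m : coroot b (l - m) = coroot b l - coroot b m.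
Proof. exact: linearB. Qed.
Lemma corootZ b k l : coroot b (k *: l) = k * coroot b l.
Proof. exact: linearZ. Qed.

Lemma root_neq0 b : fsval b != 0.
Proof. by apply/eqP => e; have := coroot_root b; rewrite e linear0. Qed.

Lemma weyl_reflE b l : weyl_refl b l = l - coroot b l *: fsval b.
Proof. by []. Qed.

Lemma weyl_refl_self b : weyl_refl b (fsval b) = - fsval b.
Proof. by rewrite weyl_reflE coroot_root scaler_nat mulr2n opprD addNKr. Qed.

Lemma weyl_refl_sq b : (weyl_refl b * weyl_refl b = 1)%g.
Proof. by apply/weyl_eqP => l; apply: reflK. Qed.

Lemma weyl_reflV b : ((weyl_refl b)^-1 = weyl_refl b)%g.
Proof. by apply/eqP; rewrite eq_invg_mul weyl_refl_sq. Qed.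

Lemma weyl1E l : (1%g : W) l = l. Proof. by []. Qed.

(* The two reflections in the root w b differ by a unipotent element of finite order. *)
Lemma coroot_weyl w b l : coroot (weyl_on_roots w b) (w l) = coroot b l.
Proof.
set c := weyl_on_roots w b.
have : fsval c = w (fsval b) by [].
move: c => c cE.
pose u : W := (weyl_refl c * (w * weyl_refl b * w^-1))%g.
pose d m := coroot b ((w^-1)%g m) - coroot c m.
have dc : d (fsval c) = 0 by rewrite /d coroot_root cE weylK coroot_root subrr.
have uE m : u m = m + d m *: fsval c.
  rewrite /u !weylM weyl_reflE (weyl_reflE b) weylB weylKV weylZ -cE.
  rewrite corootB corootZ coroot_root /d.
  rewrite -addrA -opprD -scalerDl -scaleNr; congr (_ + _ *: _); ring.
have dD m k : d (m + k *: fsval c) = d m.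
  rewrite /d weylD weylZ !corootD !corootZ.
  rewrite opprD addrACA -mulrBr -/(d m) -/(d (fsval c)) dc; ring.
have uX k m : (u ^+ k)%g m = m + (k%:Z * d m) *: fsval c.
  elim: k => [|k IH]; first by rewrite expg0 mul0r scale0r addr0.
  by rewrite expgS weylM IH uE dD -addrA -scalerDl; congr (_ + _ *: _); lia.
have : (u ^+ #[u])%g (w l) = w l by rewrite expg_order.
rewrite uX => /eqP; rewrite -[X in _ == X]addr0 (inj_eq (addrI _)) => /eqP.
have [-> //|dl] := eqVneq (coroot c (w l)) (coroot b l).
have ou : (#[u]%g)%:Z * d (w l) != 0.
  rewrite mulf_neq0 //; first by rewrite -lt0n order_gt0.
  by rewrite /d weylK subr_eq0 eq_sym.
by move/(lattice_torsion_free ou)/eqP; rewrite (negPf (root_neq0 c)).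
Qed.

Lemma weyl_refl_conj w b : (weyl_refl (weyl_on_roots w b) = w * weyl_refl b * w^-1)%g.
Proof.
apply/weyl_eqP => l; rewrite !weylM !weyl_reflE weylB weylZ weylKV.
by have := coroot_weyl w b ((w^-1)%g l); rewrite weylKV => ->.
Qed.

Definition rneg b := weyl_on_roots (weyl_refl b) b.

Lemma rnegE b : fsval (rneg b) = - fsval b.
Proof. exact: weyl_refl_self. Qed.

Lemma root_inj a b : fsval a = fsval b -> a = b.
Proof. exact: val_inj. Qed.

Lemma rnegK : involutive rneg.
Proof. by move=> b; apply: root_inj; rewrite !rnegE opprK. Qed.

Lemma weyl_refl_neg b : weyl_refl (rneg b) = weyl_refl b.
Proof. by rewrite weyl_refl_conj mulgK. Qed.

Lemma weyl_on_rootsE w b : fsval (weyl_on_roots w b) = w (fsval b). Proof. by []. Qed.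

Lemma weyl_on_roots1 b : weyl_on_roots 1%g b = b.
Proof. exact: val_inj. Qed.

Lemma weyl_on_rootsM u v b : weyl_on_roots (u * v)%g b = weyl_on_roots u (weyl_on_roots v b).
Proof. exact: val_inj. Qed.

Lemma weyl_on_rootsK w : cancel (weyl_on_roots w) (weyl_on_roots w^-1%g).
Proof. by move=> b; rewrite -weyl_on_rootsM mulVg weyl_on_roots1. Qed.

Lemma weyl_on_rootsKV w : cancel (weyl_on_roots w^-1%g) (weyl_on_roots w).
Proof. by move=> b; rewrite -weyl_on_rootsM mulgV weyl_on_roots1. Qed.

Lemma weyl_on_roots_neg w b : weyl_on_roots w (rneg b) = rneg (weyl_on_roots w b).
Proof. by apply: root_inj; rewrite weyl_on_rootsE !rnegE weylN. Qed.

End RootSystem.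

Section Simple.
Variables (D : root_datum) (n : nat) (Pi : 'I_n -> rootset D).
Hypothesis HPi : simple_roots Pi.
Local Notation L := (lattice D).
Local Notation W := (weyl D).
Local Notation wr := weyl_on_roots.
Local Notation s_ i := (weyl_refl (Pi i)).
Implicit Types (a b : rootset D) (w u v : W) (i j : 'I_n) (K J : seq 'I_n) (Xi : {set 'I_n}).

Definition root_sum (c : 'I_n -> int) : L := \sum_i c i *: fsval (Pi i).

Lemma root_sum_inj c c' : root_sum c = root_sum c' -> c =1 c'.
Proof.
move=> e i; apply/eqP; rewrite -subr_eq0; apply/eqP.
apply: (HPi.1 (fun i => c i - c' i)); under eq_bigr do rewrite scalerBl.
by rewrite sumrB -/(root_sum c) e subrr.
Qed.

Lemma rc_ex b : exists c, fsval b = root_sum c.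
Proof.
case: (HPi.2 b) => -[c e]; [exists (fun i => Posz (c i))|exists (fun i => - Posz (c i))].
  by rewrite e; apply: eq_bigr => i _; rewrite -scaler_nat natz.
rewrite -[LHS]opprK e -sumrN; apply: eq_bigr => i _.
by rewrite scaleNr -scaler_nat natz.
Qed.

Definition rc b : 'I_n -> int := projT1 (cid (rc_ex b)).

Lemma rcE b : fsval b = root_sum (rc b).
Proof. exact: projT2 (cid (rc_ex b)). Qed.

Lemma rc_uniq b c : fsval b = root_sum c -> rc b =1 c.
Proof. by rewrite rcE => /root_sum_inj. Qed.

Lemma root_sum_nat (l : L) (c : 'I_n -> int) : l = root_sum c -> (forall i, (0 <= c i)%R) -> nat_comb Pi l.
Proof.
move=> -> c0; exists (fun i => `|c i|%N); apply: eq_bigr => i _.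
by rewrite -scaler_nat natz gez0_abs.
Qed.

Definition pos b := b \notin neg_roots Pi.

Lemma nat_comb_rc b : nat_comb Pi (fsval b) -> forall i, (0 <= rc b i)%R.
Proof.
move=> [c e] i; rewrite (@rc_uniq b (fun i => Posz (c i))) //.
by rewrite e; apply: eq_bigr => j _; rewrite -scaler_nat natz.
Qed.

Lemma nat_combN_rc b : nat_comb Pi (- fsval b) -> forall i, (rc b i <= 0)%R.
Proof.
move=> [c e] i; rewrite (@rc_uniq b (fun i => - Posz (c i))) ?oppr_le0 //.
rewrite -[LHS]opprK e -sumrN; apply: eq_bigr => j _.
by rewrite scaleNr -scaler_nat natz.
Qed.

Lemma neg_rootsP b : reflect (forall i, (rc b i <= 0)%R) (b \in neg_roots Pi).
Proof.
rewrite inE; apply: (iffP (asboolP _)); first exact: nat_combN_rc.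
move=> h; apply: (@root_sum_nat _ (fun i => - rc b i)) => [|i]; last by rewrite oppr_ge0.
by rewrite rcE /root_sum -sumrN; apply: eq_bigr => i _; rewrite scaleNr.
Qed.

Lemma rc_neq0 b : exists i, rc b i != 0.
Proof.
apply/existsP; apply: contraT; rewrite negb_exists => /forallP h.
have := root_neq0 b; rewrite rcE /root_sum big1 ?eqxx // => i _.
by have := h i; rewrite negbK => /eqP ->; rewrite scale0r.
Qed.

Lemma posP b : reflect (forall i, (0 <= rc b i)%R) (pos b).
Proof.
apply: (iffP idP) => [|h].
  case: (HPi.2 b) => [/nat_comb_rc //|h]; rewrite /pos inE => /asboolP; by case.
apply/negP => /neg_rootsP h'; have [i /eqP[]] := rc_neq0 b.
by apply/eqP; rewrite Order.POrderTheory.eq_le h h'.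
Qed.

Lemma pos_rc_gt0 b i : (0 < rc b i)%R -> pos b.
Proof.
by move=> h; apply/negP => /neg_rootsP/(_ i); rewrite Order.TotalTheory.leNgt h.
Qed.

Lemma rc_neg b i : rc (rneg b) i = - rc b i.
Proof.
apply: (@rc_uniq _ (fun i => - rc b i)); rewrite rnegE rcE /root_sum -sumrN.
by apply: eq_bigr => j _; rewrite scaleNr.
Qed.

Lemma pos_neg b : pos (rneg b) = ~~ pos b.
Proof.
rewrite {2}/pos negbK; apply/posP/neg_rootsP => h i; have := h i; rewrite rc_neg ?oppr_ge0 //.
Qed.

Lemma rc_simple i j : rc (Pi i) j = (j == i)%:R.
Proof.
apply: (@rc_uniq _ (fun j => (j == i)%:R)); rewrite /root_sum (bigD1 i) //= eqxx scale1r.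
by rewrite big1 ?addr0 // => k /negPf ->; rewrite scale0r.
Qed.

Lemma pos_simple i : pos (Pi i).
Proof. by apply/posP => j; rewrite rc_simple; case: (_ == _). Qed.

Lemma rc_weyl w b j : rc (wr w b) j = \sum_i rc b i * rc (wr w (Pi i)) j.
Proof.
apply: (@rc_uniq _ (fun j => \sum_i rc b i * rc (wr w (Pi i)) j)).
have wsum (c : 'I_n -> int) : w (root_sum c) = \sum_i c i *: w (fsval (Pi i)).
  rewrite /root_sum; elim/big_ind2: _ => [|l l' m m' <- <-|i _]; first exact: weyl0.
  - exact: weylD.
  - exact: weylZ.
rewrite weyl_on_rootsE rcE wsum; under eq_bigr => i _ do rewrite -weyl_on_rootsE rcE /root_sum scaler_sumr.
rewrite exchange_big /=; apply: eq_bigr => i _; rewrite scaler_suml.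
by apply: eq_bigr => k _; rewrite scalerA.
Qed.

Lemma rc_refl i b j : rc (wr (s_ i) b) j = rc b j - (coroot (Pi i) (fsval b)) * (j == i)%:R.
Proof.
apply: (@rc_uniq _ (fun j => rc b j - (coroot (Pi i) (fsval b)) * (j == i)%:R)).
rewrite weyl_on_rootsE weyl_reflE {1}rcE /root_sum; under [RHS]eq_bigr do rewrite scalerBl.
rewrite sumrB; congr (_ - _); rewrite (bigD1 i) //= eqxx mulr1 big1 ?addr0 // => k /negPf ->.
by rewrite mulr0 scale0r.
Qed.

(** s_i changes the coordinate i only, so a change of sign forces b = k alpha_i. Reducedness
    excludes k = 2, and k > 2 contradicts that k times an integer, the value of the coroot of b at
    alpha_i, is 2. *)
Lemma pos_refl i b : pos b -> b != Pi i -> pos (wr (s_ i) b).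
Proof.
move=> /posP pb; apply: contraR => /negPf nb; apply/eqP.
have h j : j != i -> rc b j = 0.
  move=> ji; apply/eqP; apply: contraFT nb => r0; apply: (@pos_rc_gt0 _ j).
  rewrite rc_refl (negPf ji) mulr0 subr0 Order.POrderTheory.lt_def r0; exact: pb.
have bE : fsval b = rc b i *: fsval (Pi i).
  rewrite {1}rcE /root_sum (bigD1 i) //= big1 ?addr0 // => j ji.
  by rewrite h // scale0r.
have := coroot_root b; rewrite bE corootZ.
have := pb i; have := root_reduced (Pi i).
case: (rc b i) bE => // k; case: k => [|[|[|k]]] bE.
- by rewrite mul0r.
- by move=> *; apply: root_inj; rewrite bE scale1r.
- move=> /negP[]; rewrite (_ : fsval (Pi i) *+ 2 = fsval b) ?fsvalP //.
  by rewrite bE -scaler_nat.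
- by move=> _ _ e; exfalso; move: e; set z := coroot _ _; case: z => [[|z]|z] e; nia.
Qed.

Definition inv w : {set rootset D} := [set b | pos b & ~~ pos (wr w^-1%g b)]%SET.
Definition len w := #|inv w|.

Lemma inv1 : inv 1%g = finset.set0.
Proof. by apply/setP => b; rewrite !inE invg1 weyl_on_roots1; case: (pos b). Qed.

Lemma len1 : len 1%g = 0%N. Proof. by rewrite /len inv1 cards0. Qed.

Lemma lenV w : len w^-1%g = len w.
Proof.
suff le v : (len v <= len v^-1%g)%N.
  by apply/eqP; rewrite eqn_leq le andbT -{2}[w]invgK le.
have inj : injective (fun b => rneg (wr v^-1%g b)).
  by apply: can_inj (fun b => wr v (rneg b)) _ => b; rewrite rnegK weyl_on_rootsKV.
rewrite /len -(card_imset _ inj); apply: subset_leq_card; apply/fintype.subsetP => c /imsetP[b].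
rewrite !inE => /andP[pb nb] ->; rewrite pos_neg nb invgK weyl_on_roots_neg weyl_on_rootsKV.
by rewrite pos_neg pb.
Qed.

Lemma pos_refl_self i : pos (wr (s_ i) (Pi i)) = false.
Proof. by rewrite -/(rneg _) pos_neg pos_simple. Qed.

Lemma wr_refl_sq i b : wr (s_ i) (wr (s_ i) b) = b.
Proof. by rewrite -weyl_on_rootsM weyl_refl_sq weyl_on_roots1. Qed.

Lemma inv_cons i w : pos (wr w^-1%g (Pi i)) ->
  inv (s_ i * w)%g = (Pi i |: [set wr (s_ i) b | b in inv w])%SET.
Proof.
move=> h; apply/setP => b; rewrite !inE invMg weyl_reflV weyl_on_rootsM.
have [->|bi] := eqVneq b (Pi i).
  by rewrite pos_simple /= -/(rneg _) weyl_on_roots_neg pos_neg h.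
apply/idP/imsetP => [/andP[pb nb]|[c]].
  by exists (wr (s_ i) b); rewrite ?wr_refl_sq // inE nb pos_refl.
rewrite inE => /andP[pc nc] e; move: bi; rewrite e wr_refl_sq nc andbT.
move=> bi; apply: pos_refl => //; apply: contraNneq nc => ->; exact: h.
Qed.

Lemma len_cons i w : pos (wr w^-1%g (Pi i)) -> len (s_ i * w)%g = (len w).+1.
Proof.
move=> h; rewrite /len inv_cons // cardsU1 card_imset; last first.
  by apply: can_inj (wr (s_ i)) _; apply: wr_refl_sq.
rewrite (_ : _ \notin _) //; apply/imsetP => -[c].
rewrite inE => /andP[pc _] /(congr1 (wr (s_ i))) e; have := pos_refl_self i.
by rewrite e wr_refl_sq pc.
Qed.

Lemma len_cons_neg i w : ~~ pos (wr w^-1%g (Pi i)) -> len w = (len (s_ i * w)%g).+1.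
Proof.
move=> h; rewrite -(@len_cons i); first by rewrite mulgA weyl_refl_sq mul1g.
by rewrite invMg weyl_reflV weyl_on_rootsM -/(rneg _) weyl_on_roots_neg pos_neg.
Qed.

Lemma len_rcons i w : pos (wr w (Pi i)) -> len (w * s_ i)%g = (len w).+1.
Proof. by move=> h; rewrite -lenV invMg weyl_reflV len_cons ?lenV ?invgK. Qed.

Lemma len_rcons_neg i w : ~~ pos (wr w (Pi i)) -> len w = (len (w * s_ i)%g).+1.
Proof.
by move=> h; rewrite -(lenV (_ * _)%g) invMg weyl_reflV -len_cons_neg ?lenV ?invgK.
Qed.

Lemma len_cons_le i w : (len (s_ i * w)%g <= (len w).+1)%N.
Proof.
case: (boolP (pos (wr w^-1%g (Pi i)))) => [/len_cons -> //|/len_cons_neg ->].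
exact: leqW (leqnSn _).
Qed.

Local Notation wd := (wprod Pi).

Lemma len_wdM K w : (len (wd K * w)%g <= size K + len w)%N.
Proof.
elim: K => [|i K IH]; first by rewrite wd_nil mul1g.
by rewrite wd_cons -mulgA /= addSn (leq_trans (len_cons_le _ _)).
Qed.

Lemma len_wd K : (len (wd K) <= size K)%N.
Proof. by rewrite -[wd K]mulg1 (leq_trans (len_wdM _ _)) // len1 addn0. Qed.

Lemma parabolicP Xi w : reflect (exists2 K, all (mem Xi) K & w = wd K) (w \in parabolic Pi Xi).
Proof.
apply: (iffP idP) => [/gen_prodgP[k [c hc ->]]|[K KXi ->]].
  elim: k c hc => [|k IH] c hc; first by exists [::]; rewrite ?big_ord0 ?wd_nil.
  rewrite big_ord_recl; have [K KXi ->] := IH _ (fun m : 'I_k => hc (lift ord0 m)).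
  by have /imsetP[i iXi ->] := hc ord0; exists (i :: K); rewrite ?wd_cons //= iXi.
rewrite /wd big_seq; apply: group_prod => i iK; apply: mem_gen.
by apply: imset_f; apply: (allP KXi).
Qed.

Lemma parabolic_wd Xi K : all (mem Xi) K -> wd K \in parabolic Pi Xi.
Proof. by move=> h; apply/parabolicP; exists K. Qed.

Lemma parabolic_s Xi i : i \in Xi -> s_ i \in parabolic Pi Xi.
Proof. by move=> h; apply/mem_gen/imset_f. Qed.

(** Applying the letters of K to alpha_i from the right, the root turns negative at some letter j.
    Just before, it equals alpha_j, so that letter can be deleted. *)
Lemma exchange (P : pred 'I_n) K i : all P K -> ~~ pos (wr (wd K) (Pi i)) ->
  exists K', [/\ all P K', size K = (size K').+1 & (wd K * s_ i)%g = wd K'].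
Proof.
elim: K => [|j K IH] /=; first by rewrite wd_nil weyl_on_roots1 pos_simple.
move=> /andP[Pj PK]; rewrite wd_cons weyl_on_rootsM => h.
have [pu|nu] := boolP (pos (wr (wd K) (Pi i))).
  have e : wr (wd K) (Pi i) = Pi j by apply/eqP; apply: contraNT h; apply: pos_refl.
  exists K; split=> //; have := weyl_refl_conj (wd K) (Pi i); rewrite e => ->.
  by rewrite mulgKV -mulgA weyl_refl_sq mulg1.
have [K' [PK' sK e]] := IH PK nu.
by exists (j :: K'); rewrite /= Pj sK wd_cons -mulgA e.
Qed.

(** Otherwise [exchange] shortens a word of w indefinitely. *)
Lemma parabolic_id Xi w : w \in parabolic Pi Xi ->
  (forall i, i \in Xi -> pos (wr w (Pi i))) -> w = 1%g.
Proof.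
move=> /parabolicP[K]; have [k] := ubnP (size K).
elim: k K w => // k IH; case/lastP => [|K i] w; first by rewrite wd_nil.
rewrite size_rcons ltnS all_rcons => Kk /andP[iXi KXi] wK hw.
have nK : ~~ pos (wr (wd K) (Pi i)).
  have := hw i iXi; rewrite wK wd_rcons weyl_on_rootsM -/(rneg _) weyl_on_roots_neg.
  by rewrite pos_neg.
have [K' [K'Xi sK e]] := exchange KXi nK.
apply: (IH K') => //; last by rewrite wK wd_rcons.
by move: Kk; rewrite sK; apply: ltnW.
Qed.

Definition reduced K := len (wd K) == size K.

Lemma reduced_ex Xi w : w \in parabolic Pi Xi ->
  exists K, [/\ all (mem Xi) K, reduced K & wd K = w].
Proof.
have [k] := ubnP (len w); elim: k w => // k IH w; rewrite ltnS => wk wXi.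
have [e|w1] := eqVneq w 1%g.
  by exists [::]; split=> //; rewrite ?wd_nil // /reduced wd_nil len1.
have [i iXi ni] : exists2 i, i \in Xi & ~~ pos (wr w (Pi i)).
  apply: contra_neqP w1 => h; apply: (parabolic_id wXi) => i iXi.
  by apply: contra_notT h => ni; exists i.
have lw := len_rcons_neg ni.
have [||K [KXi Kr e]] := IH (w * s_ i)%g; first by move: wk; rewrite lw.
  by rewrite groupM // parabolic_s.
exists (rcons K i); rewrite all_rcons KXi wd_rcons e -mulgA weyl_refl_sq mulg1.
split=> //; first by rewrite andbT.
by rewrite /reduced wd_rcons e -mulgA weyl_refl_sq mulg1 lw size_rcons -(eqP Kr) e.
Qed.

Lemma reduced_cons i K : reduced (i :: K) -> reduced K /\ pos (wr (wd K)^-1%g (Pi i)).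
Proof.
rewrite /reduced wd_cons /= => /eqP e.
have [p|/len_cons_neg] := boolP (pos (wr (wd K)^-1%g (Pi i))).
  by move: e; rewrite len_cons // => -[->].
by rewrite e => e'; have := len_wd K; rewrite e' ltnNge leqW.
Qed.

Lemma reduced_rcons K i : reduced (rcons K i) -> reduced K /\ pos (wr (wd K) (Pi i)).
Proof.
rewrite /reduced wd_rcons size_rcons => /eqP e.
have [p|/len_rcons_neg] := boolP (pos (wr (wd K) (Pi i))).
  by move: e; rewrite len_rcons // => -[->].
by rewrite e => e'; have := len_wd K; rewrite e' ltnNge leqW.
Qed.

Definition supp Xi b := forall j, j \notin Xi -> rc b j = 0.

Lemma rc_parabolic Xi w b j : w \in parabolic Pi Xi -> j \notin Xi -> rc (wr w b) j = rc b j.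
Proof.
move=> /parabolicP[K KXi ->] jXi; elim: K KXi => [|i K IH] /=.
  by rewrite wd_nil weyl_on_roots1.
move=> /andP[iXi KXi]; rewrite wd_cons weyl_on_rootsM rc_refl IH //.
by rewrite (_ : (j == i) = false) ?mulr0 ?subr0 //; apply: contraNF jXi => /eqP ->.
Qed.

Lemma supp_wr Xi w b : w \in parabolic Pi Xi -> supp Xi b -> supp Xi (wr w b).
Proof. by move=> wXi hb j jXi; rewrite (rc_parabolic _ wXi) ?hb. Qed.

Lemma supp_simple Xi i : i \in Xi -> supp Xi (Pi i).
Proof.
by move=> iXi j jXi; rewrite rc_simple; case: eqP jXi => // ->; rewrite iXi.
Qed.

Lemma inv_supp Xi w b : w \in parabolic Pi Xi -> b \in inv w -> supp Xi b.
Proof.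
move=> wXi; rewrite inE => /andP[/posP pb nb] j jXi; apply/eqP; apply: contraNT nb => r0.
apply: (@pos_rc_gt0 _ j); rewrite (@rc_parabolic Xi) ?groupV //.
by rewrite Order.POrderTheory.lt_def r0 pb.
Qed.

Lemma pos_supp_weyl Xi w b : supp Xi b -> pos b ->
  (forall i, i \in Xi -> pos (wr w (Pi i))) -> pos (wr w b).
Proof.
move=> sb /posP pb hw; apply/posP => j; rewrite rc_weyl; apply: sumr_ge0 => i _.
have [iXi|iXi] := boolP (i \in Xi); last by rewrite sb // mul0r.
by apply: mulr_ge0 => //; move/posP: (hw i iXi); apply.
Qed.

Lemma neg_supp_weyl Xi w b : supp Xi b -> pos b ->
  (forall i, i \in Xi -> ~~ pos (wr w (Pi i))) -> ~~ pos (wr w b).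
Proof.
move=> sb /posP pb hw; rewrite /pos negbK; apply/neg_rootsP => j; rewrite rc_weyl; apply: sumr_le0 => i _.
have [iXi|iXi] := boolP (i \in Xi); last by rewrite sb // mul0r.
by apply: mulr_ge0_le0 => //; have := hw i iXi; rewrite /pos negbK => /neg_rootsP; apply.
Qed.

Definition w0 Xi : W := [arg max_(w > 1%g in parabolic Pi Xi) len w].

Lemma w0_mem Xi : w0 Xi \in parabolic Pi Xi.
Proof. by rewrite /w0; case: arg_maxnP => //; apply: group1. Qed.

Lemma w0_neg Xi i : i \in Xi -> ~~ pos (wr (w0 Xi) (Pi i)).
Proof.
rewrite /w0; case: arg_maxnP => [|w wXi hmax iXi]; first exact: group1.
apply/negP => /len_rcons e.
by have := hmax _ (groupM wXi (parabolic_s iXi)); rewrite /= e ltnn.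
Qed.

Lemma w0_neg_supp Xi b : supp Xi b -> pos b -> ~~ pos (wr (w0 Xi) b).
Proof. by move=> sb pb; apply: neg_supp_weyl sb pb _ => i; apply: w0_neg. Qed.

Lemma w0_sq Xi : (w0 Xi * w0 Xi = 1)%g.
Proof.
apply: (parabolic_id (groupM (w0_mem Xi) (w0_mem Xi))) => i iXi.
rewrite weyl_on_rootsM -[wr (w0 Xi) (Pi i)]rnegK weyl_on_roots_neg pos_neg.
apply: w0_neg_supp; last by rewrite pos_neg w0_neg.
by move=> j jXi; rewrite rc_neg (supp_wr (w0_mem _) (supp_simple iXi)) ?oppr0.
Qed.

Lemma w0V Xi : ((w0 Xi)^-1 = w0 Xi)%g.
Proof. by apply/eqP; rewrite eq_invg_mul w0_sq. Qed.

Lemma w0_unique Xi w : w \in parabolic Pi Xi ->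
  (forall i, i \in Xi -> ~~ pos (wr w (Pi i))) -> w = w0 Xi.
Proof.
move=> wXi hw; apply/eqP; rewrite -w0V eq_sym eq_invg_mul; apply/eqP.
apply: (parabolic_id (groupM (w0_mem _) wXi)) => i iXi.
rewrite weyl_on_rootsM -[wr w (Pi i)]rnegK weyl_on_roots_neg pos_neg.
apply: w0_neg_supp; last by rewrite pos_neg hw.
by move=> j jXi; rewrite rc_neg (supp_wr wXi (supp_simple iXi)) ?oppr0.
Qed.

(** At the letter where b changes sign its image is a simple root of Xi, so b is conjugate to that
    root under W_Xi. *)
Lemma refl_word Xi K b : all (mem Xi) K -> pos b -> ~~ pos (wr (wd K) b) ->
  weyl_refl b \in parabolic Pi Xi.
Proof.
elim: K b => [|j K IH] b /=; first by rewrite wd_nil weyl_on_roots1 => _ ->.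
move=> /andP[jXi KXi] pb; rewrite wd_cons weyl_on_rootsM => h.
have [pu|nu] := boolP (pos (wr (wd K) b)); last exact: IH nu.
have e : wr (wd K) b = Pi j by apply/eqP; apply: contraNT h; apply: pos_refl.
have := weyl_refl_conj (wd K)^-1%g (Pi j); rewrite -e weyl_on_rootsK => ->.
by rewrite e invgK !groupM ?groupV ?parabolic_wd ?parabolic_s.
Qed.

Lemma refl_parabolic Xi b : reflect (supp Xi b) (weyl_refl b \in parabolic Pi Xi).
Proof.
apply: (iffP idP) => [bXi j jXi|sb].
  have := rc_parabolic b bXi jXi; rewrite -/(rneg b) rc_neg; lia.
wlog pb : b sb / pos b.
  move=> h; have [/h->//|nb] := boolP (pos b).
  rewrite -weyl_refl_neg h ?pos_neg //.
  by move=> j jXi; rewrite rc_neg sb ?oppr0.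
have /parabolicP[K KXi e] := w0_mem Xi.
by apply: (refl_word KXi pb); rewrite -e w0_neg_supp.
Qed.

(** [weyl] is generated by all reflections; [refl_parabolic] for the full set of simple roots brings
    this down to the simple ones. *)
Lemma parabolicT w : w \in parabolic Pi finset.setT.
Proof.
case: w => f [r hr]; set w := Weyl _.
suff -> : w = (\prod_(b <- r) weyl_refl b)%g.
  by rewrite group_prod // => b _; apply/refl_parabolic => j; rewrite inE.
apply/weyl_eqP => l; rewrite [LHS]hr; elim: r {hr w} l => [|b r IH] l /=.
  by rewrite big_nil.
by rewrite big_cons weylM IH.
Qed.

Lemma inv_w0 Xi : inv (w0 Xi) = [set b | pos b & weyl_refl b \in parabolic Pi Xi]%SET.
Proof.
apply/setP => b; rewrite !inE w0V; case: (boolP (pos b)) => //= pb.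
apply/idP/refl_parabolic => [nb|sb]; last exact: w0_neg_supp.
by apply: (inv_supp (w0_mem Xi)); rewrite inE pb w0V.
Qed.

Lemma len_w0M Xi v : v \in parabolic Pi Xi -> (len (v * w0 Xi)%g + len v = len (w0 Xi))%N.
Proof.
move=> /reduced_ex[K [KXi Kr <-]]; elim: K KXi Kr => [|j K IH] /=.
  by rewrite wd_nil mul1g len1 addn0.
move=> /andP[jXi KXi] /reduced_cons[Kr p]; rewrite wd_cons -mulgA len_cons // addnS -addSn.
rewrite -len_cons_neg ?IH // invMg w0V weyl_on_rootsM w0_neg_supp //.
by apply: supp_wr (supp_simple jXi); rewrite groupV parabolic_wd.
Qed.

Lemma len_w0V Xi v : v \in parabolic Pi Xi -> (len v + len (v^-1 * w0 Xi)%g = len (w0 Xi))%N.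
Proof. by move=> vXi; rewrite addnC -(lenV v) len_w0M ?groupV. Qed.

Lemma len_parabolicM Xi v u : u \in parabolic Pi Xi ->
  (forall i, i \in Xi -> pos (wr v (Pi i))) -> len (v * u)%g = (len v + len u)%N.
Proof.
move=> /reduced_ex[K [KXi Kr <-]] hv; elim/last_ind: K KXi Kr => [|K j IH] /=.
  by rewrite wd_nil mulg1 len1 addn0.
rewrite all_rcons => /andP[jXi KXi] /reduced_rcons[Kr p].
rewrite wd_rcons mulgA !len_rcons ?IH ?addnS // weyl_on_rootsM.
by apply: pos_supp_weyl p hv; apply: supp_wr (supp_simple jXi); rewrite parabolic_wd.
Qed.

End Simple.

(** * The localized twisted algebra *)

Section Localized.
Variables (R : comPzRingType) (F : fgl R) (D : root_datum).
Hypothesis reg : forall a : rootset D, GRing.lreg (fga_x F (fsval a)).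
Local Notation L := (lattice D).
Local Notation W := (weyl D).
Local Notation S := (fga F D).
Local Notation Q := (fgaQ F D).
Local Notation QW := (QW F D).
Local Notation x := (fga_x F).
Local Notation wr := weyl_on_roots.
Local Notation toQ := (@toQ R F D).
Local Notation delta := (@delta R F D).

Lemma toQ_inj : injective toQ.
Proof.
move=> s t /frac_eq[v]; rewrite /den big_nil !mulr1.
suff h : GRing.lreg (\prod_(b <- v) fga_root F b) by apply: h.
elim: v => [|b v IH]; first by rewrite big_nil; apply: lreg1.
by rewrite big_cons; apply: lregM => //; apply: reg.
Qed.

Lemma toQM s t : toQ (s * t) = toQ s * toQ t. Proof. exact: rmorphM. Qed.
Lemma toQD s t : toQ (s + t) = toQ s + toQ t. Proof. exact: rmorphD. Qed.
Lemma toQB s t : toQ (s - t) = toQ s - toQ t. Proof. exact: rmorphB. Qed.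
Lemma toQN s : toQ (- s) = - toQ s. Proof. exact: rmorphN. Qed.
Lemma toQ1 : toQ 1 = 1. Proof. exact: rmorph1. Qed.
Lemma toQ0 : toQ 0 = 0. Proof. exact: rmorph0. Qed.

Definition rootV (b : rootset D) : Q := Defs.frac (fga_root F (D:=D)) 1 [:: b].

Lemma rootVP b : toQ (x (fsval b)) * rootV b = 1.
Proof. exact: toQ_rootV. Qed.

Lemma frac1E (u : seq (rootset D)) : Defs.frac (fga_root F (D:=D)) 1 u = \prod_(b <- u) rootV b :> Q.
Proof.
elim: u => [|b u IH]; first by rewrite big_nil.
rewrite big_cons -IH -[RHS]/(loc_mul _ _) mul_frac mulr1; reflexivity.
Qed.

Lemma weylQ_rootV w b : weylQ w (rootV b) = rootV (wr w b).
Proof. by rewrite /rootV weylQ_frac rmorph1. Qed.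

Lemma weylQ_toQ w s : weylQ w (toQ s) = toQ (weyl_fga w s).
Proof. exact: weylQ_frac. Qed.

Lemma weylQ_mul w (p q : Q) : weylQ w (p * q) = weylQ w p * weylQ w q.
Proof. exact: rmorphM. Qed.

Lemma weylQ_opp w (p : Q) : weylQ w (- p) = - weylQ w p.
Proof. exact: rmorphN. Qed.

Definition intQ (q : Q) := exists s, q = toQ s.

Lemma intQ_toQ s : intQ (toQ s). Proof. by exists s. Qed.
Lemma intQ0 : intQ 0. Proof. by exists 0; rewrite rmorph0. Qed.
Lemma intQD p q : intQ p -> intQ q -> intQ (p + q).
Proof. by move=> [s ->] [t ->]; exists (s + t); rewrite rmorphD. Qed.
Lemma intQN p : intQ p -> intQ (- p).
Proof. by move=> [s ->]; exists (- s); rewrite rmorphN. Qed.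
Lemma intQM p q : intQ p -> intQ q -> intQ (p * q).
Proof. by move=> [s ->] [t ->]; exists (s * t); rewrite rmorphM. Qed.
Lemma intQ_sum (I : Type) (r : seq I) (P : pred I) (f : I -> Q) :
  (forall i, P i -> intQ (f i)) -> intQ (\sum_(i <- r | P i) f i).
Proof. move=> h; elim/big_ind: _ => //; [exact: intQ0|exact: intQD]. Qed.

Lemma intQ_range q : intQ q <-> range toQ q.
Proof. by split=> [[s ->]|[s _ <-]]; exists s. Qed.

Lemma qw_add (y z : QW) u : (y + z) u = y u + z u. Proof. by rewrite ffunE. Qed.
Lemma qw_opp (y : QW) u : (- y) u = - y u. Proof. by rewrite ffunE. Qed.
Lemma qw_scale q (y : QW) u : (q *: y) u = q * y u. Proof. by rewrite ffunE. Qed.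
Lemma qw_zero u : (0 : QW) u = 0. Proof. by rewrite ffunE. Qed.
Lemma qw_sum (I : Type) (r : seq I) (P : pred I) (f : I -> QW) u :
  (\sum_(i <- r | P i) f i) u = \sum_(i <- r | P i) f i u.
Proof. by elim/big_rec2: _ => [|i y z _ <-]; rewrite ?qw_zero ?qw_add. Qed.
Lemma qw_delta w u : delta w u = if u == w then 1 else 0.
Proof. by rewrite ffunE; case: eqP. Qed.
Lemma qw_one u : (1 : QW) u = if u == 1%g then 1 else 0.
Proof. exact: qw_delta. Qed.

Lemma qw_deltaM w (z : QW) u : (delta w * z) u = weylQ w (z (w^-1 * u)%g).
Proof.
rewrite [LHS]qw_mulE (bigD1 w) //= big1 ?addr0; first by rewrite qw_delta eqxx mul1r.
by move=> v /negPf vw; rewrite qw_delta vw mul0r.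
Qed.

Lemma qw_decomp (z : QW) : z = \sum_(w : W) z w *: delta w.
Proof.
apply/ffunP => u; rewrite qw_sum (bigD1 u) //= big1 ?addr0 ?qw_scale ?qw_delta ?eqxx ?mulr1 //.
by move=> w /negPf; rewrite qw_scale qw_delta eq_sym => ->; rewrite mulr0.
Qed.

Lemma deltaM v w : delta v * delta w = delta (v * w)%g.
Proof. by rewrite -[delta v]scale1r -[delta w]scale1r qw_mul_delta rmorph1 mulr1 scale1r. Qed.

Lemma deltaZ w q (z : QW) : delta w * (q *: z) = weylQ w q *: (delta w * z).
Proof.
have e1 : delta 1%g * z = z by exact: qw_mul1l.
have e2 : q *: z = (q *: delta 1%g) * z by rewrite -qw_scaleAl e1.
have e3 : delta w * (q *: delta 1%g) = weylQ w q *: delta w.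
  by rewrite -[delta w in LHS]scale1r qw_mul_delta mul1r mulg1.
by rewrite e2 mulrA e3 -qw_scaleAl.
Qed.

Lemma qw_mul_coef (y z : QW) u : (y * z) u = \sum_v y v * weylQ v (z (v^-1 * u)%g).
Proof. exact: qw_mulE. Qed.

Lemma qw_act_comp (y z : QW) (f : {scalar QW}) : qw_act y (qw_act z f) = qw_act (y * z) f.
Proof. by apply: scalar_ext => v; rewrite /= /qw_act_fun /= /qw_act_fun mulrA. Qed.

Lemma scalar_decomp (f : {scalar QW}) z : f z = \sum_(w : W) z w * f (delta w).
Proof. by rewrite {1}[z]qw_decomp linear_sum; apply: eq_bigr => w _; rewrite linearZ. Qed.

Lemma scalar_delta_ext (f g : {scalar QW}) : (forall w, f (delta w) = g (delta w)) -> f = g.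
Proof.
move=> h; apply: scalar_ext => z; rewrite !scalar_decomp.
by apply: eq_bigr => w _; rewrite h.
Qed.

Definition of_fun (h : W -> Q) (z : QW) : Q := \sum_(w : W) z w * h w.
Fact of_fun_is_linear h : scalar (of_fun h).
Proof.
move=> q y z; rewrite /of_fun mulr_sumr -big_split; apply: eq_bigr => w _.
by rewrite qw_add qw_scale mulrDl mulrA.
Qed.
HB.instance Definition _ h := GRing.isLinear.Build Q QW Q *%R (of_fun h) (of_fun_is_linear h).

Lemma of_fun_delta h w : of_fun h (delta w) = h w.
Proof.
rewrite /of_fun (bigD1 w) //= qw_delta eqxx mul1r big1 ?addr0 // => v /negPf vw.
by rewrite qw_delta vw mul0r.
Qed.

Section Words.
Variables (n : nat) (Pi : 'I_n -> rootset D).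
Hypothesis HPi : simple_roots Pi.
Local Notation s_ i := (weyl_refl (Pi i)).
Local Notation wd := (wprod Pi).
Local Notation X_ := (demazure F Pi).
Local Notation len := (len Pi).
Implicit Types (K J : seq 'I_n) (Xi : {set 'I_n}) (w u v : W).

Lemma demazureM i (z : QW) : X_ i * z = rootV (Pi i) *: (z - delta (s_ i) * z).
Proof. by rewrite /demazure -qw_scaleAl mulrBl mul1r. Qed.

Lemma demazureM_coef i (z : QW) u :
  (X_ i * z) u = rootV (Pi i) * (z u - weylQ (s_ i) (z (s_ i * u)%g)).
Proof. by rewrite demazureM qw_scale qw_add qw_opp qw_deltaM weyl_reflV. Qed.

Definition XK K : QW := \prod_(i <- K) X_ i.

Lemma XK_nil : XK [::] = 1. Proof. by rewrite /XK big_nil. Qed.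
Lemma XK_cons i K : XK (i :: K) = X_ i * XK K. Proof. by rewrite /XK big_cons. Qed.
Lemma XK_cat K J : XK (K ++ J) = XK K * XK J. Proof. by rewrite /XK big_cat. Qed.
Lemma XK_rcons K i : XK (rcons K i) = XK K * X_ i.
Proof. by rewrite -cats1 XK_cat XK_cons XK_nil mulr1. Qed.

(** The contribution to X_K of choosing the reflection in every factor (1 - delta_s) / x. *)
Fixpoint lead K : Q := if K is i :: K' then - (rootV (Pi i) * weylQ (s_ i) (lead K')) else 1.

Lemma lead_cat K J : lead (K ++ J) = lead K * weylQ (wd K) (lead J).
Proof.
elim: K => [|i K IH] /=; first by rewrite wd_nil weylQ1 mul1r.
by rewrite IH rmorphM wd_cons weylQM mulNr mulrA.
Qed.

(** All other terms of X_K come from proper subwords, whose products have length below that of K. *)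
Lemma XK_coef K u : (size K <= len u)%N -> XK K u = if u == wd K then lead K else 0.
Proof.
elim: K u => [|i K IH] u /= Ku; first by rewrite XK_nil qw_one wd_nil.
rewrite XK_cons demazureM_coef IH; last exact: ltnW.
rewrite (_ : (u == wd K) = false); last first.
  by apply: contraTF Ku => /eqP ->; rewrite -leqNgt len_wd.
have su : (size K <= len (s_ i * u)%g)%N.
  have := len_cons_le HPi i (s_ i * u)%g; rewrite mulgA weyl_refl_sq mul1g.
  by move=> h; rewrite -ltnS; apply: leq_trans Ku h.
rewrite IH // wd_cons -(can2_eq (mulKVg (s_ i)) (mulKg (s_ i))) weyl_reflV.
by case: eqP => _; rewrite ?rmorph0 ?subrr ?mulr0 // sub0r mulrN.
Qed.

Lemma lead_reduced K : reduced Pi K -> lead K = (-1) ^+ size K * \prod_(b in inv Pi (wd K)) rootV b.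
Proof.
elim: K => [|i K IH] /=.
  by rewrite expr0 mul1r wd_nil inv1 big_pred0 // => b; rewrite inE.
move=> /(reduced_cons HPi)[rK p]; rewrite IH // wd_cons inv_cons // big_setU1; last first.
  apply/imsetP => -[c]; rewrite inE => /andP[pc _] /(congr1 (wr (s_ i))) e.
  have := pos_refl_self HPi i; rewrite e -weyl_on_rootsM weyl_refl_sq weyl_on_roots1 pc //.
rewrite big_imset => [|b c _ _]; last first.
  by move/(congr1 (wr (s_ i))); rewrite -!weyl_on_rootsM weyl_refl_sq !weyl_on_roots1.
rewrite rmorphM rmorphXn rmorphN rmorph1 rmorph_prod exprS mulN1r mulNr; congr (- _).
rewrite mulrCA; congr (_ * (_ * _)); apply: eq_bigr => b _; exact: weylQ_rootV.
Qed.

Lemma lead_wd K J : reduced Pi K -> reduced Pi J -> wd K = wd J -> lead K = lead J.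
Proof.
move=> rK rJ e; rewrite !lead_reduced // e; congr (_ ^+ _ * _).
by rewrite -(eqP rK) -(eqP rJ) e.
Qed.

Definition Xspan (P : pred (seq 'I_n)) (z : QW) := exists r : seq (S * seq 'I_n),
  all (fun p => P p.2) r /\ z = \sum_(p <- r) toQ p.1 *: XK p.2.

Lemma Xspan0 P : Xspan P 0.
Proof. by exists [::]; rewrite big_nil. Qed.

Lemma XspanD P y z : Xspan P y -> Xspan P z -> Xspan P (y + z).
Proof.
move=> [r [Pr ->]] [r' [Pr' ->]]; exists (r ++ r'); rewrite all_cat Pr Pr'.
by rewrite big_cat.
Qed.

Lemma XspanZ P s z : Xspan P z -> Xspan P (toQ s *: z).
Proof.
move=> [r [Pr ->]]; exists [seq (s * p.1, p.2) | p <- r]; rewrite all_map; split=> //.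
by rewrite scaler_sumr big_map; apply: eq_bigr => p _; rewrite scalerA toQM.
Qed.

Lemma XspanN P z : Xspan P z -> Xspan P (- z).
Proof. by move=> /(XspanZ (-1)); rewrite toQN toQ1 scaleN1r. Qed.

Lemma Xspan_sum P (I : Type) (r : seq I) (Q' : pred I) (f : I -> QW) :
  (forall i, Q' i -> Xspan P (f i)) -> Xspan P (\sum_(i <- r | Q' i) f i).
Proof. move=> h; elim/big_ind: _ => //; [exact: Xspan0|exact: XspanD]. Qed.

Lemma Xspan_XK (P : pred (seq 'I_n)) K : P K -> Xspan P (XK K).
Proof. by move=> PK; exists [:: (1, K)]; rewrite /= PK big_seq1 /= toQ1 scale1r. Qed.

Lemma Xspan_sub (P P' : pred (seq 'I_n)) z : subpred P P' -> Xspan P z -> Xspan P' z.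
Proof. by move=> h [r [Pr ->]]; exists r; split=> //; apply: sub_all Pr => p; apply: h. Qed.

Lemma Xspan_ind (P : pred (seq 'I_n)) (A : QW -> Prop) :
  A 0 -> (forall y z, A y -> A z -> A (y + z)) -> (forall s K, P K -> A (toQ s *: XK K)) ->
  forall z, Xspan P z -> A z.
Proof.
move=> A0 AD AX z [r [Pr ->]]; rewrite big_seq; elim/big_ind: _ => // p pr.
by apply: AX; apply: (allP Pr).
Qed.

Definition words Xi l : pred (seq 'I_n) := fun K => all (mem Xi) K && (size K <= l)%N.

Lemma words_le Xi k l : (k <= l)%N -> subpred (words Xi k) (words Xi l).
Proof. by move=> kl K /andP[h h']; rewrite /words h (leq_trans h'). Qed.

(** Leibniz rule, with t the divided difference of s. It moves coefficients to the left, which is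
    why D_F is the S-span of the X_K. *)
Lemma demazureZ i s (z : QW) : exists t,
  X_ i * (toQ s *: z) = toQ t *: z + toQ (weyl_fga (s_ i) s) *: (X_ i * z).
Proof.
have [t e] := divdiff_ex (Pi i) s; exists t.
have e' : toQ t = rootV (Pi i) * (toQ s - toQ (weyl_fga (s_ i) s)).
  by rewrite -toQB e toQM mulrCA mulrA rootVP mul1r.
apply/ffunP => u; rewrite demazureM_coef [RHS]qw_add [X in _ = X + _]qw_scale [X in _ = _ + X]qw_scale.
rewrite demazureM_coef [X in _ * (X - _)]qw_scale [X in weylQ _ X]qw_scale weylQ_mul weylQ_toQ e'.
by ring.
Qed.

Lemma Xspan_demazure Xi l i z : i \in Xi -> Xspan (words Xi l) z -> Xspan (words Xi l.+1) (X_ i * z).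
Proof.
move=> iXi; move: z; apply: Xspan_ind => [|y y'|s K /andP[KXi Kl]].
- by rewrite mulr0; apply: Xspan0.
- by rewrite mulrDr; apply: XspanD.
have [t ->] := demazureZ i s (XK K); rewrite -XK_cons.
by apply: XspanD; apply/XspanZ/Xspan_XK; rewrite /words /= ?iXi KXi // (leq_trans Kl).
Qed.

Lemma Xspan_XKl Xi l K z : all (mem Xi) K -> Xspan (words Xi l) z ->
  Xspan (words Xi (size K + l)) (XK K * z).
Proof.
elim: K => [|i K IH] /=; first by rewrite XK_nil mul1r.
by move=> /andP[iXi KXi] hz; rewrite XK_cons -mulrA; apply: Xspan_demazure => //; apply: IH.
Qed.

Lemma Xspan_XKr Xi l K z : all (mem Xi) K -> Xspan (words Xi l) z ->
  Xspan (words Xi (l + size K)) (z * XK K).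
Proof.
move=> KXi; move: z; apply: Xspan_ind => [|y y'|s J /andP[JXi Jl]].
- by rewrite mul0r; apply: Xspan0.
- by rewrite mulrDl; apply: XspanD.
rewrite -qw_scaleAl -XK_cat; apply/XspanZ/Xspan_XK.
by rewrite /words all_cat JXi KXi size_cat leq_add2r.
Qed.

Lemma Xspan_toQr Xi l s z : Xspan (words Xi l) z -> Xspan (words Xi l) (z * (toQ s *: delta 1%g)).
Proof.
move: z; apply: Xspan_ind => [|y y'|t K /andP[KXi Kl]].
- by rewrite mul0r; apply: Xspan0.
- by rewrite mulrDl; apply: XspanD.
rewrite -qw_scaleAl; apply/XspanZ; apply: (Xspan_sub (words_le Kl)).
rewrite -[size K]addn0; apply: Xspan_XKl => //; apply: XspanZ; rewrite -[delta 1%g]/(1 : QW) -XK_nil.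
exact: Xspan_XK.
Qed.

Lemma demazure_sq i : X_ i * X_ i = toQ (kap F (fsval (Pi i))) *: X_ i.
Proof.
rewrite {1}demazureM {2 3}/demazure deltaZ weylQ_rootV mulrBr mulr1 deltaM weyl_refl_sq -/(rneg _).
have -> : toQ (kap F (fsval (Pi i))) = rootV (Pi i) + rootV (rneg (Pi i)).
  have e1 := rootVP (Pi i); have e2 := rootVP (rneg (Pi i)).
  have := congr1 toQ (kapE F (fsval (Pi i))); rewrite -rnegE toQD !toQM.
  move: (toQ (x (fsval (Pi i)))) (toQ (x (fsval (rneg (Pi i))))) (toQ (kap _ _)) e1 e2 => a b k e1 e2 e.
  transitivity (k * (a * rootV (Pi i)) * (b * rootV (rneg (Pi i)))); first by rewrite e1 e2 !mulr1.
  transitivity (a * b * k * rootV (Pi i) * rootV (rneg (Pi i))); first by ring.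
  rewrite -e; transitivity (a * rootV (Pi i) * rootV (rneg (Pi i)) + (b * rootV (rneg (Pi i))) * rootV
      (Pi i)); first by ring.
  by rewrite e1 e2 !mul1r addrC.
rewrite /demazure -[delta 1%g]/(1 : QW) -[X in _ - _ *: X]opprB scalerN opprK -scalerDl !scalerA.
by congr (_ *: _); rewrite mulrC.
Qed.

Lemma DF_Xspan z : DF F Pi z -> exists l, Xspan (words finset.setT l) z.
Proof.
have allT K : all (mem (finset.setT : {set 'I_n})) K by apply/allP => i; rewrite !inE.
elim=> {z} [s|i|y z _ [k hy] _ [l hz]|y z _ [k hy] _ [l hz]|c z _ [l hz]].
- exists 0%N; apply: XspanZ; rewrite -[delta 1%g]/(1 : QW) -XK_nil; exact: Xspan_XK.
- by exists 1%N; rewrite -[X_ i]mulr1 -XK_nil -XK_cons; apply: Xspan_XK; rewrite /words allT.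
- exists (maxn k l); apply: XspanD; [apply: Xspan_sub hy|apply: Xspan_sub hz]; apply: words_le.
    exact: leq_maxl.
  exact: leq_maxr.
- exists (k + l)%N; move: z hz; apply: Xspan_ind => [|z1 z2 h1 h2|s K /andP[_ Kl]].
  + by rewrite mulr0; apply: Xspan0.
  + by rewrite mulrDr; apply: XspanD.
  rewrite -[XK K]mul1r qw_scaleAl mulrA.
  apply: Xspan_sub (Xspan_XKr (allT K) (Xspan_toQr s hy)).
  by apply: words_le; rewrite leq_add2l.
by exists l; apply: XspanZ.
Qed.

Lemma Xspan_DF P z : Xspan P z -> DF F Pi z.
Proof.
have DS s y : DF F Pi y -> DF F Pi (toQ s *: y).
  by move=> h; rewrite -[y]mul1r qw_scaleAl; apply: DF_mul => //; apply: DF_S.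
apply: Xspan_ind => [|y y'|s K _].
- by have := @DF_S R F D n Pi 0; rewrite toQ0 scale0r.
- exact: DF_add.
apply: DS; elim: K => [|i K IH].
  by rewrite XK_nil; have := @DF_S R F D n Pi 1; rewrite toQ1 scale1r.
by rewrite XK_cons; apply: DF_mul => //; apply: DF_X.
Qed.

End Words.
End Localized.

(** * Membership in the span of the X_K by pairing *)

Section Key.
Variables (R : comPzRingType) (F : fgl R) (D : root_datum).
Local Notation W := (weyl D).
Local Notation S := (fga F D).
Local Notation Q := (fgaQ F D).
Local Notation QW := (QW F D).
Local Notation x := (fga_x F).
Local Notation wr := weyl_on_roots.
Local Notation toQ := (@toQ R F D).
Local Notation delta := (@delta R F D).
Variables (n : nat) (Pi : 'I_n -> rootset D).
Hypothesis HPi : simple_roots Pi.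
Local Notation s_ i := (weyl_refl (Pi i)).
Local Notation wd := (wprod Pi).
Local Notation X_ := (demazure F Pi).
Local Notation XK := (XK F Pi).
Local Notation len := (len Pi).
Local Notation w0 := (w0 Pi).
Local Notation par := (parabolic Pi).
Implicit Types (K J : seq 'I_n) (Xi : {set 'I_n}) (w u v : W).

Lemma XK_par Xi K u : all (mem Xi) K -> u \notin par Xi -> XK K u = 0.
Proof.
elim: K u => [|i K IH] u /=.
  by rewrite XK_nil qw_one; case: eqP => // ->; rewrite group1.
move=> /andP[iXi KXi] uXi; rewrite XK_cons demazureM_coef !IH // ?rmorph0 ?subrr ?mulr0 //.
by rewrite groupMl // parabolic_s.
Qed.

(** A term of z at v no longer than u meets X_J at v^-1 w0, whose length is at least that of J; by
    triangularity only v = u contributes. *)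
Lemma pairing_coef Xi (z : QW) u J : (forall v, v \notin par Xi -> z v = 0) ->
  (forall v, (len u < len v)%N -> z v = 0) -> u \in par Xi ->
  reduced Pi J -> wd J = (u^-1 * w0 Xi)%g ->
  (z * XK J) (w0 Xi) = z u * weylQ u (lead F Pi J).
Proof.
move=> zXi zl uXi rJ eJ; rewrite qw_mul_coef.
have E v : v \in par Xi -> (len v <= len u)%N ->
    XK J (v^-1 * w0 Xi)%g = if v == u then lead F Pi J else 0.
  move=> vXi vu; rewrite XK_coef //.
    rewrite eJ; congr (if _ then _ else _).
    by apply/eqP/eqP => [/mulIg/invg_inj //|->].
  have := len_w0V HPi vXi; have := len_w0V HPi uXi; rewrite -eJ (eqP rJ); lia.
rewrite (bigD1 u) //= E // eqxx [X in _ + X]big1 ?addr0 // => v vu.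
have [vXi|vXi] := boolP (v \in par Xi); last by rewrite zXi // mul0r.
have [vl|vl] := leqP (len v) (len u); last by rewrite zl // mul0r.
by rewrite E // (negPf vu) rmorph0 mulr0.
Qed.

Definition words_lt Xi l : pred (seq 'I_n) := fun K => all (mem Xi) K && (size K < l)%N.

(** Descent on the length of the support. Let I and J be reduced words of u and u^-1 w0, with u of
    maximal length. Then p lead(I) u(lead(J)) is a unit, so integrality of the pairing makes z u an
    S-multiple of lead(I). The factor p stays abstract because it is a product over negative roots
    in rank two and over positive roots in [span_intQ]. *)
Lemma key_span Xi (p : Q) k (z : QW) :
  (forall K, all (mem Xi) K -> intQ (p * XK K (w0 Xi))) ->
  (forall K, reduced Pi K -> wd K = w0 Xi ->
     exists e e', p * lead F Pi K = toQ e' /\ e * e' = 1) ->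
  (forall v, v \notin par Xi -> z v = 0) ->
  (forall v, (k <= len v)%N -> z v = 0) ->
  (forall J, all (mem Xi) J -> intQ (p * (z * XK J) (w0 Xi))) ->
  Xspan (F := F) Pi (words_lt Xi k) z.
Proof.
move=> H1 H2; elim: k z => [|k IH] z zXi zk zp.
  rewrite (_ : z = 0); first exact: Xspan0.
  by apply/ffunP => v; rewrite zk // qw_zero.
(* The pair (0, [::]) is a default for u outside W_Xi or of length other than k. *)
have hu u : exists sK : S * seq 'I_n, u \in par Xi -> len u = k ->
   [/\ all (mem Xi) sK.2, reduced Pi sK.2, wd sK.2 = u & z u = toQ sK.1 * lead F Pi sK.2].
  have [uXi|] := boolP (u \in par Xi); last by exists (0, [::]).
  have [uk|/eqP uk] := eqVneq (len u) k; last by exists (0, [::]).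
  have [I [IXi rI eI]] := reduced_ex HPi uXi.
  have [J [JXi rJ eJ]] := reduced_ex HPi (groupM (groupVr uXi) (w0_mem Pi Xi)).
  have eIJ : wd (I ++ J) = w0 Xi by rewrite wd_cat eI eJ mulKVg.
  have rIJ : reduced Pi (I ++ J).
    by rewrite /reduced eIJ size_cat -(eqP rI) -(eqP rJ) eI eJ (len_w0V HPi).
  have [e [e' [pe ee]]] := H2 _ rIJ eIJ; have [s es] := zp J JXi.
  exists (e * s, I) => _ _; split=> //=.
  have hz v : (len u < len v)%N -> z v = 0 by rewrite uk; apply: zk.
  move: es; rewrite (pairing_coef zXi hz uXi rJ eJ) => es.
  move: pe; rewrite lead_cat eI => pe.
  have ee1 : toQ e * toQ e' = 1 by rewrite -toQM ee toQ1.
  rewrite toQM -mulrA -es.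
  transitivity (z u * (toQ e * (p * (lead F Pi I * weylQ u (lead F Pi J))))); first by rewrite pe ee1 mulr1.
  by ring.
have /choice[sK hsK] := hu.
(* y has the same coefficients as z at length k, so z - y satisfies the hypotheses for the bound
   k. *)
pose y : QW := \sum_(u in par Xi | len u == k) toQ (sK u).1 *: XK (sK u).2.
have yE v : (k <= len v)%N -> v \in par Xi -> y v = z v.
  move=> kv vXi; rewrite qw_sum.
  have E u : u \in par Xi -> len u = k -> (toQ (sK u).1 *: XK (sK u).2) v = if v == u then z v else 0.
    move=> uXi uk; have [_ rK eK zu] := hsK u uXi uk.
    rewrite qw_scale XK_coef //; last by rewrite -(eqP rK) eK uk.
    by rewrite eK; case: eqP => [->|_]; rewrite ?mulr0.
  have [vk|vk] := eqVneq (len v) k.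
    rewrite -[RHS]addr0 (bigD1 v); last by rewrite vXi vk eqxx.
    congr (_ + _); first by rewrite E // eqxx.
    apply: big1 => u /andP[/andP[uXi /eqP uk] uv].
    by rewrite E // eq_sym (negPf uv).
  rewrite zk ?big1 // => [u /andP[uXi /eqP uk]|]; last by rewrite ltn_neqAle eq_sym vk.
  by rewrite E //; case: (v =P u) => // vu; move: vk; rewrite vu uk eqxx.
have ySp : Xspan (F := F) Pi (words_lt Xi k.+1) y.
  apply: Xspan_sum => u /andP[uXi /eqP uk]; have [KXi rK eK _] := hsK u uXi uk.
  by apply/XspanZ/Xspan_XK; rewrite /words_lt KXi ltnS -(eqP rK) eK uk leqnn.
rewrite -[z](subrK y); apply: XspanD => //.
apply: (@Xspan_sub R F D n Pi (words_lt Xi k)).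
  by move=> K /andP[h1 h2]; rewrite /words_lt h1 ltnS ltnW.
apply: IH => [v vXi|v kv|J JXi].
- rewrite qw_add qw_opp zXi // qw_sum big1 ?subr0 // => u /andP[uXi /eqP uk].
  by have [KXi _ _ _] := hsK u uXi uk; rewrite qw_scale (XK_par KXi) // mulr0.
- rewrite qw_add qw_opp; have [vXi|vXi] := boolP (v \in par Xi); first by rewrite yE // subrr.
  rewrite zXi // qw_sum big1 ?subr0 // => u /andP[uXi /eqP uk].
  by have [KXi _ _ _] := hsK u uXi uk; rewrite qw_scale (XK_par KXi) // mulr0.
rewrite mulrBl qw_add qw_opp mulrBr; apply: intQD; first exact: zp.
apply: intQN; rewrite mulr_suml qw_sum mulr_sumr.
apply: intQ_sum => u /andP[uXi /eqP uk]; have [KXi _ _ _] := hsK u uXi uk.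
rewrite -qw_scaleAl qw_scale mulrCA -XK_cat; apply: intQM; first exact: intQ_toQ.
by apply: H1; rewrite all_cat KXi.
Qed.

(* The successive values of phi along X_J are the divided differences of f. *)
Lemma divisible_intQ (T : Type) (rho : T -> 'I_n) (phi : {scalar QW}) (f : seq T -> S) (J : seq T) :
  (forall K : seq T, phi (delta (wprod (Pi \o rho) K)) = toQ (f K)) ->
  divisible (Pi \o rho) (size J) 0 f -> intQ (phi (XK (map rho J))).
Proof.
elim/last_ind: J phi f => [|J c IH] phi f hf.
  by move=> _; exists (f [::]); rewrite -hf wd_nil XK_nil.
rewrite size_rcons => -[_ /(_ c)[g [eg hg]]].
rewrite map_rcons XK_rcons -[phi _]/(qw_act (X_ (rho c)) phi (XK (map rho J))).
apply: IH hg => K; set w := wprod _ _.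
rewrite /= /qw_act_fun /demazure -[Defs.frac _ _ _]/(rootV F (Pi (rho c))).
rewrite deltaZ weylQ_rootV linearZ mulrBr mulr1 linearB /= deltaM.
rewrite -[(w * _)%g]/(w * weyl_refl ((Pi \o rho) c))%g -wd_rcons !hf -toQB eg toQM.
rewrite mulrCA mulrA [X in X * _](_ : _ = 1) ?mul1r //.
exact: (rootVP F (wr w (Pi (rho c)))).
Qed.

End Key.

Lemma braid_telescope (A : pzRingType) (x y a b c d k : A) :
  x * a - y * b = x * (a - c * k) + (x * c - y * d) * k - y * (b - d * k).
Proof. by rewrite !mulrBr mulrBl !mulrA addrA subrK opprB addrA subrK. Qed.

(** * Change of word modulo shorter words *)

Section Straightening.
Variables (R : comPzRingType) (F : fgl R) (D : root_datum).
Local Notation W := (weyl D).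
Local Notation S := (fga F D).
Local Notation Q := (fgaQ F D).
Local Notation QW := (QW F D).
Local Notation x := (fga_x F).
Local Notation wr := weyl_on_roots.
Local Notation toQ := (@toQ R F D).
Local Notation delta := (@delta R F D).
Variables (n : nat) (Pi : 'I_n -> rootset D).
Hypothesis HPi : simple_roots Pi.
Local Notation s_ i := (weyl_refl (Pi i)).
Local Notation wd := (wprod Pi).
Local Notation X_ := (demazure F Pi).
Local Notation XK := (XK F Pi).
Local Notation len := (len Pi).
Local Notation w0 := (w0 Pi).
Local Notation par := (parabolic Pi).
Local Notation lead := (lead F Pi).
Local Notation Xspan := (Xspan (F := F) Pi).
Implicit Types (K J I : seq 'I_n) (Xi : {set 'I_n}) (w u v : W).

(** The leading coefficients agree by [lead_wd], so the difference is supported on lengths below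
    that of I and [key_span] bounds its words accordingly. *)
Lemma span_reduced_w0 Xi (p : Q) I J :
  (forall K, all (mem Xi) K -> intQ (p * XK K (w0 Xi))) ->
  (forall K, reduced Pi K -> wd K = w0 Xi ->
     exists e e', p * lead K = toQ e' /\ e * e' = 1) ->
  all (mem Xi) I -> all (mem Xi) J -> reduced Pi I -> reduced Pi J ->
  wd I = w0 Xi -> wd J = w0 Xi -> Xspan (words_lt Xi (size I)) (XK I - XK J).
Proof.
move=> H1 H2 IXi JXi rI rJ eI eJ.
have sIJ : size I = size J by rewrite -(eqP rI) -(eqP rJ) eI eJ.
apply: (key_span HPi H1 H2) => [v vXi|v vk|K KXi].
- by rewrite qw_add qw_opp !(XK_par _ _ vXi) // subrr.
- rewrite qw_add qw_opp !XK_coef -?sIJ // eI eJ.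
  by case: eqP => _; rewrite ?subrr // (lead_wd F HPi rI rJ) ?subrr // eI eJ.
rewrite mulrBl qw_add qw_opp mulrBr -!XK_cat.
by apply: intQD; [|apply: intQN]; apply: H1; rewrite all_cat ?IXi ?JXi.
Qed.

Lemma words_lt_sub (Xi Xi' : {set 'I_n}) k l : Xi \subset Xi' -> (k <= l)%N ->
  subpred (words_lt Xi k) (words_lt Xi' l).
Proof.
move=> /fintype.subsetP XX kl K /andP[KXi Kk]; rewrite /words_lt (leq_trans Kk) // andbT.
by apply: sub_all KXi => i /XX.
Qed.

Lemma words_lt0 Xi z : Xspan (words_lt Xi 0) z -> z = 0.
Proof.
move: z; apply: Xspan_ind => // [y z -> ->|s K]; first by rewrite addr0.
by rewrite /words_lt ltn0 andbF.
Qed.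

Lemma words_lt_demazure Xi l i z : i \in Xi ->
  Xspan (words_lt Xi l) z -> Xspan (words_lt Xi l.+1) (X_ i * z).
Proof.
case: l => [|l] iXi; last exact: Xspan_demazure.
by move=> /words_lt0 ->; rewrite mulr0; apply: Xspan0.
Qed.

Lemma words_lt_XKr Xi l K z : all (mem Xi) K ->
  Xspan (words_lt Xi l) z -> Xspan (words_lt Xi (l + size K)) (z * XK K).
Proof.
case: l => [|l] KXi; last exact: Xspan_XKr.
by move=> /words_lt0 ->; rewrite mul0r; apply: Xspan0.
Qed.

Hypothesis rank2 : forall i j I J, i != j -> let Xi := [set i; j]%SET in
  all (mem Xi) I -> all (mem Xi) J -> reduced Pi I -> reduced Pi J ->
  wd I = w0 Xi -> wd J = w0 Xi -> Xspan (words_lt Xi (size I)) (XK I - XK J).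

Lemma w0_reduced_head Xi i : i \in Xi -> exists K,
  [/\ all (mem Xi) (i :: K), reduced Pi (i :: K) & wd (i :: K) = w0 Xi].
Proof.
move=> iXi; have [K [KXi rK eK]] := reduced_ex HPi (groupM (parabolic_s Pi iXi) (w0_mem Pi Xi)).
exists K; have e : wd (i :: K) = w0 Xi by rewrite wd_cons eK mulgA weyl_refl_sq mul1g.
split=> //=; first by rewrite iXi.
rewrite /reduced e (len_cons_neg HPi (i := i)) -?eK ?(eqP rK) //.
by rewrite w0V // w0_neg.
Qed.

(* Matsumoto's argument: words starting with i and j are both compared with words that
   start with a reduced word of the longest element of the parabolic of i and j. *)
Lemma XK_reduced Xi I J : all (mem Xi) I -> all (mem Xi) J -> reduced Pi I -> reduced Pi J ->
  wd I = wd J -> Xspan (words_lt Xi (size I)) (XK I - XK J).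
Proof.
have [l] := ubnP (size I); elim: l I J => // l IH [|i I] [|j J] lI IXi JXi rI rJ e.
- by rewrite subrr; apply: Xspan0.
- by move: rI rJ; rewrite /reduced e => /eqP->.
- by move: rI rJ; rewrite /reduced e => /eqP->.
have [iXi IXi'] := andP IXi; have [jXi JXi'] := andP JXi.
have [rI' pI] := reduced_cons HPi rI; have [rJ' pJ] := reduced_cons HPi rJ.
have [eij|ij] := eqVneq i j.
  rewrite eij !XK_cons -mulrBr; apply: words_lt_demazure => //; apply: IH => //.
  by move: e; rewrite eij !wd_cons => /mulgI.
pose P := [set i; j]%SET; pose u := w0 P; set w := wd (i :: I) in e.
have iP : i \in P by rewrite !inE eqxx.
have jP : j \in P by rewrite !inE eqxx orbT.
have PXi : P \subset Xi by apply/fintype.subsetP => k; rewrite !inE => /orP[] /eqP ->.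
have negw k : k \in P -> ~~ pos Pi (wr w^-1%g (Pi k)).
  rewrite !inE => /orP[] /eqP ->; [rewrite /w|rewrite e];
    by rewrite wd_cons invMg weyl_reflV weyl_on_rootsM -/(rneg _) weyl_on_roots_neg pos_neg // ?pI ?pJ.
have uV : (u^-1 = u)%g by apply: w0V.
(* v is the shortest element of the coset of w under the parabolic of i and j. A reduced word of u,
   which may be chosen to start with i or with j, followed by one of v is therefore a reduced word
   of w. *)
pose v := (u * w)%g.
have uv : w = (u * v)%g by rewrite /v mulgA w0_sq // mul1g.
have posv k : k \in P -> pos Pi (wr v^-1%g (Pi k)).
  move=> kP; rewrite /v invMg uV weyl_on_rootsM -[wr u (Pi k)]rnegK weyl_on_roots_neg pos_neg //.
  apply: (neg_supp_weyl (Xi := P) (HPi := HPi) _ _ negw); last by rewrite pos_neg // w0_neg.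
  by move=> m mP; rewrite rc_neg (supp_wr (w0_mem Pi P) (supp_simple HPi kP)) ?oppr0.
have lenw : len w = (len u + len v)%N.
  rewrite -(lenV HPi w) {1}uv invMg uV (len_parabolicM HPi (w0_mem Pi P) posv) lenV //.
  exact: addnC.
have uXi : u \in par Xi.
  have /parabolicP[A AP eA] := w0_mem Pi P; rewrite /u eA; apply: parabolic_wd.
  by apply: sub_all AP => k kP; apply: (fintype.subsetP PXi).
have vXi : v \in par Xi by rewrite groupM // parabolic_wd.
have [K [KXi rK eK]] := reduced_ex HPi vXi.
have [A [AP rA eA]] := w0_reduced_head iP; have [B [BP rB eB]] := w0_reduced_head jP.
have sA : (size A).+1 = len u by rewrite -[_.+1]/(size (i :: A)) -(eqP rA) eA.
have sB : (size B).+1 = len u by rewrite -[_.+1]/(size (j :: B)) -(eqP rB) eB.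
have sK : size K = len v by rewrite -(eqP rK) eK.
have lI' : (size I).+1 = len w by rewrite -[_.+1]/(size (i :: I)) -(eqP rI).
have lJ' : (size J).+1 = len w by rewrite e -[_.+1]/(size (j :: J)) -(eqP rJ).
have subXi M : all (mem P) M -> all (mem Xi) M by apply: sub_all => k /(fintype.subsetP PXi).
have AXi : all (mem Xi) A by apply: subXi; case/andP: AP.
have BXi : all (mem Xi) B by apply: subXi; case/andP: BP.
have eAK : wd I = wd (A ++ K).
  apply: (mulgI (s_ i)); rewrite wd_cat mulgA -!wd_cons -/w eK eA.
  exact: uv.
have eBK : wd J = wd (B ++ K).
  apply: (mulgI (s_ j)); rewrite wd_cat mulgA -!wd_cons eK eB -e; exact: uv.
have red C c : wd (c :: C) = u -> (size C).+1 = len u -> wd (c :: C ++ K) = w /\ reduced Pi (c :: C ++ K).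
  move=> eC sC; have h : wd (c :: C ++ K) = w by rewrite -cat_cons wd_cat eC eK -uv.
  by rewrite /reduced h lenw /= size_cat -addSn sC sK.
have [_ rAK] := red A i eA sA; have [_ rBK] := red B j eB sB.
have [rAK' _] := reduced_cons HPi rAK; have [rBK' _] := reduced_cons HPi rBK.
(* The outer terms compare words of a common shorter element, after the same first letter; the
   middle one is the rank-two relation. *)
have -> : XK (i :: I) - XK (j :: J) = X_ i * (XK I - XK (A ++ K))
    + (XK (i :: A) - XK (j :: B)) * XK K - X_ j * (XK J - XK (B ++ K)).
  rewrite !XK_cons !XK_cat; exact: braid_telescope.
apply: XspanD; first apply: XspanD.
- apply: words_lt_demazure => //; apply: IH => //; first by rewrite all_cat AXi.
- have -> : size (i :: I) = (size (i :: A) + size K)%N by rewrite /= lI' lenw sA sK.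
  apply: words_lt_XKr => //; apply: Xspan_sub (words_lt_sub PXi (leqnn _)) _.
  exact: rank2.
apply: XspanN; rewrite (_ : size (i :: I) = (size J).+1); last by rewrite /= lI' lJ'.
apply: words_lt_demazure => //; apply: IH => //; last by rewrite all_cat BXi.
by move: lI; rewrite /= lI' -lJ'.
Qed.

(** If a reduced word ceases to be reduced on appending i, it can be replaced, modulo shorter words,
    by a word ending in i. Then X_i X_i = kap X_i saves a letter. *)
Lemma XK_nonreduced Xi K : all (mem Xi) K -> ~~ reduced Pi K ->
  Xspan (words_lt Xi (size K)) (XK K).
Proof.
elim/last_ind: K => [|K i IH]; first by rewrite /reduced wd_nil len1.
rewrite all_rcons size_rcons => /andP[iXi KXi] nr.
have iXi1 : all (mem Xi) [:: i] by apply/andP.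
rewrite -cats1 XK_cat -addn1 -[1%N]/(size [:: i]).
have [rK|nK] := boolP (reduced Pi K); last by apply: words_lt_XKr => //; apply: IH.
have np : ~~ pos Pi (wr (wd K) (Pi i)).
  apply: contraNN nr => p; rewrite /reduced wd_rcons len_rcons // size_rcons.
  by rewrite (eqP rK).
have lK := len_rcons_neg HPi np.
have [J [JXi rJ eJ]] := reduced_ex HPi (groupM (parabolic_wd Pi KXi) (parabolic_s Pi iXi)).
have sJ : size K = (size J).+1 by rewrite -(eqP rK) lK -eJ (eqP rJ).
have eJi : wd (rcons J i) = wd K by rewrite wd_rcons eJ -mulgA weyl_refl_sq mulg1.
rewrite -[XK K](subrK (XK (rcons J i))) mulrDl; apply: XspanD.
  apply: words_lt_XKr => //; apply: XK_reduced => //; first by rewrite all_rcons; apply/andP.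
  by rewrite /reduced eJi size_rcons -sJ (eqP rK).
rewrite XK_rcons XK_cons XK_nil mulr1 -mulrA demazure_sq sJ addn1.
have e1 : delta 1%g * X_ i = X_ i by exact: qw_mul1l.
rewrite -{1}e1 qw_scaleAl mulrA -[X_ i]mulr1 -(XK_nil F Pi) -XK_cons.
have hJ : Xspan (words Xi (size J)) (XK J) by apply: Xspan_XK; rewrite /words JXi leqnn.
by have := Xspan_XKr iXi1 (Xspan_toQr (kap F (fsval (Pi i))) hJ); rewrite addn1.
Qed.

Definition pt_coef Xi : Q := \prod_(b in inv Pi (w0 Xi)) toQ (x (fsval b)).

Lemma pt_coef_lead Xi K : reduced Pi K -> wd K = w0 Xi -> pt_coef Xi * lead K = (-1) ^+ size K.
Proof.
move=> rK eK; rewrite lead_reduced // eK mulrCA /pt_coef -big_split big1 ?mulr1 // => b _.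
exact: rootVP.
Qed.

Lemma pt_coef_unit Xi K : reduced Pi K -> wd K = w0 Xi ->
  exists e e', pt_coef Xi * lead K = toQ e' /\ e * e' = 1.
Proof.
move=> rK eK; exists ((-1) ^+ size K), ((-1) ^+ size K); split; last by rewrite -exprD addnn -mul2n exprM
    sqrrN !expr1n.
by rewrite pt_coef_lead // rmorphXn rmorphN rmorph1.
Qed.

Lemma pt_intQ Xi K : all (mem Xi) K -> intQ (pt_coef Xi * XK K (w0 Xi)).
Proof.
have [l] := ubnP (size K); elim: l K => // l IH K; rewrite ltnS => Kl KXi.
have [rK|nK] := boolP (reduced Pi K); last first.
  have := XK_nonreduced KXi nK; move: (XK K); apply: Xspan_ind => [|y z hy hz|s J /andP[JXi Jk]].
  - by rewrite qw_zero mulr0; apply: intQ0.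
  - by rewrite qw_add mulrDr; apply: intQD.
  rewrite qw_scale mulrCA; apply: intQM; first exact: intQ_toQ.
  by apply: IH JXi; apply: leq_trans Jk Kl.
rewrite XK_coef // -?(eqP rK); last first.
  by rewrite -(len_w0M HPi (parabolic_wd Pi KXi)) leq_addl.
case: eqP => [/esym eK|_]; last by rewrite mulr0; apply: intQ0.
by have [e [e' [-> _]]] := pt_coef_unit rK eK; apply: intQ_toQ.
Qed.

Lemma span_intQ Xi (z : QW) : (forall v, v \notin par Xi -> z v = 0) ->
  (forall J, all (mem Xi) J -> intQ (pt_coef Xi * (z * XK J) (w0 Xi))) ->
  exists l, Xspan (words Xi l) z.
Proof.
move=> zXi zp; exists (len (w0 Xi)).
change (Xspan (words_lt Xi (len (w0 Xi)).+1) z).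
apply: (key_span HPi (@pt_intQ Xi) (@pt_coef_unit Xi) zXi _ zp) => v vl.
apply: zXi; apply: contraTN vl => vXi.
by rewrite -leqNgt -(len_w0M HPi vXi) leq_addl.
Qed.

End Straightening.

(** * Rank two *)

Section RankTwo.
Variables (R : comPzRingType) (F : fgl R) (D : root_datum).
Local Notation L := (lattice D).
Local Notation W := (weyl D).
Local Notation S := (fga F D).
Local Notation Q := (fgaQ F D).
Local Notation QW := (QW F D).
Local Notation x := (fga_x F).
Local Notation wr := weyl_on_roots.
Local Notation toQ := (@toQ R F D).
Local Notation delta := (@delta R F D).
Variables (n : nat) (Pi : 'I_n -> rootset D).
Hypothesis HPi : simple_roots Pi.
Local Notation s_ i := (weyl_refl (Pi i)).
Local Notation XK := (XK F Pi).
Local Notation w0 := (w0 Pi).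

Variables (i j : 'I_n).
Hypothesis ij : i != j.
Local Notation al := (fsval (Pi i)).
Local Notation be := (fsval (Pi j)).
Local Notation P := [set i; j]%SET.

Definition letter (c : bool) : 'I_n := if c then i else j.
Local Notation rho := (Pi \o letter).
Local Notation wd := (wprod rho).

Definition emb (p : int * int) : L := p.1 *: al + p.2 *: be.

Lemma embD p q : emb (p.1 + q.1, p.2 + q.2) = emb p + emb q.
Proof. by rewrite /emb !scalerDl addrACA. Qed.
Lemma embN p : emb (- p.1, - p.2) = - emb p.
Proof. by rewrite /emb !scaleNr opprD. Qed.
Lemma embZ k p : emb (k * p.1, k * p.2) = k *: emb p.
Proof. by rewrite /emb scalerDr !scalerA. Qed.
Lemma emb0 : emb (0, 0) = 0.
Proof. by rewrite /emb !scale0r addr0. Qed.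

Definition state := ((int * int) * (int * int))%type.
Implicit Types (s : state) (K : seq bool) (c : bool).

Variables (a b : int).
Hypotheses (ha : coroot (Pi i) be = a) (hb : coroot (Pi j) al = b).

Definition comb (p q : int) s : int * int := (p * s.1.1 + q * s.2.1, p * s.1.2 + q * s.2.2).

(* The coordinates of (w alpha, w beta), for w the product of a word. *)
Definition step s c : state :=
  if c then (comb (-1) 0 s, comb (- a) 1 s) else (comb 1 (- b) s, comb 0 (-1) s).
Definition st0 : state := ((1, 0), (0, 1)).
Definition st K : state := foldl step st0 K.

Lemma emb_comb p q s : emb (comb p q s) = p *: emb s.1 + q *: emb s.2.
Proof. by rewrite -!embZ -embD. Qed.

Lemma st_wd K : emb (st K).1 = wd K al /\ emb (st K).2 = wd K be.
Proof.
elim/last_ind: K => [|K c [IH1 IH2]].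
  by rewrite wd_nil /emb /= !scale1r !scale0r addr0 add0r.
rewrite /st foldl_rcons -/(st K) wd_rcons !weylM.
case: c; rewrite /= /refl !emb_comb IH1 IH2 ?ha ?hb ?coroot_root !weylB !weylZ.
  split; first by rewrite scale0r addr0 scaleN1r scaler_nat mulr2n opprD addNKr.
  by rewrite scale1r scaleNr addrC.
split; first by rewrite scale1r scaleNr.
by rewrite scale0r add0r scaleN1r scaler_nat mulr2n opprD addNKr.
Qed.

Lemma wd_emb K p : wd K (emb p) = emb (comb p.1 p.2 (st K)).
Proof. by have [e1 e2] := st_wd K; rewrite emb_comb e1 e2 weylD !weylZ. Qed.

Lemma weightlike_comb p q : weightlike rho (fun K => emb (comb p q (st K))).
Proof.
rewrite (_ : (fun K => _) = fun K => wd K (emb (p, q))); first exact: weightlike_wd.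
by apply/funext => K; rewrite wd_emb.
Qed.

(** For a reduced word and s = [st0] these are the inversions of its product, in the order of the
    letters. *)
Fixpoint gam s K : seq (int * int) :=
  if K is c :: K' then (if c then s.1 else s.2) :: gam (step s c) K' else [::].

Lemma gam_rcons s K c : gam s (rcons K c) =
  rcons (gam s K) (if c then (foldl step s K).1 else (foldl step s K).2).
Proof. by elim: K s => //= d K IH s; rewrite IH. Qed.

Lemma wr_letter K c : fsval (wr (wd K) (Pi (letter c))) = emb (if c then (st K).1 else (st K).2).
Proof. by have [e1 e2] := st_wd K; case: c; rewrite ?e1 ?e2. Qed.

Lemma rc_emb (c : rootset D) p : fsval c = emb p ->
  rc HPi c =1 fun k => if k == i then p.1 else if k == j then p.2 else 0.
Proof.
move=> e; apply: rc_uniq; rewrite e /root_sum (bigD1 i) //= eqxx (bigD1 j) 1?eq_sym //=.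
rewrite (negPf ij) eqxx big1 ?addr0 // => k /andP[/negPf -> /negPf ->].
by rewrite scale0r.
Qed.

Definition nonneg (p : int * int) := (0 <= p.1)%R && (0 <= p.2)%R.
Definition nonpos (p : int * int) := (p.1 <= 0)%R && (p.2 <= 0)%R.

Lemma pos_emb (c : rootset D) p : fsval c = emb p -> nonneg p -> pos Pi c.
Proof.
move=> e /andP[p1 p2]; apply/(posP HPi) => k; rewrite (rc_emb e).
by case: ifP => // _; case: ifP.
Qed.

Lemma nonpos_neg (c : rootset D) p : fsval c = emb p -> nonpos p = ~~ pos Pi c.
Proof.
move=> e; apply/idP/idP => [/andP[p1 p2]|].
  rewrite -pos_neg //; apply: (@pos_emb _ (- p.1, - p.2)); first by rewrite rnegE e embN.
  by rewrite /nonneg /= !oppr_ge0 p1.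
rewrite /pos negbK => /(neg_rootsP HPi) h; have := h j; have := h i.
by rewrite !(rc_emb e) !eqxx (eq_sym j) (negPf ij) /nonpos => -> ->.
Qed.

Lemma reduced_gam K : all nonneg (gam st0 K) -> reduced Pi (map letter K).
Proof.
elim/last_ind: K => [|K c IH]; first by rewrite /reduced wd_nil len1.
rewrite gam_rcons all_rcons => /andP[pc /IH rK].
rewrite /reduced map_rcons wd_rcons size_rcons len_rcons ?(eqP rK) //.
rewrite /wprod big_map -/(wprod _ _); apply: pos_emb pc; exact: wr_letter.
Qed.

Lemma wprod_letter K : wprod Pi (map letter K) = wd K.
Proof. by rewrite /wprod big_map. Qed.

Lemma lead_rcons (J : seq 'I_n) k :
  lead F Pi (rcons J k) = - (lead F Pi J * rootV F (wr (wprod Pi J) (Pi k))).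
Proof.
rewrite -cats1 lead_cat (_ : lead F Pi [:: k] = - rootV F (Pi k)); last by rewrite /= rmorph1 mulr1.
by rewrite weylQ_opp weylQ_rootV mulrN.
Qed.

Definition negprod K : S := \prod_(p <- gam st0 K) x (- emb p).

(** Each factor x_(-b) meets - 1 / x_b, and their product is the unit 1 - kap_b x_(-b). *)
Lemma negprod_lead K : exists e e',
  toQ (negprod K) * lead F Pi (map letter K) = toQ e' /\ e * e' = 1.
Proof.
elim/last_ind: K => [|K c [e [e' [IH ee]]]].
  by exists 1, 1; rewrite /negprod big_nil !mulr1.
have -> : negprod (rcons K c) = negprod K * x (- emb (if c then (st K).1 else (st K).2)).
  by rewrite /negprod gam_rcons -cats1 big_cat big_seq1.
rewrite map_rcons lead_rcons wprod_letter.
set b' := wr (wd K) (Pi (letter c)).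
have eb : fsval b' = emb (if c then (st K).1 else (st K).2) by apply: wr_letter.
rewrite -eb toQM mulrN mulrACA IH.
set k := kap F (fsval b'); pose y := x (fsval b'); pose y' := x (- fsval b').
have ku : (1 - k * y) * (1 - k * y') = 1 by apply: kap_unit.
exists (e * (1 - k * y)), (e' * (1 - k * y')); split; last by rewrite mulrACA ee mul1r.
have h : y' = - (y * (1 - k * y')).
  by rewrite -mulNr -kap_opp -/k -/y -/y' -mulrA ku mulr1.
rewrite toQM -mulrN; congr (_ * _).
transitivity (- (toQ (- (y * (1 - k * y'))) * rootV F b')); first by rewrite -h.
by rewrite toQN toQM mulNr opprK mulrAC rootVP mul1r.
Qed.

Lemma word_letter (K : seq 'I_n) : all (mem P) K -> exists K', K = map letter K'.
Proof.
elim: K => [|k K IH]; first by exists [::].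
move=> /andP[kP /IH[K' ->]]; move: kP; rewrite !inE => /orP[] /eqP ->.
  by exists (true :: K').
by exists (false :: K').
Qed.

Lemma letters_P K : all (mem P) (map letter K).
Proof. by apply/allP => k /mapP[[] _ ->]; rewrite !inE eqxx ?orbT. Qed.

Section States.
(** [sts] is a list of states closed under [step], [fin] the state of w0, recognized by its signs,
    and K0 a reduced word of w0. Once these are explicit, every condition on them is settled by
    computation; only [gdiv] carries mathematics. *)
Variables (sts : seq state) (fin : state) (g : state -> S) (K0 : seq bool).
Hypotheses (sts0 : st0 \in sts) (stsS : all (fun s => (step s true \in sts) && (step s false \in sts)) sts).
Hypothesis (finP : all (fun s => (s == fin) == (nonpos s.1 && nonpos s.2)) sts).
Hypothesis (g0 : forall s, s \in sts -> s != fin -> g s = 0).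
Hypotheses (K0P : all nonneg (gam st0 K0)) (stK0 : st K0 = fin) (gfin : g fin = negprod K0).
Hypothesis gdiv : forall m, divisible rho m 0 (fun K => g (st K)).

Lemma st_mem K : st K \in sts.
Proof.
elim/last_ind: K => [|K c IH] //; rewrite /st foldl_rcons -/(st K).
by have /andP[h1 h2] := allP stsS _ IH; case: c.
Qed.

Lemma st_fin K : (st K == fin) = (wd K == w0 P).
Proof.
have /eqP-> := allP finP _ (st_mem K).
rewrite (nonpos_neg (wr_letter K true)) (nonpos_neg (wr_letter K false)).
apply/idP/eqP => [/andP[h1 h2]|->].
  apply: (w0_unique HPi); first by rewrite -wprod_letter parabolic_wd // letters_P.
  by move=> k; rewrite !inE => /orP[] /eqP ->.
by rewrite !w0_neg // !inE eqxx ?orbT.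
Qed.

(** The form supported at w0 with value g fin is read along words as g composed with [st], so
    divisibility makes its values on all X_K integral. *)
Lemma rank2_states (I J : seq 'I_n) : all (mem P) I -> all (mem P) J ->
  reduced Pi I -> reduced Pi J -> wprod Pi I = w0 P -> wprod Pi J = w0 P ->
  Xspan (F := F) Pi (words_lt P (size I)) (XK I - XK J).
Proof.
have eK0 : wprod Pi (map letter K0) = w0 P by rewrite wprod_letter; apply/eqP; rewrite -st_fin stK0.
have rK0 := reduced_gam K0P.
apply: (span_reduced_w0 (p := toQ (g fin)) HPi) => [K /word_letter[K' ->]|K rK eK]; last first.
  rewrite (lead_wd F HPi rK rK0) ?eK // gfin; exact: negprod_lead.
pose phi := @of_fun R F D (fun w => if w == w0 P then toQ (g fin) else 0) : {scalar QW}.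
have -> : toQ (g fin) * XK (map letter K') (w0 P) = phi (XK (map letter K')).
  rewrite /phi /= /of_fun (bigD1 (w0 P)) //= eqxx mulrC [X in _ = _ + X]big1 ?addr0 //.
  by move=> w /negPf ->; rewrite mulr0.
apply: (divisible_intQ (f := fun K => g (st K))) (gdiv _) => J1.
rewrite /phi /= of_fun_delta -st_fin; case: eqP => [->|] // /eqP h.
by rewrite g0 ?toQ0 ?st_mem.
Qed.

End States.
End RankTwo.

(** * Cartan integers of two simple roots *)

Section Cartan.
Variables (D : root_datum) (n : nat) (Pi : 'I_n -> rootset D).
Hypothesis HPi : simple_roots Pi.
Local Notation wr := weyl_on_roots.
Local Notation s_ i := (weyl_refl (Pi i)).
Local Notation cart i j := (coroot (Pi i) (fsval (Pi j))).

Lemma cartan_le0 i j : i != j -> (cart i j <= 0)%R.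
Proof.
move=> ij; have p : pos Pi (wr (s_ i) (Pi j)).
  apply: pos_refl (pos_simple HPi j) _ => //; apply/eqP => e.
  by have := rc_simple HPi i i; rewrite -e rc_simple eqxx (negPf ij).
move/(posP HPi)/(_ i): p; rewrite rc_refl rc_simple eqxx (negPf ij).
by rewrite mulr1 sub0r oppr_ge0.
Qed.

Lemma coroot_rc k (c : rootset D) i j : i != j -> (forall m, m != i -> m != j -> rc HPi c m = 0) ->
  coroot (Pi k) (fsval c) = rc HPi c i * cart k i + rc HPi c j * cart k j.
Proof.
move=> ij h; rewrite (rcE HPi c) /root_sum (bigD1 i) //= (bigD1 j) 1?eq_sym //=.
rewrite [X in _ + (_ + X)]big1 => [|m /andP[mi mj]]; last by rewrite h // scale0r.
by rewrite addr0 corootD !corootZ.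
Qed.

(** Otherwise s_i s_j alpha_i has the coordinate -1 at i and a positive one at j. *)
Lemma cartan_eq0 i j : i != j -> cart i j = 0 -> cart j i = 0.
Proof.
move=> ij a0; apply/eqP; apply: contraT => b0.
pose c := wr (s_ i) (wr (s_ j) (Pi i)).
have ri : rc HPi c i = -1.
  rewrite rc_refl weyl_on_rootsE weyl_reflE corootB corootZ coroot_root a0 mulr0 subr0.
  by rewrite rc_refl rc_simple eqxx (negPf ij) mulr0 subr0 mulr1.
have rj : rc HPi c j = - cart j i.
  by rewrite rc_refl rc_refl rc_simple (eq_sym j) (negPf ij) !eqxx mulr0 subr0 mulr1 sub0r.
have : pos Pi c.
  apply: (@pos_rc_gt0 _ _ _ HPi _ j); rewrite rj oppr_gt0 Order.POrderTheory.lt_def eq_sym.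
  by rewrite b0 cartan_le0 // eq_sym.
by move/(posP HPi)/(_ i); rewrite ri.
Qed.

(** If the product is at least 4, the coordinate at i of (s_i s_j)^k alpha_i grows without bound,
    whereas s_i s_j has finite order. *)
Lemma cartan_lt4 i j : i != j -> (cart i j * cart j i < 4)%R.
Proof.
move=> ij; rewrite Order.TotalTheory.ltNge; apply/negP => ab.
have a0 := cartan_le0 ij; have b0 : (cart j i <= 0)%R by rewrite cartan_le0 // eq_sym.
set a := cart i j in ab a0; set b := cart j i in ab b0.
pose w := (s_ i * s_ j)%g.
(* The last inequality is the extra invariant that makes the growth of the coordinate at i
   inductive. *)
have key k : let c := wr (w ^+ k)%g (Pi i) in
  [/\ forall m, m != i -> m != j -> rc HPi c m = 0, (k%:Z < rc HPi c i)%R &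
      (2 * rc HPi c j < - b * rc HPi c i)%R].
  elim: k => [|k [IH0 IH1 IH2]] /=.
    rewrite expg0 weyl_on_roots1; split=> [m mi mj||]; rewrite !rc_simple ?(negPf mi) ?eqxx //.
    by rewrite (eq_sym j) (negPf ij); clear -ab a0 b0; clearbody a b; nia.
  rewrite expgS !weyl_on_rootsM; set c := wr _ _ in IH0 IH1 IH2 *.
  set d := wr (s_ j) c.
  have di : rc HPi d i = rc HPi c i by rewrite rc_refl (negPf ij) mulr0 subr0.
  have dj : rc HPi d j = - b * rc HPi c i - rc HPi c j.
    by rewrite rc_refl eqxx mulr1 (coroot_rc j ij IH0) coroot_root -/b; ring.
  have d0 m : m != i -> m != j -> rc HPi d m = 0.
    by move=> mi mj; rewrite rc_refl (negPf mj) mulr0 subr0 IH0.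
  have ei : rc HPi (wr (s_ i) d) i = - a * rc HPi d j - rc HPi d i.
    by rewrite rc_refl eqxx mulr1 (coroot_rc i ij d0) coroot_root -/a; ring.
  have ej : rc HPi (wr (s_ i) d) j = rc HPi d j.
    by rewrite rc_refl (eq_sym j) (negPf ij) mulr0 subr0.
  split=> [m mi mj||].
  - by rewrite rc_refl (negPf mi) mulr0 subr0 d0.
  - rewrite ei dj di; move: (rc HPi c i) (rc HPi c j) IH1 IH2 => p q IH1 IH2.
    clear -ab a0 b0 IH1 IH2; clearbody a b; have a1 : (a <= -1)%R by nia.
    have h1 : (0 <= - a * (2 * (- b * p - q) + b * p - 1))%R by apply: mulr_ge0; lia.
    have h2 : (0 <= (a * b - 4) * p)%R by apply: mulr_ge0; lia.
    by nia.
  rewrite ei ej dj di; move: (rc HPi c i) (rc HPi c j) IH1 IH2 => p q IH1 IH2.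
  clear -ab a0 b0 IH1 IH2; clearbody a b.
  have h1 : (0 <= - b * p)%R by apply: mulr_ge0; lia.
  have h2 : (0 <= (a * b - 4) * (- b * p - q))%R by apply: mulr_ge0; lia.
  by nia.
have [_ h _] := key #[w]%g.
move: h; rewrite expg_order weyl_on_roots1 rc_simple eqxx.
by have := order_gt0 w; case: #[w]%g => // -[].
Qed.

Lemma cartan_cases i j : i != j -> exists k l,
  [/\ k != l, [set k; l]%SET = [set i; j]%SET &
      [\/ cart k l = 0 /\ cart l k = 0, cart k l = -1 /\ cart l k = -1,
          cart k l = -2 /\ cart l k = -1 | cart k l = -3 /\ cart l k = -1]].
Proof.
move=> ij; have ji : j != i by rewrite eq_sym.
have := cartan_lt4 ij; have := cartan_le0 ij; have := cartan_le0 ji.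
have := @cartan_eq0 _ _ ij; have := @cartan_eq0 _ _ ji.
have key (a b : int) : (b = 0 -> a = 0) -> (a = 0 -> b = 0) -> (b <= 0)%R -> (a <= 0)%R ->
    (a * b < 4)%R -> (a <= b)%R ->
    [\/ a = 0 /\ b = 0, a = -1 /\ b = -1, a = -2 /\ b = -1 | a = -3 /\ b = -1].
  move=> h1 h2 b0 a0 ab le; have [ea|/eqP na] := eqVneq a 0; first by constructor 1; rewrite h2.
  have hb : b = -1.
    have nb : b <> 0 by move/h1.
    have : b = -1 \/ b = 0 \/ (b <= -2)%R by lia.
    case=> [//|[/nb//|b2]]; exfalso.
    have : (0 <= (- b - 2) * (- a - 2))%R by apply: mulr_ge0; lia.
    by nia.
  have : a = -1 \/ a = -2 \/ a = -3 by nia.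
  by case=> [->|[->|->]]; [constructor 2|constructor 3|constructor 4].
have [le|le] := lerP (cart i j) (cart j i) => h1 h2 h3 h4 h5.
  by exists i, j; split=> //; apply: key.
exists j, i; split=> //; first by rewrite finset.setUC.
by apply: key => //; [rewrite mulrC|apply: Order.POrderTheory.ltW].
Qed.

End Cartan.

(** * Point classes in types A1xA1, A2 and B2 *)

Section RankTwoCases.
Variables (R : comPzRingType) (F : fgl R) (D : root_datum).
Local Notation L := (lattice D).
Local Notation S := (fga F D).
Local Notation x := (fga_x F).
Variables (n : nat) (Pi : 'I_n -> rootset D).
Hypothesis HPi : simple_roots Pi.
Local Notation XK := (XK F Pi).
Local Notation w0 := (w0 Pi).
Variables (i j : 'I_n).
Hypothesis ij : i != j.
Local Notation al := (fsval (Pi i)).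
Local Notation be := (fsval (Pi j)).
Local Notation P := [set i; j]%SET.
Local Notation rho := (Pi \o letter i j).
Local Notation wd := (wprod rho).
Local Notation embed := (emb Pi i j).
Local Notation X p := (x (embed p)).

Definition padd (p q : int * int) : int * int := (p.1 + q.1, p.2 + q.2).
Definition pneg (p : int * int) : int * int := (- p.1, - p.2).

Definition rank2_conclusion := forall (I J : seq 'I_n), all (mem P) I -> all (mem P) J ->
  reduced Pi I -> reduced Pi J -> wprod Pi I = w0 P -> wprod Pi J = w0 P ->
  Xspan (F := F) Pi (words_lt P (size I)) (XK I - XK J).

Section Weights.
Variables (a b : int).
Hypotheses (ha : coroot (Pi i) be = a) (hb : coroot (Pi j) al = b).
Local Notation st := (st a b).
Local Notation step := (step a b).
Local Notation gam := (gam a b).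
Implicit Types (psi : state -> int * int) (s : state).

Definition weight psi := weightlike rho (fun K => embed (psi (st K))).

Lemma weight_add psi psi' : weight psi -> weight psi' -> weight (fun s => padd (psi s) (psi' s)).
Proof.
move=> h h'; have := weightlikeD h h'; rewrite /weight.
by congr weightlike; apply/funext => K; rewrite -embD.
Qed.

Lemma weight_cst p : weight (fun=> p).
Proof. exact: weightlike_cst. Qed.

Lemma weight_comb p q : weight (comb p q).
Proof. exact: (weightlike_comb ha hb). Qed.

Fixpoint weights (psis : seq (state -> int * int)) : Prop :=
  if psis is psi :: psis' then weight psi /\ weights psis' else True.

Definition weight_prod (psis : seq (state -> int * int)) s : S := \prod_(psi <- psis) X (psi s).

Lemma divisible_weight_prod psis m : weights psis ->
  divisible rho m 0 (fun K => weight_prod psis (st K)).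
Proof.
elim: psis => [_|psi psis IH [h /IH h']].
  have := divisible_cst rho m (Sfil0 (1 : S)); apply: divisible_ext => K.
  by rewrite /weight_prod big_nil.
have := divisibleM (divisible_xw0 F m h) h'; apply: divisible_ext => K.
by rewrite pwM /weight_prod big_cons.
Qed.

Section Table.
Variables (sts : seq state) (fin : state) (K0 : seq bool).
Hypotheses (sts0 : st0 \in sts) (stsS : all (fun s => (step s true \in sts) && (step s false \in sts)) sts).
Hypothesis (finP : all (fun s => (s == fin) == (nonpos s.1 && nonpos s.2)) sts).
Hypotheses (K0P : all nonneg (gam st0 K0)) (stK0 : st K0 = fin).

(* psi is (w theta - theta) / N for theta = p alpha + q beta. *)
Lemma weight_div (N p q : int) psi : N != 0 -> (exists k, 2 * p + a * q = k * N) ->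
  (exists k, b * p + 2 * q = k * N) ->
  all (fun s => padd (p, q) (N * (psi s).1, N * (psi s).2) == comb p q s) sts -> weight psi.
Proof.
move=> N0 [k1 e1] [k2 e2] h; apply: (weightlike_div (n := N) (l := embed (p, q))) => //.
  move=> c; case: c; [exists k1|exists k2]; rewrite /= /emb corootD !corootZ coroot_root ?ha ?hb.
    by rewrite -e1; ring.
  by rewrite -e2; ring.
move=> K; rewrite (wd_emb ha hb) -embZ.
have /eqP <- := allP h _ (st_mem sts0 stsS K).
by rewrite (embD _ _ _ (p, q)) addrAC subrr add0r.
Qed.

(** At every state but [fin] some psi vanishes, and x_0 = 0; at [fin] the psi take as values the
    negatives of the roots along K0. *)
Lemma rank2_weights psis : weights psis ->
  all (fun s => (s == fin) || has (fun psi => psi s == (0, 0)) psis) sts ->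
  perm_eq [seq psi fin | psi <- psis] [seq pneg p | p <- gam st0 K0] -> rank2_conclusion.
Proof.
move=> hw h0 hp I J.
apply: (rank2_states HPi ij ha hb sts0 stsS finP (g := weight_prod psis) _ K0P stK0).
- move=> s ss /negPf sf; have := allP h0 _ ss; rewrite sf /= /weight_prod.
  elim: psis {hw h0 hp} => //= psi psis IH /orP[/eqP e|/IH e]; rewrite big_cons ?e ?mulr0 //.
  by rewrite emb0 fga_x0 mul0r.
- rewrite /weight_prod -(big_map (fun psi => psi fin) xpredT (fun p => X p)) (perm_big _ hp) big_map.
  by apply: eq_bigr => p _; rewrite embN.
by move=> m; apply: divisible_weight_prod.
Qed.

End Table.
End Weights.

Lemma rank2_A1A1 : coroot (Pi i) be = 0 -> coroot (Pi j) al = 0 -> rank2_conclusion.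
Proof.
move=> ha hb.
pose sts : seq state := [:: ((1, 0), (0, 1)); ((-1, 0), (0, 1)); ((1, 0), (0, -1)); ((-1, 0), (0, -1))].
(* These are (w alpha - alpha) / 2 and (w beta - beta) / 2; one of them is 0 unless w = w0. *)
pose psi1 (s : state) : int * int := if s.1 == (1, 0) then (0, 0) else (-1, 0).
pose psi2 (s : state) : int * int := if s.2 == (0, 1) then (0, 0) else (0, -1).
have sts0 : st0 \in sts by [].
have stsS : all (fun s => (step 0 0 s true \in sts) && (step 0 0 s false \in sts)) sts by [].
apply: (rank2_weights ha hb sts0 stsS (fin := ((-1, 0), (0, -1))) (K0 := [:: true; false]) _ _ _
  (psis := [:: psi1; psi2])) => //; split; last split=> //.
- apply: (weight_div ha hb sts0 stsS (N := 2) (p := 1) (q := 0)) => //; [by exists 1|by exists 0].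
- apply: (weight_div ha hb sts0 stsS (N := 2) (p := 0) (q := 1)) => //; [by exists 0|by exists 1].
Qed.

Lemma rank2_A2 : coroot (Pi i) be = -1 -> coroot (Pi j) al = -1 -> rank2_conclusion.
Proof.
move=> ha hb.
pose sts : seq state := [:: ((1, 0), (0, 1)); ((-1, 0), (1, 1)); ((1, 1), (0, -1)); ((0, 1), (-1, -1));
    ((-1, -1), (1, 0)); ((0, -1), (-1, 0))].
(* (2 alpha + beta) / 3 is the fundamental weight omega of alpha. The three factors below vanish
   where w omega = omega, w omega = omega - alpha and w (s_alpha omega) = omega. *)
pose psi (s : state) : int * int := (((comb 2 1 s).1 - 2) %/ 3, ((comb 2 1 s).2 - 1) %/ 3)%Z.
have sts0 : st0 \in sts by [].
have stsS : all (fun s => (step (-1) (-1) s true \in sts) && (step (-1) (-1) s false \in sts)) sts by [].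
have hpsi : weight (-1) (-1) psi.
  by apply: (weight_div ha hb sts0 stsS (N := 3) (p := 2) (q := 1)) => //; [exists 1|exists 0].
apply: (rank2_weights ha hb sts0 stsS (fin := ((0, -1), (-1, 0))) (K0 := [:: true; false; true]) _ _ _
  (psis := [:: psi; fun s => padd (psi s) (1, 0); fun s => padd (psi s) (comb (-1) 0 s)])) => //.
split=> //; split; [|split=> //]; apply: weight_add => //; first exact: weight_cst.
exact: weight_comb.
Qed.

Lemma rank2_B2 : coroot (Pi i) be = -2 -> coroot (Pi j) al = -1 -> rank2_conclusion.
Proof.
move=> ha hb.
pose sts : seq state := [:: ((1, 0), (0, 1)); ((-1, 0), (2, 1)); ((1, 1), (0, -1)); ((1, 1), (-2, -1));
    ((-1, -1), (2, 1)); ((-1, -1), (0, 1)); ((1, 0), (-2, -1)); ((-1, 0), (0, -1))].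
(* (2 alpha + beta) / 2 is the fundamental weight omega of alpha, with orbit omega, omega - alpha,
   omega - alpha - beta, - omega. Three factors exclude all but - omega, which leaves w0 and w0
   s_beta; the fourth vanishes where w (s_alpha omega) = omega - alpha, hence at w0 s_beta. *)
pose psi (s : state) : int * int := (((comb 2 1 s).1 - 2) %/ 2, ((comb 2 1 s).2 - 1) %/ 2)%Z.
have sts0 : st0 \in sts by [].
have stsS : all (fun s => (step (-2) (-1) s true \in sts) && (step (-2) (-1) s false \in sts)) sts by [].
have hpsi : weight (-2) (-1) psi.
  by apply: (weight_div ha hb sts0 stsS (N := 2) (p := 2) (q := 1)) => //; [exists 1|exists 0].
apply: (rank2_weights ha hb sts0 stsS (fin := ((-1, 0), (0, -1))) (K0 := [:: true; false; true; false]) _ _ _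
  (psis := [:: psi; fun s => padd (psi s) (1, 0); fun s => padd (psi s) (1, 1);
     fun s => padd (padd (psi s) (comb (-1) 0 s)) (1, 0)])) => //.
split=> //; do 2 (split; first by apply: weight_add => //; apply: weight_cst).
split=> //; apply: weight_add; last exact: weight_cst.
by apply: weight_add => //; apply: weight_comb.
Qed.

End RankTwoCases.

(** * The point class in type G2 *)

Section TypeG2.
Variables (R : comPzRingType) (F : fgl R) (D : root_datum).
Local Notation L := (lattice D).
Local Notation S := (fga F D).
Local Notation x := (fga_x F).
Variables (n : nat) (Pi : 'I_n -> rootset D).
Hypothesis HPi : simple_roots Pi.
Variables (i j : 'I_n).
Hypothesis ij : i != j.
Local Notation al := (fsval (Pi i)).
Local Notation be := (fsval (Pi j)).
Local Notation rho := (Pi \o letter i j).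
Local Notation embed := (emb Pi i j).
Local Notation X p := (x (embed p)).
Hypotheses (ha : coroot (Pi i) be = -3) (hb : coroot (Pi j) al = -1).
Local Notation st := (st (-3) (-1)).
Local Notation step := (step (-3) (-1)).
Implicit Types (s : state) (K : seq bool).

(* Write e1 = (2, 1), e2 = (-1, 0), e3 = (-1, -1) for the short roots with sum 0.
   schubert is the localization at the weights +-e1, +-e2, +-e3 of the plane spanned
   by the weights -e1, e2, e3 in the five-dimensional quadric G2 / P. *)
Definition schubert (p : int * int) : S :=
  if p == (-2, -1) then X (-2, -1) * X (-3, -1) * X (-3, -2)
  else if p == (-1, 0) then X (-2, -1) * X (-1, 0) * X (-3, -1)
  else if p == (-1, -1) then X (-2, -1) * X (-1, -1) * X (-3, -2)
  else 0.

Definition g2_states : seq state := [:: ((1, 0), (0, 1)); ((1, 1), (0, -1)); ((-2, -1), (3, 2)); ((1, 1),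
    (-3, -2)); ((-2, -1), (3, 1)); ((1, 0), (-3, -1)); ((-1, 0), (0, -1)); ((-1, -1), (0, 1)); ((2, 1),
    (-3, -2)); ((-1, -1), (3, 2)); ((2, 1), (-3, -1)); ((-1, 0), (3, 1))].

Lemma X0 : X (0, 0) = 0. Proof. by rewrite emb0 fga_x0. Qed.

Lemma kapX p : X (pneg p) * (X p * kap F (embed p) - 1) = X p.
Proof.
rewrite embN; have e := kapE F (embed p).
transitivity (x (embed p) * x (- embed p) * kap F (embed p) - x (- embed p)); first by ring.
by rewrite -e; ring.
Qed.

Definition tau : S := 2 + X (-2, -1) * fgF F (embed (-2, -1)) (embed (-2, -1)).

Lemma dbl : X (-4, -2) = X (-2, -1) * tau.
Proof.
have -> : embed (-4, -2) = embed (-2, -1) + embed (-2, -1) by rewrite -embD.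
by rewrite fga_xDF /tau; ring.
Qed.

(** As x_p kap_p - 1 is x_p / x_(-p) by [kapX], this is the equation x(l + p) / x_p + x(l - p) /
    x_(-p) = tau + x(l - p) x(l + p) U for l = - e1, cleared of denominators. By [dbl], tau is x(2
    l) / x(l). *)
Definition trace_rel (p : int * int) (U : S) :=
  X (padd (-2, -1) p) + (X p * kap F (embed p) - 1) * X (padd (-2, -1) (pneg p))
  = X p * (tau + X (padd (-2, -1) (pneg p)) * X (padd (-2, -1) p) * U).

Lemma trace_quotient_rel m : exists U : seq bool -> S, divisible rho m 0 U /\
  forall K, trace_rel (comb (-1) 0 (st K)) (U K).
Proof.
have hw := weightlike_comb ha hb (-1) 0.
have [U [hU e]] := trace_quotient F m (embed (-2, -1)) hw.
exists U; split=> // K; move: {e}(e K); move: (comb (-1) 0 (st K)) (U K) => p V e.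
rewrite /trace_rel !(embD _ _ _ (-2, -1)) embN /tau.
have k := kapX p; rewrite embN in k.
move: e k; set m0 := embed (-2, -1); set b := embed p => e k.
transitivity (x m0 * (x b * kap F b) + x b + x m0 * x b * fgF F m0 b
  + (x (- b) * (x b * kap F b - 1)) * (1 + x m0 * fgF F m0 (- b))).
  by rewrite !fga_xDF; ring.
rewrite k; transitivity (x b * (2 + x m0 * fgF F m0 m0
  + x m0 * (kap F b + fgF F m0 b + fgF F m0 (- b) - fgF F m0 m0))); first by ring.
by rewrite e; ring.
Qed.

(** With p = - w alpha, this computes x_p times the divided difference of [schubert] from w to w
    s_alpha, up to exchanging x_p and x_(-p). In the four states where both localizations are
    nonzero it is the trace relation combined with [dbl]; the others follow from x_0 = 0, from
    [kapX] or directly. *)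
Lemma schubert_diff s U : s \in g2_states -> trace_rel (comb (-1) 0 s) U ->
  schubert (comb 1 1 s) + (X (comb (-1) 0 s) * kap F (embed (comb (-1) 0 s)) - 1) * schubert (comb 2 1 s)
  = X (comb (-1) 0 s) * (X (padd (comb 2 1 s) (-2, -1)) * X (padd (comb 1 1 s) (-2, -1))
      + X (padd (comb (-1) 0 s) (-2, -1)) * U * schubert (comb 2 1 s)).
Proof.
have Le1 : schubert (2, 1) = 0 by [].
have LNe1 : schubert (-2, -1) = X (-2, -1) * X (-3, -1) * X (-3, -2) by [].
have Le2 : schubert (-1, 0) = X (-2, -1) * X (-1, 0) * X (-3, -1) by [].
have LNe2 : schubert (1, 0) = 0 by [].
have Le3 : schubert (-1, -1) = X (-2, -1) * X (-1, -1) * X (-3, -2) by [].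
have LNe3 : schubert (1, 1) = 0 by [].
rewrite !inE; do !case/predU1P => [->|]; last move/eqP->; move=> E1.
  - change (schubert (1, 1) + (X (-1, 0) * kap F (embed (-1, 0)) - 1) * schubert (2, 1) = X (-1, 0) * (X
      (0, 0) * X (-1, 0) + X (-3, -1) * U * schubert (2, 1))).
    by rewrite LNe3 Le1 X0; ring.
  - change (schubert (1, 0) + (X (-1, -1) * kap F (embed (-1, -1)) - 1) * schubert (2, 1) = X (-1, -1) *
      (X (0, 0) * X (-1, -1) + X (-3, -2) * U * schubert (2, 1))).
    by rewrite LNe2 Le1 X0; ring.
  - change (schubert (1, 1) + (X (2, 1) * kap F (embed (2, 1)) - 1) * schubert (-1, 0) = X (2, 1) * (X
      (-3, -1) * X (-1, 0) + X (0, 0) * U * schubert (-1, 0))).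
    rewrite LNe3 Le2 X0.
    have h : X (-2, -1) * (X (2, 1) * kap F (embed (2, 1)) - 1) = X (2, 1) by exact: (kapX (2, 1)).
    transitivity (X (-2, -1) * (X (2, 1) * kap F (embed (2, 1)) - 1) * (X (-1, 0) * X (-3, -1))); first by ring.
    by rewrite h; ring.
  - change (schubert (-2, -1) + (X (-1, -1) * kap F (embed (-1, -1)) - 1) * schubert (-1, 0) = X (-1, -1)
      * (X (-3, -1) * X (-4, -2) + X (-3, -2) * U * schubert (-1, 0))).
    rewrite LNe1 Le2 dbl.
    have h : X (-3, -2) + (X (-1, -1) * kap F (embed (-1, -1)) - 1) * X (-1, 0) = X (-1, -1) * (tau + X
        (-1, 0) * X (-3, -2) * U) by exact: E1.
    transitivity (X (-2, -1) * X (-3, -1) * (X (-3, -2) + (X (-1, -1) * kap F (embed (-1, -1)) - 1) * X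
        (-1, 0))); first by ring.
    by rewrite h; ring.
  - change (schubert (1, 0) + (X (2, 1) * kap F (embed (2, 1)) - 1) * schubert (-1, -1) = X (2, 1) * (X
      (-3, -2) * X (-1, -1) + X (0, 0) * U * schubert (-1, -1))).
    rewrite LNe2 Le3 X0.
    have h : X (-2, -1) * (X (2, 1) * kap F (embed (2, 1)) - 1) = X (2, 1) by exact: (kapX (2, 1)).
    transitivity (X (-2, -1) * (X (2, 1) * kap F (embed (2, 1)) - 1) * (X (-1, -1) * X (-3, -2))); first by ring.
    by rewrite h; ring.
  - change (schubert (-2, -1) + (X (-1, 0) * kap F (embed (-1, 0)) - 1) * schubert (-1, -1) = X (-1, 0) *
      (X (-3, -2) * X (-4, -2) + X (-3, -1) * U * schubert (-1, -1))).
    rewrite LNe1 Le3 dbl.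
    have h : X (-3, -1) + (X (-1, 0) * kap F (embed (-1, 0)) - 1) * X (-1, -1) = X (-1, 0) * (tau + X
        (-1, -1) * X (-3, -1) * U) by exact: E1.
    transitivity (X (-2, -1) * X (-3, -2) * (X (-3, -1) + (X (-1, 0) * kap F (embed (-1, 0)) - 1) * X
        (-1, -1))); first by ring.
    by rewrite h; ring.
  - change (schubert (-1, -1) + (X (1, 0) * kap F (embed (1, 0)) - 1) * schubert (-2, -1) = X (1, 0) * (X
      (-4, -2) * X (-3, -2) + X (-1, -1) * U * schubert (-2, -1))).
    rewrite Le3 LNe1 dbl.
    have h : X (-1, -1) + (X (1, 0) * kap F (embed (1, 0)) - 1) * X (-3, -1) = X (1, 0) * (tau + X (-3,
        -1) * X (-1, -1) * U) by exact: E1.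
    transitivity (X (-2, -1) * X (-3, -2) * (X (-1, -1) + (X (1, 0) * kap F (embed (1, 0)) - 1) * X (-3,
        -1))); first by ring.
    by rewrite h; ring.
  - change (schubert (-1, 0) + (X (1, 1) * kap F (embed (1, 1)) - 1) * schubert (-2, -1) = X (1, 1) * (X
      (-4, -2) * X (-3, -1) + X (-1, 0) * U * schubert (-2, -1))).
    rewrite Le2 LNe1 dbl.
    have h : X (-1, 0) + (X (1, 1) * kap F (embed (1, 1)) - 1) * X (-3, -2) = X (1, 1) * (tau + X (-3,
        -2) * X (-1, 0) * U) by exact: E1.
    transitivity (X (-2, -1) * X (-3, -1) * (X (-1, 0) + (X (1, 1) * kap F (embed (1, 1)) - 1) * X (-3,
        -2))); first by ring.
    by rewrite h; ring.
  - change (schubert (-1, -1) + (X (-2, -1) * kap F (embed (-2, -1)) - 1) * schubert (1, 0) = X (-2, -1)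
      * (X (-1, -1) * X (-3, -2) + X (-4, -2) * U * schubert (1, 0))).
    by rewrite Le3 LNe2; ring.
  - change (schubert (2, 1) + (X (1, 1) * kap F (embed (1, 1)) - 1) * schubert (1, 0) = X (1, 1) * (X
      (-1, -1) * X (0, 0) + X (-1, 0) * U * schubert (1, 0))).
    by rewrite Le1 LNe2 X0; ring.
  - change (schubert (-1, 0) + (X (-2, -1) * kap F (embed (-2, -1)) - 1) * schubert (1, 1) = X (-2, -1) *
      (X (-1, 0) * X (-3, -1) + X (-4, -2) * U * schubert (1, 1))).
    by rewrite Le2 LNe3; ring.
  - change (schubert (2, 1) + (X (1, 0) * kap F (embed (1, 0)) - 1) * schubert (1, 1) = X (1, 0) * (X
      (-1, 0) * X (0, 0) + X (-1, -1) * U * schubert (1, 1))).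
    by rewrite Le1 LNe3 X0; ring.
Qed.

(** Along beta the function is constant, since s_beta fixes e1. Along alpha the quotient is
    expressed by weights, [kap], the trace quotient and the function itself, so induction on m
    closes. *)
Lemma divisible_schubert m : divisible rho m 0 (fun K => schubert (comb 2 1 (st K))).
Proof.
have sts0 : st0 \in g2_states by [].
have stsS : all (fun s => (step s true \in g2_states) && (step s false \in g2_states)) g2_states by [].
elim: m => [|m IH]; first by split=> // K; apply: Sfil0.
split=> [K|c]; first exact: Sfil0.
have wc p q : weightlike rho (fun K => embed (comb p q (st K))) by apply: (weightlike_comb ha hb).
have wp p q r : weightlike rho (fun K => embed (padd (comb p q (st K)) r)).
  rewrite (_ : (fun K => _) = fun K => embed (comb p q (st K)) + embed r).
    by apply: weightlikeD => //; apply: weightlike_cst.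
  by apply/funext => K; rewrite -embD.
have one : divisible rho m 0 (1 : seq bool -> S) by apply: divisible_cst; apply: Sfil0.
have stE K : st (rcons K c) = step (st K) c by rewrite /st foldl_rcons.
case: c stE => stE; last first.
  exists 0; split; last exact: divisible0.
  move=> K; rewrite stE pw0 mulr0 (_ : comb 2 1 (step _ _) = comb 2 1 (st K)) ?subrr //.
  by case: (st K) => -[? ?] [? ?]; rewrite /step /comb /=; congr pair; ring.
have [U [hU eU]] := trace_quotient_rel m.
pose b K := embed (comb (-1) 0 (st K)).
have hb' : weightlike rho b by apply: wc.
have hkap : divisible rho m 0 (fun K => kap F (b K)).
  by apply/divisibleN/divisible_fgF => //; apply: weightlikeN.
pose A := xw F (fun K => embed (padd (comb 2 1 (st K)) (-2, -1))).
pose B := xw F (fun K => embed (padd (comb 1 1 (st K)) (-2, -1))).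
pose C := xw F (fun K => embed (padd (comb (-1) 0 (st K)) (-2, -1))).
pose k K := kap F (b K).
(* The edge root is w alpha = - b, while [schubert_diff] divides by x_b. The factor 1 - k x_b is -
   x_b / x_(-b), and the summand - k corrects the coefficient of the function at w. *)
exists ((1 - k * xw F b) * (A * B + (C * U - k) * (fun K => schubert (comb 2 1 (st K))))); split; last first.
  have [hA hB hC hx] := And4 (divisible_xw0 F m (wp 2 1 (-2, -1))) (divisible_xw0 F m (wp 1 1 (-2, -1)))
    (divisible_xw0 F m (wp (-1) 0 (-2, -1))) (divisible_xw0 F m hb').
  apply: divisibleM.
    by apply: divisibleD one _; apply: divisibleN; apply: divisibleM.
  apply: divisibleD; first exact: divisibleM.
  by apply: divisibleM => //; apply: divisibleD; [apply: divisibleM|apply: divisibleN].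
move=> K; have sd := schubert_diff (st_mem sts0 stsS K) (eU K).
have e1 : comb 2 1 (st (rcons K true)) = comb 1 1 (st K).
  by rewrite stE; case: (st K) => -[? ?] [? ?]; rewrite /step /comb /=; congr pair; ring.
have e2 : wroot rho K true = - b K.
  have [e _] := st_wd ha hb K; rewrite /b emb_comb scale0r addr0 scaleN1r opprK e; reflexivity.
rewrite e1 e2 !pwE /xw /A /B /C /xw -/(b K) in sd *.
move: sd; set X1 := x _; set L1 := schubert _; set L2 := schubert _; set k1 := k K.
set A1 := x (embed (padd (comb 2 1 _) _)); set B1 := x (embed (padd (comb 1 1 _) _)).
set C1 := x (embed (padd (comb (-1) 0 _) _)) => sd.
have kE : x (- b K) * (1 - k1 * X1) = - X1 by apply: kap_opp.
rewrite mulrA kE; transitivity (- (X1 * (A1 * B1 + C1 * U K * L2)) + X1 * k1 * L2); last by ring.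
by rewrite -sd /k1 /k; ring.
Qed.

Lemma rank2_G2 : rank2_conclusion F Pi i j.
Proof.
have sts0 : st0 \in g2_states by [].
have stsS : all (fun s => (step s true \in g2_states) && (step s false \in g2_states)) g2_states by [].
pose fin : state := ((-1, 0), (0, -1)).
pose K0 := [:: true; false; true; false; true; false].
(* [schubert] vanishes unless w e1 is - e1, e2 or e3, and the next two factors exclude e2 and e3. Of
   the remaining w0 and w0 s_beta, the last factor excludes w0 s_beta, which takes alpha to - alpha
   - beta. *)
pose g (s : state) := schubert (comb 2 1 s) * X (padd (comb 2 1 s) (1, 0)) *
  X (padd (comb 2 1 s) (1, 1)) * X (padd (comb (-1) 0 s) (-1, -1)).
have finP : all (fun s => (s == fin) == (nonpos s.1 && nonpos s.2)) g2_states by [].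
have K0P : all nonneg (gam (-3) (-1) st0 K0) by [].
have stK0 : st K0 = fin by [].
have gz s : [\/ schubert (comb 2 1 s) = 0, padd (comb 2 1 s) (1, 0) = (0, 0),
    padd (comb 2 1 s) (1, 1) = (0, 0) | padd (comb (-1) 0 s) (-1, -1) = (0, 0)] -> g s = 0.
  by rewrite /g => -[] ->; rewrite ?X0 ?(mul0r, mulr0).
move=> I J; apply: (rank2_states HPi ij ha hb sts0 stsS finP (g := g) _ K0P stK0).
- move=> s; rewrite !inE; do !case/predU1P => [->|]; last move/eqP->; move=> ne;
    first [by case/eqP: ne | by apply/gz/Or41 | by apply/gz/Or42
    | by apply/gz/Or43 | by apply/gz/Or44].
- rewrite [g fin]/g /negprod /= !big_cons big_nil /= -!embN.
  change (X (-2, -1) * X (-3, -1) * X (-3, -2) * X (-1, -1) * X (-1, 0) * X (0, -1) =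
    X (-1, 0) * (X (-3, -1) * (X (-2, -1) * (X (-3, -2) * (X (-1, -1) * (X (0, -1) * 1)))))).
  by ring.
move=> m; have wp p q r : weightlike rho (fun K => embed (padd (comb p q (st K)) r)).
  apply: weight_add; [exact: (weight_comb ha hb)|exact: weight_cst].
by do 3 (apply: divisibleM; last exact: (divisible_xw0 F m (wp _ _ _))); apply: divisible_schubert.
Qed.

End TypeG2.

(** * Push-pull operators *)

Section PushPull.
Variables (R : comPzRingType) (F : fgl R) (D : root_datum).
Hypothesis reg : forall a : rootset D, GRing.lreg (fga_x F (fsval a)).
Local Notation L := (lattice D).
Local Notation W := (weyl D).
Local Notation S := (fga F D).
Local Notation Q := (fgaQ F D).
Local Notation QW := (QW F D).
Local Notation x := (fga_x F).
Local Notation wr := weyl_on_roots.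
Local Notation toQ := (@toQ R F D).
Local Notation delta := (@delta R F D).
Variables (n : nat) (Pi : 'I_n -> rootset D).
Hypothesis HPi : simple_roots Pi.
Local Notation s_ i := (weyl_refl (Pi i)).
Local Notation wd := (wprod Pi).
Local Notation X_ := (demazure F Pi).
Local Notation XK := (XK F Pi).
Local Notation w0 := (w0 Pi).
Local Notation par := (parabolic Pi).
Local Notation neg := (neg_roots_of Pi).
Local Notation lead := (lead F Pi).
Local Notation rV := (rootV F).
Implicit Types (K J : seq 'I_n) (Xi : {set 'I_n}) (w u v : W) (T : {set W}) (f g h : {scalar QW}).

Lemma rank2 i j I J : i != j -> let Xi := [set i; j]%SET in
  all (mem Xi) I -> all (mem Xi) J -> reduced Pi I -> reduced Pi J ->
  wd I = w0 Xi -> wd J = w0 Xi -> Xspan (F := F) Pi (words_lt Xi (size I)) (XK I - XK J).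
Proof.
move=> ij /=; have [k [l [kl <- h]]] := cartan_cases HPi ij; move: I J.
by case: h => -[ha hb];
  [apply: rank2_A1A1|apply: rank2_A2|apply: rank2_B2|apply: rank2_G2].
Qed.

Definition relV Xi' Xi : Q := \prod_(b in neg Xi :\: neg Xi') rV b.

Lemma push_pullE Xi' Xi T :
  push_pull_elt F Pi Xi' Xi T = \sum_(w in T) weylQ w (relV Xi' Xi) *: delta w.
Proof.
rewrite /push_pull_elt mulr_suml frac1E big_enum; apply: eq_bigr => w _.
by rewrite deltaZ deltaM mulg1.
Qed.

Lemma push_pull_coef Xi' Xi T u :
  push_pull_elt F Pi Xi' Xi T u = if u \in T then weylQ u (relV Xi' Xi) else 0.
Proof.
rewrite push_pullE qw_sum; pose c w := weylQ w (relV Xi' Xi).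
transitivity (\sum_(w in T | w == u) c w).
  rewrite big_mkcondr; apply: eq_bigr => w _.
  by rewrite qw_deltaE eq_sym.
case: ifP => uT.
  rewrite (big_pred1 u) // => w /=; by case: eqP => [->|]; rewrite ?uT ?andbF.
by apply: big_pred0 => w; case: eqP => [->|]; rewrite ?uT ?andbF.
Qed.

Lemma push_pull_delta Xi' Xi T f v :
  push_pull F Pi Xi' Xi T f (delta v) = \sum_(w in T) weylQ (v * w)%g (relV Xi' Xi) * f (delta (v * w)%g).
Proof.
rewrite /push_pull /= /qw_act_fun push_pullE mulr_sumr linear_sum; apply: eq_bigr => w _.
by rewrite deltaZ deltaM linearZ weylQM.
Qed.

Lemma mem_neg Xi b : (b \in neg Xi) = ~~ pos Pi b && (weyl_refl b \in par Xi).
Proof. by rewrite inE /pos negbK. Qed.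

Lemma neg_set0 : neg finset.set0 = finset.set0.
Proof.
apply/setP => b; rewrite mem_neg [RHS]inE; apply/negP => /andP[_].
rewrite /parabolic imset0 gen0 => /finset.set1P e.
have := weyl_refl_self b; rewrite e weyl1E => /eqP; rewrite -addr_eq0 -mulr2n -scaler_nat => /eqP h.
by have := lattice_torsion_free (isT : (2 : int) != 0) h; apply/eqP/root_neq0.
Qed.

Lemma relV0 Xi : relV finset.set0 Xi = \prod_(b in neg Xi) rV b.
Proof. by rewrite /relV neg_set0 finset.setD0. Qed.

Lemma parS Xi' Xi : Xi' \subset Xi -> par Xi' \subset par Xi.
Proof. by move=> h; apply/genS/imsetS. Qed.

Lemma neg_sub Xi' Xi : Xi' \subset Xi -> neg Xi' \subset neg Xi.
Proof.
move=> /parS/fintype.subsetP h; apply/fintype.subsetP => b; rewrite !mem_neg.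
by move=> /andP[-> /h].
Qed.

Lemma relV_chain Xi' Xi : Xi' \subset Xi ->
  relV Xi' Xi * relV finset.set0 Xi' = relV finset.set0 Xi.
Proof.
move=> h; rewrite !relV0 [RHS](big_setID (neg Xi')) /= mulrC.
by rewrite (finset.setIidPr (neg_sub h)).
Qed.

Lemma weylQ_prod w (A : {set rootset D}) :
  (forall b, b \in A -> wr w b \in A) ->
  weylQ w (\prod_(b in A) rV b) = \prod_(b in A) rV b.
Proof.
move=> wA; transitivity (\prod_(b in A) rV (wr w b)).
  by rewrite rmorph_prod; apply: eq_bigr => b _; apply: weylQ_rootV.
have inj : injective (wr w) := can_inj (weyl_on_rootsK w).
have e : [set wr w b | b in A]%SET = A.
  apply/eqP; rewrite eqEcard card_imset // leqnn andbT.
  by apply/fintype.subsetP => _ /imsetP[b /wA bA ->].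
by rewrite -[in RHS]e big_imset //= => b c _ _; apply: inj.
Qed.

(** W_Xi' permutes the negative roots of Xi outside Xi': if such a root became positive under a word
    in Xi', [refl_word] would place its reflection in W_Xi'. *)
Lemma relV_invariant Xi' Xi w : Xi' \subset Xi -> w \in par Xi' ->
  weylQ w (relV Xi' Xi) = relV Xi' Xi.
Proof.
move=> h wXi; apply: weylQ_prod => b; rewrite !finset.in_setD !mem_neg.
have wXi1 : w \in par Xi by apply: (fintype.subsetP (parS h)).
rewrite weyl_refl_conj; set r := weyl_refl b; have memw Ys : w \in par Ys -> (w * r * w^-1 \in par Ys)%g
    = (r \in par Ys).
  by move=> wY; rewrite groupMr ?groupV // groupMl.
rewrite !memw // => /and3P[h1 nb rXi]; rewrite nb in h1.
suff nwb : ~~ pos Pi (wr w b) by rewrite nwb rXi h1.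
apply/negP => pb; case/negP: h1.
have /parabolicP[K KXi wK] := wXi.
rewrite /r -weyl_refl_neg; apply: (refl_word HPi KXi (b := rneg b)); first by rewrite pos_neg.
by rewrite -wK weyl_on_roots_neg pos_neg // pb.
Qed.

(** By [relV_invariant] and [relV_chain] the terms of t and w multiply to the term of t w, and every
    u in W_Xi is t w for exactly one t in T. *)
Lemma push_pull_comp Xi' Xi T : Xi' \subset Xi -> left_coset_reps Pi Xi' Xi T ->
  push_pull_elt F Pi Xi' Xi T * push_pull_elt F Pi finset.set0 Xi' (par Xi')
  = push_pull_elt F Pi finset.set0 Xi (par Xi).
Proof.
move=> XX hT; rewrite !push_pullE mulr_suml.
pose G u := weylQ u (relV finset.set0 Xi) *: delta u.
have TXi : T \subset par Xi by case/and3P: hT.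
have e t : t \in T -> (weylQ t (relV Xi' Xi) *: delta t) *
    (\sum_(w in par Xi') weylQ w (relV finset.set0 Xi') *: delta w)
    = \sum_(u in par Xi | t \in (u *: par Xi')%g) G u.
  move=> tT; rewrite mulr_sumr (reindex_inj (mulgI t^-1%g)) /=.
  have tXi := fintype.subsetP TXi _ tT; apply: congr_big => [//|u|u uXi].
    rewrite mem_lcoset -groupV invMg invgK; apply/idP/andP => [h|[_ ->] //]; split=> //.
    rewrite -[u]invgK -(mulgK t u^-1%g) groupV groupM ?groupV //.
    exact: (fintype.subsetP (parS XX)).
  rewrite -qw_scaleAl deltaZ deltaM mulKVg scalerA -weylQM mulKVg /G.
  rewrite -(relV_chain XX) weylQ_mul; congr ((_ * _) *: _).
  have := relV_invariant XX uXi; rewrite weylQM => e.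
  by rewrite -{1}e -weylQM mulgV weylQ1.
rewrite (eq_bigr _ e) (exchange_big_dep (mem (par Xi))) //=; last by move=> ? ? _ /andP[].
apply: eq_bigr => u uXi; rewrite -/(G u).
have /andP[_ /andP[_ /forall_inP h]] := hT.
have /cards1P[t e'] : #|T :&: (u *: par Xi')%g| == 1%N by apply/h/lcosetsP; exists u.
rewrite (eq_bigl (mem [set t]%SET)) => [|t']; last by rewrite -e' uXi !inE.
exact: big_set1.
Qed.

Lemma push_pull_abs_comp Xi' Xi T f : Xi' \subset Xi -> left_coset_reps Pi Xi' Xi T ->
  push_pull F Pi Xi' Xi T (push_pull_abs F Pi Xi' f) = push_pull_abs F Pi Xi f.
Proof.
move=> XX hT; rewrite [RHS]/push_pull_abs /push_pull -(push_pull_comp XX hT).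
exact: qw_act_comp.
Qed.

End PushPull.

Lemma mul0_assoc (A : pzRingType) (y z t : A) : y * z = 0 -> y * (z * t) = 0.
Proof. by rewrite mulrA => ->; apply: mul0r. Qed.

Section PushPullDF.
Variables (R : comPzRingType) (F : fgl R) (D : root_datum).
Hypothesis reg : forall a : rootset D, GRing.lreg (fga_x F (fsval a)).
Local Notation L := (lattice D).
Local Notation W := (weyl D).
Local Notation S := (fga F D).
Local Notation Q := (fgaQ F D).
Local Notation QW := (QW F D).
Local Notation x := (fga_x F).
Local Notation wr := weyl_on_roots.
Local Notation toQ := (@toQ R F D).
Local Notation delta := (@delta R F D).
Variables (n : nat) (Pi : 'I_n -> rootset D).
Hypothesis HPi : simple_roots Pi.
Local Notation s_ i := (weyl_refl (Pi i)).
Local Notation wd := (wprod Pi).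
Local Notation X_ := (demazure F Pi).
Local Notation XK := (XK F Pi).
Local Notation w0 := (w0 Pi).
Local Notation par := (parabolic Pi).
Local Notation neg := (neg_roots_of Pi).
Local Notation lead := (lead F Pi).
Local Notation rV := (rootV F).
Implicit Types (K J : seq 'I_n) (Xi : {set 'I_n}) (w u v : W) (T : {set W}) (f g h : {scalar QW}).

Local Notation relV := (relV F Pi).
Local Notation pt_coef := (pt_coef F Pi).
Local Notation Y Xi := (push_pull_elt F Pi finset.set0 Xi (par Xi)).

(** s_i permutes the negative roots of Xi other than - alpha_i, which it takes to alpha_i. *)
Lemma relV_refl Xi i : i \in Xi ->
  weylQ (s_ i) (relV finset.set0 Xi) * rV (rneg (Pi i)) = relV finset.set0 Xi * rV (Pi i).
Proof.
move=> iXi; have hi : rneg (Pi i) \in neg Xi.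
  by rewrite mem_neg pos_neg // pos_simple // weyl_refl_neg parabolic_s.
rewrite relV0 (big_setD1 _ hi) /=; set A := neg Xi :\ _.
have hA b : b \in A -> wr (s_ i) b \in A.
  rewrite !finset.in_setD1 !mem_neg => /and3P[bi nb rb].
  rewrite weyl_refl_conj weyl_reflV !groupM ?parabolic_s // andbT.
  have bi' : rneg b != Pi i by apply: contra bi => /eqP <-; rewrite rnegK.
  have p : pos Pi (wr (s_ i) (rneg b)) by apply: pos_refl => //; rewrite pos_neg.
  rewrite weyl_on_roots_neg pos_neg // in p; rewrite p andbT.
  apply: contraNneq nb => e; rewrite -(wr_refl_sq Pi i b) e weyl_on_roots_neg -/(rneg _).
  by rewrite rnegK pos_simple.
rewrite weylQ_mul weylQ_rootV (weylQ_prod F hA) weyl_on_roots_neg -/(rneg _) rnegK.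
by rewrite [LHS]mulrAC [RHS]mulrAC; congr (_ * _); apply: mulrC.
Qed.

(** The coefficient relV / x_(alpha_i) is fixed by s_i, so the two halves of X_i give sums that
    agree after w -> w s_i. *)
Lemma push_pull_demazure Xi i : i \in Xi -> Y Xi * X_ i = 0.
Proof.
move=> iXi; pose c := relV finset.set0 Xi * rV (Pi i).
have e w : (weylQ w (relV finset.set0 Xi) *: delta w) * X_ i
    = weylQ w c *: delta w - weylQ w c *: delta (w * s_ i)%g.
  rewrite -qw_scaleAl -[X_ i]/(rV (Pi i) *: (1 - delta (s_ i))) deltaZ scalerA -weylQ_mul.
  by rewrite mulrBr mulr1 deltaM scalerBr.
rewrite push_pullE mulr_suml (eq_bigr _ (fun w _ => e w)) sumrB.
apply/eqP; rewrite subr_eq0; apply/eqP.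
rewrite [RHS](reindex_inj (mulIg (s_ i))) /=; apply: eq_big => [w|w wXi].
  by rewrite groupMr // parabolic_s.
rewrite -mulgA weyl_refl_sq mulg1; congr (_ *: _).
rewrite weylQM; congr weylQ; rewrite /c weylQ_mul weylQ_rootV -/(rneg _).
by rewrite relV_refl.
Qed.

(** w0 carries the negative roots of Xi onto the positive ones, which are its inversions, and the
    factors cancel in pairs. *)
Lemma pt_coef_relV Xi : pt_coef Xi * weylQ (w0 Xi) (relV finset.set0 Xi) = 1.
Proof.
have -> : weylQ (w0 Xi) (relV finset.set0 Xi) = \prod_(b in inv Pi (w0 Xi)) rV b.
  have -> : weylQ (w0 Xi) (relV finset.set0 Xi) = \prod_(b in neg Xi) rV (wr (w0 Xi) b).
    by rewrite relV0 rmorph_prod; apply: eq_bigr => b _; apply: weylQ_rootV.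
  have conj_w0 b : (weyl_refl (wr (w0 Xi) b) \in par Xi) = (weyl_refl b \in par Xi).
    by rewrite weyl_refl_conj groupMr ?groupV ?groupMl ?w0_mem.
  have -> : inv Pi (w0 Xi) = [set wr (w0 Xi) b | b in neg Xi]%SET.
    apply/setP => b; rewrite inv_w0 // inE; apply/idP/imsetP => [|[c]].
      move=> /andP[pb rb]; exists (wr (w0 Xi) b); last by rewrite -weyl_on_rootsM w0_sq // weyl_on_roots1.
      rewrite mem_neg w0_neg_supp ?conj_w0 //.
        exact/(refl_parabolic HPi).
    rewrite mem_neg => /andP[nc rc] ->; rewrite conj_w0 rc andbT.
    rewrite -[c]rnegK weyl_on_roots_neg pos_neg // w0_neg_supp ?pos_neg //.
    by apply/(refl_parabolic HPi); rewrite weyl_refl_neg.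
  by rewrite big_imset //= => b c _ _; apply: (can_inj (weyl_on_rootsK _)).
rewrite /pt_coef -big_split big1 // => b _; exact: rootVP.
Qed.

Lemma DF_push_pull Xi : DF F Pi (Y Xi).
Proof.
have [v vXi|J|l] := span_intQ HPi (rank2 F HPi) (Xi := Xi) (z := Y Xi).
- by rewrite push_pull_coef (negPf vXi).
- case: J => [|i J] /=.
    move=> _; rewrite XK_nil mulr1 push_pull_coef w0_mem pt_coef_relV.
    by exists 1; rewrite toQ1.
  move=> /andP[iXi _].
  have -> : Y Xi * XK (i :: J) = 0.
    rewrite XK_cons; exact: mul0_assoc (push_pull_demazure iXi).
  rewrite qw_zero mulr0.
  exact: intQ0.
exact: Xspan_DF.
Qed.

End PushPullDF.

(** * The dual of D_F as a ring of functions *)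

Section Dual.
Variables (R : comPzRingType) (F : fgl R) (D : root_datum).
Hypothesis reg : forall a : rootset D, GRing.lreg (fga_x F (fsval a)).
Local Notation L := (lattice D).
Local Notation W := (weyl D).
Local Notation S := (fga F D).
Local Notation Q := (fgaQ F D).
Local Notation QW := (QW F D).
Local Notation x := (fga_x F).
Local Notation wr := weyl_on_roots.
Local Notation toQ := (@toQ R F D).
Local Notation delta := (@delta R F D).
Variables (n : nat) (Pi : 'I_n -> rootset D).
Hypothesis HPi : simple_roots Pi.
Local Notation s_ i := (weyl_refl (Pi i)).
Local Notation wd := (wprod Pi).
Local Notation X_ := (demazure F Pi).
Local Notation XK := (XK F Pi).
Local Notation w0 := (w0 Pi).
Local Notation par := (parabolic Pi).
Local Notation neg := (neg_roots_of Pi).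
Local Notation lead := (lead F Pi).
Local Notation rV := (rootV F).
Implicit Types (K J : seq 'I_n) (Xi : {set 'I_n}) (w u v : W) (T : {set W}) (f g h : {scalar QW}).

Local Notation relV := (relV F Pi).
Local Notation pt_coef := (pt_coef F Pi).
Local Notation Y Xi := (push_pull_elt F Pi finset.set0 Xi (par Xi)).

Lemma DF_delta w : DF F Pi (delta w).
Proof.
have /parabolicP[K _ ->] : w \in par finset.setT by rewrite parabolicT.
elim: K => [|i K IH]; first by rewrite wd_nil -[delta 1%g]scale1r -(toQ1 F D); apply: DF_S.
rewrite wd_cons -deltaM; apply: DF_mul IH.
have -> : delta (s_ i) = toQ 1 *: delta 1%g + toQ (- x (fsval (Pi i))) *: X_ i.
  rewrite -[X_ i]/(rV (Pi i) *: (1 - delta (s_ i))) scalerA toQN mulNr rootVP scaleN1r.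
  rewrite toQ1 scale1r opprB addrC; apply/esym/subrK.
apply: DF_add; first exact: DF_S.
rewrite -[X_ i]mul1r qw_scaleAl; apply: DF_mul; [exact: DF_S|exact: DF_X].
Qed.

Lemma dual_act y f : DF F Pi y -> DF_dual F Pi f -> DF_dual F Pi (qw_act y f).
Proof. by move=> hy hf z hz; apply: hf; apply: DF_mul. Qed.

Lemma dual_delta f w : DF_dual F Pi f -> intQ (f (delta w)).
Proof. by move=> hf; apply/intQ_range/hf/DF_delta. Qed.

Lemma dual_word f : DF_dual F Pi f -> exists p : seq 'I_n -> S, forall K, f (delta (wd K)) = toQ (p K).
Proof.
move=> hf; have /choice[p hp] : forall K, exists s, f (delta (wd K)) = toQ s.
  by move=> K; apply: dual_delta.
by exists p.
Qed.

Lemma dual_divisible f (p : seq 'I_n -> S) m : DF_dual F Pi f ->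
  (forall K, f (delta (wd K)) = toQ (p K)) -> divisible Pi m 0 p.
Proof.
elim: m f p => [|m IH] f p hf hp; first by split=> // K; apply: Sfil0.
split=> [K|c]; first exact: Sfil0.
have hg := dual_act (@DF_X _ _ _ _ Pi c) hf.
have [q hq] := dual_word hg; exists q; split; last exact: IH hg hq.
move=> K; apply: (toQ_inj reg); rewrite toQB toQM -hq -!hp.
rewrite /= /qw_act_fun -[X_ c]/(rV (Pi c) *: (1 - delta (s_ c))) deltaZ weylQ_rootV linearZ.
rewrite mulrA -[wroot _ _ _]/(fsval (wr (wd K) (Pi c))) rootVP mul1r mulrBr mulr1 linearB deltaM.
by rewrite wd_rcons.
Qed.

Lemma divisible_dual f (p : seq 'I_n -> S) : (forall K, f (delta (wd K)) = toQ (p K)) ->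
  (forall m, divisible Pi m 0 p) -> DF_dual F Pi f.
Proof.
move=> hp hd z /DF_Xspan[l hz]; apply/intQ_range.
move: z hz; apply: Xspan_ind => [|y z hy hz|s K _].
- by rewrite linear0; apply: intQ0.
- by rewrite linearD; apply: intQD.
rewrite linearZ; apply: intQM; first exact: intQ_toQ.
have := @divisible_intQ R F D n Pi 'I_n id f p K hp (hd _).
by rewrite map_id.
Qed.

Definition dual_mul f g : {scalar QW} := of_fun (fun w => f (delta w) * g (delta w)).

Lemma dual_mulE f g w : dual_mul f g (delta w) = f (delta w) * g (delta w).
Proof. exact: of_fun_delta. Qed.

Lemma DF_dual_mul f g : DF_dual F Pi f -> DF_dual F Pi g -> DF_dual F Pi (dual_mul f g).
Proof.
move=> hf hg; have [[p hp] [q hq]] := (dual_word hf, dual_word hg).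
apply: (@divisible_dual _ (p * q)) => [K|m]; first by rewrite dual_mulE hp hq -toQM.
by apply: divisibleM; [apply: dual_divisible hf hp|apply: dual_divisible hg hq].
Qed.

Lemma DF_dual_inverse f g : DF_dual F Pi f -> (forall w, intQ (g (delta w))) ->
  (forall w, f (delta w) * g (delta w) = 1) -> DF_dual F Pi g.
Proof.
move=> hf hg e; have [p hp] := dual_word hf.
have /choice[q hq] : forall K, exists s, g (delta (wd K)) = toQ s by move=> K; apply: hg.
apply: (@divisible_dual _ q) => // m; apply: divisible_inv (dual_divisible m hf hp) _ => K.
by apply: (toQ_inj reg); rewrite toQM -hp -hq e toQ1.
Qed.

(* Modulo Sfil 1, the value of f at delta w does not depend on w. *)
Lemma dual_unit f (k : nat) : DF_dual F Pi f -> f (delta 1%g) = (-1) ^+ k ->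
  exists g, DF_dual F Pi g /\ forall w, f (delta w) * g (delta w) = 1.
Proof.
move=> hf f1; have [p hp] := dual_word hf; have H := @Sfil_cfilt R F D.
have hpK K : Sfil 1 (p K - (-1) ^+ k).
  elim/last_ind: K => [|K c IH].
    have -> : p [::] = (-1) ^+ k.
      by apply: (toQ_inj reg); rewrite -hp wd_nil f1 rmorphXn rmorphN rmorph1.
    by rewrite subrr; apply: (fl0 H).
  have [_ /(_ c)[q [e _]]] := dual_divisible 1 hf hp.
  have -> : p (rcons K c) - (-1) ^+ k = (p K - (-1) ^+ k) - x (wroot Pi K c) * q K.
    by rewrite -e; ring.
  by apply: (flB H) IH _; apply: (flMr H); [apply: fga_x_fil|apply: Sfil0].
have hu w : exists s, f (delta w) * toQ s = 1.
  have /parabolicP[K _ ->] : w \in par finset.setT by rewrite parabolicT.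
  have sg : (-1 : S) ^+ k * (-1) ^+ k = 1 by rewrite -exprMn mulrNN mulr1 expr1n.
  have [b _ hb] := fl_unit H (flMr H (flN H (hpK K)) (Sfil0 ((-1) ^+ k))).
  exists ((-1) ^+ k * b); rewrite hp -toQM -(toQ1 F D); congr (toQ _).
  move: sg hb; set e := (-1) ^+ k; move=> sg hb.
  transitivity ((1 - - (p K - e) * e) * b + (e * e - 1) * b); first by ring.
  by rewrite hb sg subrr mul0r addr0.
have /choice[u hu'] := hu; exists (of_fun (toQ \o u)).
have e w : (of_fun (toQ \o u) : {scalar QW}) (delta w) = toQ (u w) by apply: of_fun_delta.
have eu w : f (delta w) * (of_fun (toQ \o u) : {scalar QW}) (delta w) = 1 by rewrite e.
split=> //; apply: (DF_dual_inverse hf) eu => w.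
by rewrite e; apply: intQ_toQ.
Qed.

End Dual.

(** The hypotheses force b = d e. In the application c is the point coefficient of Xi, b = w0(relV),
    d the leading coefficient of a reduced word of w0, and e a sign. *)
Lemma cancel_involution (A : comPzRingType) (a b c d k e : A) :
  c * b = 1 -> c * d = e -> e * e = 1 -> k * (b * a) = k * (d * a) * e.
Proof.
move=> h <- sg; transitivity (k * (b * ((c * d) * (c * d))) * a).
  by rewrite sg mulr1 mulrA.
transitivity (k * (c * b * d * (c * d)) * a); first by ring.
by rewrite h mul1r; ring.
Qed.

(** * Images of the push-pull operators *)

Section Surjectivity.
Variables (R : comPzRingType) (F : fgl R) (D : root_datum).
Hypothesis reg : forall a : rootset D, GRing.lreg (fga_x F (fsval a)).
Local Notation L := (lattice D).
Local Notation W := (weyl D).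
Local Notation S := (fga F D).
Local Notation Q := (fgaQ F D).
Local Notation QW := (QW F D).
Local Notation x := (fga_x F).
Local Notation wr := weyl_on_roots.
Local Notation toQ := (@toQ R F D).
Local Notation delta := (@delta R F D).
Variables (n : nat) (Pi : 'I_n -> rootset D).
Hypothesis HPi : simple_roots Pi.
Local Notation s_ i := (weyl_refl (Pi i)).
Local Notation wd := (wprod Pi).
Local Notation X_ := (demazure F Pi).
Local Notation XK := (XK F Pi).
Local Notation w0 := (w0 Pi).
Local Notation par := (parabolic Pi).
Local Notation neg := (neg_roots_of Pi).
Local Notation lead := (lead F Pi).
Local Notation rV := (rootV F).
Implicit Types (K J : seq 'I_n) (Xi : {set 'I_n}) (w u v : W) (T : {set W}) (f g h : {scalar QW}).

Local Notation relV := (relV F Pi).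
Local Notation pt_coef := (pt_coef F Pi).
Local Notation Y Xi := (push_pull_elt F Pi finset.set0 Xi (par Xi)).

Local Notation A Xi := (push_pull_abs F Pi Xi).

Lemma push_pull_abs_delta Xi f v :
  A Xi f (delta v) = \sum_(w in par Xi) weylQ (v * w)%g (relV finset.set0 Xi) * f (delta (v * w)%g).
Proof. exact: push_pull_delta. Qed.

Lemma dual_invP Xi f : DF_dual_inv F Pi Xi f <->
  DF_dual F Pi f /\ forall v w, w \in par Xi -> f (delta (v * w)%g) = f (delta v).
Proof.
split=> -[hf hi]; split=> //.
  by move=> v w /hi e; rewrite -deltaM -[in RHS]e.
by move=> w wXi; apply: scalar_delta_ext => v; rewrite /= /qw_act_fun deltaM hi.
Qed.

Lemma push_pull_abs_dual Xi f : DF_dual F Pi f -> DF_dual_inv F Pi Xi (A Xi f).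
Proof.
move=> hf; apply/dual_invP; split; first exact: dual_act (DF_push_pull F HPi Xi) hf.
move=> v w wXi; rewrite !push_pull_abs_delta [RHS](reindex_inj (mulgI w)) /=.
by apply: eq_big => [u|u _]; rewrite ?groupMl // mulgA.
Qed.

(** Projection formula: h is constant on the coset v W_Xi over which the sum runs. *)
Lemma push_pull_abs_mul Xi f h v : (forall v w, w \in par Xi -> h (delta (v * w)%g) = h (delta v)) ->
  A Xi (dual_mul f h) (delta v) = A Xi f (delta v) * h (delta v).
Proof.
move=> hh; rewrite !push_pull_abs_delta mulr_suml; apply: eq_bigr => w wXi.
by rewrite dual_mulE hh // mulrA.
Qed.

(* f is the action of X_I, for a reduced word I of w0(Xi)^-1 w0, on the class p of a
   point, which is supported at w0. *)
Lemma push_pull_abs_sign Xi : exists f k, DF_dual F Pi f /\ A Xi f (delta 1%g) = (-1) ^+ k.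
Proof.
pose p : {scalar QW} := of_fun (fun w => if w == w0 finset.setT then pt_coef finset.setT else 0).
have pE z : p z = pt_coef finset.setT * z (w0 finset.setT).
  rewrite /= /of_fun (bigD1 (w0 finset.setT)) //= eqxx mulrC [X in _ + X]big1; first exact: addr0.
  by move=> w /negPf ->; apply: mulr0.
have hp : DF_dual F Pi p.
  move=> z /DF_Xspan[l hz]; apply/intQ_range; move: z hz; apply: Xspan_ind => [|y z hy hz|s K /andP[KT _]].
  - by rewrite linear0; apply: intQ0.
  - by rewrite linearD; apply: intQD.
  rewrite linearZ; apply: intQM; first exact: intQ_toQ.
  by rewrite /= -/(p _) pE; apply: (pt_intQ HPi (rank2 F HPi)).
have wT w : w \in par finset.setT by rewrite parabolicT.
have [I [_ rI eI]] := reduced_ex HPi (wT ((w0 Xi)^-1 * w0 finset.setT)%g).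
have [J [_ rJ eJ]] := reduced_ex HPi (w0_mem Pi Xi).
have eJI : wd (J ++ I) = w0 finset.setT by rewrite wd_cat eJ eI mulKVg.
have rJI : reduced Pi (J ++ I).
  rewrite /reduced eJI size_cat -(eqP rJ) -(eqP rI) eI eJ.
  by rewrite (len_w0V HPi (wT _)).
exists (qw_act (XK I) p), (size (J ++ I) + size J)%N; split.
  apply: dual_act hp; apply: (@Xspan_DF _ _ _ _ _ (words finset.setT (size I))).
  by apply: Xspan_XK; rewrite /words leqnn andbT; apply/allP => i; rewrite !inE.
rewrite /push_pull_abs /push_pull qw_act_comp /= /qw_act_fun.
have -> : delta 1%g * (Y Xi * XK I) = Y Xi * XK I by exact: qw_mul1l.
rewrite -/(p _) pE (pairing_coef HPi (Xi := finset.setT) (u := w0 Xi)) //.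
- rewrite push_pull_coef w0_mem.
  have e1 := pt_coef_relV F HPi Xi; have e2 := pt_coef_lead F HPi rJ eJ.
  have := pt_coef_lead F HPi rJI eJI; rewrite lead_cat eJ exprD => <-.
  have sg : (-1 : Q) ^+ size J * (-1) ^+ size J = 1 by rewrite -exprMn mulrNN mulr1 expr1n.
  exact: cancel_involution e1 e2 sg.
- by move=> v; rewrite wT.
move=> v lv; rewrite push_pull_coef; case: ifP => // vXi.
by move: lv; rewrite -(len_w0M HPi vXi) ltnNge leq_addl.
Qed.

Lemma push_pull_abs_image Xi : A Xi @` DF_dual F Pi = DF_dual_inv F Pi Xi.
Proof.
apply/seteqP; split=> [_ [f hf <-]|h /dual_invP[hh hi]]; first exact: push_pull_abs_dual.
have [f [k [hf fk]]] := push_pull_abs_sign Xi.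
have /dual_invP[hg gi] := push_pull_abs_dual Xi hf.
have [u [hu gu]] := dual_unit reg HPi hg fk.
(* The inverse of an invariant function is invariant, which the projection formula needs below. *)
have ui v w : w \in par Xi -> u (delta (v * w)%g) = u (delta v).
  move=> wXi; rewrite -[LHS]mulr1 -(gu v) -(gi v w wXi) mulrA [X in X * _]mulrC gu.
  exact: mul1r.
exists (dual_mul (dual_mul f u) h); first by do 2 apply: DF_dual_mul => //.
apply: scalar_delta_ext => v; rewrite push_pull_abs_mul // push_pull_abs_mul // gu.
exact: mul1r.
Qed.

End Surjectivity.

Theorem corollary14p6 (R : comPzRingType) (F : fgl R) (D : root_datum)
  (reg : forall a : rootset D, GRing.lreg (fga_x F (fsval a)))
  (n : nat) (Pi : 'I_n -> rootset D) (Pi_simple : simple_roots Pi)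
  (Xi' Xi : {set 'I_n}) (Xi'_sub : Xi' \subset Xi) :
  [/\ push_pull_abs F Pi Xi @` DF_dual F Pi = DF_dual_inv F Pi Xi,
      forall T : {set weyl D}, left_coset_reps Pi Xi' Xi T ->
        set_fun (DF_dual_inv F Pi Xi') (DF_dual_inv F Pi Xi)
          (push_pull F Pi Xi' Xi T) /\
        set_surj (DF_dual_inv F Pi Xi') (DF_dual_inv F Pi Xi)
          (push_pull F Pi Xi' Xi T)
    & forall T1 T2 : {set weyl D},
        left_coset_reps Pi Xi' Xi T1 -> left_coset_reps Pi Xi' Xi T2 ->
        forall f, DF_dual_inv F Pi Xi' f ->
          push_pull F Pi Xi' Xi T1 f = push_pull F Pi Xi' Xi T2 f ].
Proof.
have im := push_pull_abs_image reg Pi_simple.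
have comp T f := @push_pull_abs_comp R F D n Pi Pi_simple Xi' Xi T f Xi'_sub.
split; first exact: im.
(* Invariants of either group are images of the absolute operators, so [comp] settles stability,
   surjectivity and independence of T alike. *)
- move=> T hT; split; move=> f; rewrite -!im => -[g hg <-].
    by exists g; rewrite // comp.
  by exists (push_pull_abs F Pi Xi' g); [exists g|rewrite comp].
move=> T1 T2 h1 h2 f; rewrite -im => -[g _ <-].
by rewrite !comp.
Qed.
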